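(* Let $n\ge 1$. There exist a bounded above chain complex $P_{1^n}\in\mathcal{K}^-(\mathbb{S}\mathbf{Bim}_n)$ and a map $\varepsilon:P_{1^n}\to R$ such that (P1) $P_{1^n}$ is homotopy equivalent to a chain complex whose chain bimodules are direct sums of shifted copies of $B_{w_0}$; (P2) $\mathrm{Cone}(\varepsilon)\otimes_RB_{w_0}\simeq B_{w_0}\otimes_R\mathrm{Cone}(\varepsilon)\simeq0$; (P3) $P_{1^n}\otimes_RP_{1^n}\simeq P_{1^n}$. If another pair $(P',\varepsilon')$, with $P'\in\mathcal{K}^-(\mathbb{S}\mathbf{Bim}_n)$ and $\varepsilon':P'\to R$, satisfies (P1) and (P2), then $P'$ is canonically homotopy equivalent to $P_{1^n}$; the canonical homotopy equivalence $\Phi:P'\to P_{1^n}$ is characterized up to homotopy by $\varepsilon\circ\Phi\simeq\varepsilon'$.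
   Context: $R=\mathbb{Q}[x_1,\dots,x_n]$ is graded with $\deg x_i=2$; $W=S_n$ permutes the variables; $w_0\in S_n$ is the longest element, of length $\ell=\frac12n(n-1)$; $R^W$ is the ring of symmetric polynomials. $M(k)$ is the upward shift, $(M(k))_i=M_{i-k}$. $B_{w_0}=R\otimes_{R^W}R(-\ell)$; for a simple transposition $s$ with invariant ring $R^s$, $B_s=R\otimes_{R^s}R(-1)$. $\mathbb{S}\mathbf{Bim}_n$ (Soergel bimodules) is the smallest full subcategory of graded $(R,R)$-bimodules containing $R$ and all $B_s$ and closed under (finite) direct sums, direct summands, grading shifts, and $\otimes_R$. $\mathcal{K}^-(\mathbb{S}\mathbf{Bim}_n)$ is the homotopy category of bounded above complexes over $\mathbb{S}\mathbf{Bim}_n$ (differentials of degree $+1$, morphisms of internal degree $0$). $\simeq$ denotes homotopy equivalence of complexes, or homotopy of maps. *)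

(* Defs.v *)
From HB Require Import structures.
From mathcomp Require Import all_boot all_order all_algebra all_fingroup.
From mathcomp Require Import generic_quotient ring_quotient.
From mathcomp Require Import boolp.
From mathcomp Require Import freeg mpoly.

Set Implicit Arguments.
Unset Strict Implicit.
Unset Printing Implicit Defensive.

Import GRing.Theory.
Local Open Scope ring_scope.
Local Open Scope quotient_scope.

(* V is the internal direct sum of the subgroups g i, for i : int. *)
Record grading (V : zmodType) (g : int -> V -> Prop) : Prop := Grading {
  gr0 : forall i, g i 0;
  grB : forall i u v, g i u -> g i v -> g i (u - v);
  gr_span : forall v, exists (s : seq int) (f : int -> V),
    (forall i, g i (f i)) /\ v = \sum_(i <- s) f i;
  gr_indep : forall (s : seq int) (f : int -> V), uniq s ->
    (forall i, g i (f i)) -> \sum_(i <- s) f i = 0 ->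
    forall i, i \in s -> f i = 0 }.

Section AdditiveMaps.
Variables (U V : zmodType) (f : U -> V).
Hypothesis hf : zmod_morphism f.

Lemma zm0 : f 0 = 0.
Proof. by rewrite -(subrr 0) hf subrr. Qed.

Lemma zmN u : f (- u) = - f u.
Proof. by rewrite -sub0r hf zm0 sub0r. Qed.

Lemma zmD u v : f (u + v) = f u + f v.
Proof. by rewrite -{1}[v]opprK hf zmN opprK. Qed.

Lemma zm_sum (I : Type) (s : seq I) (P : pred I) (F : I -> U) :
  f (\sum_(i <- s | P i) F i) = \sum_(i <- s | P i) f (F i).
Proof. exact: (big_morph f zmD zm0). Qed.
End AdditiveMaps.

Lemma big_supp (V : zmodType) (I : eqType) (s t : seq I) (F : I -> V) :
    uniq s -> uniq t -> (forall i, i \notin s -> F i = 0) ->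
    (forall i, i \notin t -> F i = 0) ->
  \sum_(i <- s) F i = \sum_(i <- t) F i.
Proof.
move=> us ut hs ht.
have aux (r : seq I) :
    \sum_(i <- r) F i = \sum_(i <- [seq i <- r | F i != 0]) F i.
  rewrite big_filter [LHS](bigID (fun i => F i != 0)) /= [X in _ + X]big1 ?addr0 //.
  by move=> i /negPn/eqP.
rewrite aux [RHS]aux; apply: perm_big; apply: uniq_perm; rewrite ?filter_uniq //.
move=> i; rewrite !mem_filter; case: eqVneq => //= /eqP hF.
case: (boolP (i \in s)) => [|/hs //]; case: (boolP (i \in t)) => // /ht //.
Qed.

Section Decompositions.
Variables (V : zmodType) (g : int -> V -> Prop).
Hypotheses (h0 : forall i, g i 0)
  (hB : forall i u v, g i u -> g i v -> g i (u - v)).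

Definition decomp v := exists (s : seq int) (f : int -> V),
  (forall i, g i (f i)) /\ v = \sum_(i <- s) f i.

Lemma decomp_norm v : decomp v -> exists p : (int -> V) * seq int,
  [/\ forall i, g i (p.1 i), uniq p.2, forall i, i \notin p.2 -> p.1 i = 0
    & v = \sum_(i <- p.2) p.1 i].
Proof.
have hD i u w : g i u -> g i w -> g i (u + w).
  by move=> hu hw; rewrite -[w]opprK -[- w]sub0r; apply: hB => //; exact: hB.
move=> [s [f [hf ->]]].
exists (fun i => \sum_(j <- s | j == i) f j, undup s); split=> /=.
- by move=> i; apply: big_ind => //; [exact: hD | move=> j /eqP->].
- exact: undup_uniq.
- move=> i; rewrite mem_undup => /negP hi; rewrite big_seq_cond big1 // => j.
  by case/andP=> js /eqP e; case: hi; rewrite -e.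
rewrite (exchange_big_dep xpredT) //=; apply: eq_big_seq => j js.
rewrite -big_filter (_ : [seq _ <- _ | _] = [:: j]) ?big_seq1 //.
rewrite (eq_filter (a2 := pred1 j)); last by move=> i; rewrite /= eq_sym.
by rewrite filter_pred1_uniq ?undup_uniq ?mem_undup.
Qed.

Lemma decompB u v : decomp u -> decomp v -> decomp (u - v).
Proof.
move=> /decomp_norm[[p s] /= [hp us ps ->]] /decomp_norm[[q t] /= [hq ut qt ->]].
exists (undup (s ++ t)), (fun i => p i - q i); split=> [i|]; first exact: hB.
rewrite sumrB; congr (_ - _); apply: big_supp; rewrite ?undup_uniq //.
  by move=> i; rewrite mem_undup mem_cat negb_or => /andP[/ps].
by move=> i; rewrite mem_undup mem_cat negb_or => /andP[_ /qt].
Qed.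

Lemma decomp_homog i u : g i u -> decomp u.
Proof.
move=> hu; exists [:: i], (fun j => if j == i then u else 0); split=> [j|].
  by case: eqP => [->|].
by rewrite big_seq1 eqxx.
Qed.

Lemma decomp_sum (I : Type) (s : seq I) (F : I -> V) :
  (forall i, decomp (F i)) -> decomp (\sum_(i <- s) F i).
Proof.
have d0 : decomp 0 by apply: (@decomp_homog 0).
move=> h; apply: big_ind => // u v hu hv.
by rewrite -[v]opprK -[- v]sub0r; apply: decompB => //; exact: decompB.
Qed.
End Decompositions.

Section Grading.
Variables (V : zmodType) (g : int -> V -> Prop).
Hypothesis hg : grading g.

Lemma grN i u : g i u -> g i (- u).
Proof. by move=> h; rewrite -sub0r; apply: (grB hg) => //; apply: gr0. Qed.

Lemma grD i u v : g i u -> g i v -> g i (u + v).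
Proof. by move=> hu /grN hv; rewrite -[v]opprK; apply: (grB hg). Qed.

Lemma gr_sum i (I : Type) (s : seq I) (P : pred I) (F : I -> V) :
  (forall j, P j -> g i (F j)) -> g i (\sum_(j <- s | P j) F j).
Proof. by move=> h; apply: big_ind => //; [exact: gr0 | exact: grD]. Qed.

Lemma gr_dec v : exists p : (int -> V) * seq int,
  [/\ forall i, g i (p.1 i), uniq p.2, forall i, i \notin p.2 -> p.1 i = 0
    & v = \sum_(i <- p.2) p.1 i].
Proof. by apply: (decomp_norm (gr0 hg) (grB hg)); exact: (gr_span hg). Qed.

(* The homogeneous components of v, and a finite set of degrees outside which
   they vanish. *)
Definition pr i v : V := (projT1 (cid (gr_dec v))).1 i.
Definition gsupp v : seq int := (projT1 (cid (gr_dec v))).2.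

Lemma pr_gr i v : g i (pr i v).
Proof. by rewrite /pr; case: cid => p []. Qed.

Lemma gsupp_uniq v : uniq (gsupp v).
Proof. by rewrite /gsupp; case: cid => p []. Qed.

Lemma pr_out i v : i \notin gsupp v -> pr i v = 0.
Proof. by rewrite /gsupp /pr; case: cid => p [? ? h ?]; exact: h. Qed.

Lemma pr_sum v : v = \sum_(i <- gsupp v) pr i v.
Proof. by rewrite /gsupp /pr; case: cid => p []. Qed.

Lemma pr_uniq (p : int -> V) s v : (forall i, g i (p i)) -> uniq s ->
  (forall i, i \notin s -> p i = 0) -> v = \sum_(i <- s) p i ->
  forall i, pr i v = p i.
Proof.
move=> hp us hs ev i; pose t := undup (gsupp v ++ s).
have ht j : j \notin t -> pr j v = 0 /\ p j = 0.
  by rewrite mem_undup mem_cat negb_or => /andP[/pr_out ? /hs].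
case: (boolP (i \in t)) => [it|/ht[-> ->] //].
apply/eqP; rewrite -subr_eq0; apply/eqP.
apply: (gr_indep hg (s := t) (f := fun i => pr i v - p i)) => //.
- exact: undup_uniq.
- by move=> j; apply: (grB hg) => //; exact: pr_gr.
rewrite sumrB; apply/eqP; rewrite subr_eq0; apply/eqP.
transitivity v.
  rewrite [RHS]pr_sum; apply: big_supp; rewrite ?undup_uniq ?gsupp_uniq //.
    by move=> j /ht[].
  by move=> j /pr_out.
rewrite [LHS]ev; apply: big_supp; rewrite ?undup_uniq //.
by move=> j /ht[].
Qed.

Lemma prB i : zmod_morphism (pr i).
Proof.
move=> u v; apply: (pr_uniq (p := fun i => pr i u - pr i v)
  (s := undup (gsupp u ++ gsupp v))).
- by move=> j; apply: (grB hg); apply: pr_gr.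
- exact: undup_uniq.
- move=> j; rewrite mem_undup mem_cat negb_or => /andP[/pr_out-> /pr_out->].
  by rewrite subrr.
rewrite sumrB; congr (_ - _); rewrite [LHS]pr_sum; apply: big_supp;
  rewrite ?undup_uniq ?gsupp_uniq //; try by move=> j /pr_out.
all: by move=> j; rewrite mem_undup mem_cat negb_or => /andP[/pr_out ? /pr_out].
Qed.

Lemma pr_id i j u : g i u -> pr j u = if j == i then u else 0.
Proof.
move=> hu; apply: (pr_uniq (p := fun j => if j == i then u else 0) (s := [:: i])).
- by move=> k; case: eqP => [->|_] //; apply: (gr0 hg).
- by [].
- by move=> k; rewrite inE => /negPf->.
by rewrite big_seq1 eqxx.
Qed.

Lemma eq_homog (Z : zmodType) (f h : V -> Z) :
    zmod_morphism f -> zmod_morphism h ->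
  (forall i u, g i u -> f u = h u) -> f =1 h.
Proof.
move=> hf hh e v; have [s [p [hp ->]]] := gr_span hg v.
by rewrite !zm_sum //; apply: eq_bigr => i _; apply: e (hp i).
Qed.

Definition gsum (Z : zmodType) (F : int -> V -> Z) v :=
  \sum_(i <- gsupp v) F i (pr i v).

Lemma gsum_is_additive (Z : zmodType) (F : int -> V -> Z) :
  (forall i, zmod_morphism (F i)) -> zmod_morphism (gsum F).
Proof.
move=> hF u v; pose t := undup (gsupp u ++ gsupp v ++ gsupp (u - v)).
have ht w : {subset gsupp w <= t} -> gsum F w = \sum_(i <- t) F i (pr i w).
  move=> hw; apply: big_supp; rewrite ?undup_uniq ?gsupp_uniq //.
    by move=> i /pr_out->; rewrite zm0.
  move=> i hi; rewrite pr_out ?zm0 //; apply/negP => /hw; exact/negP.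
rewrite !ht; try by move=> i hi; rewrite mem_undup !mem_cat hi ?orbT.
by rewrite -sumrB; apply: eq_bigr => i _; rewrite prB hF.
Qed.

Lemma gsum_gr (Z : zmodType) (F : int -> V -> Z) i u :
  (forall i, zmod_morphism (F i)) -> g i u -> gsum F u = F i u.
Proof.
move=> hF hu; transitivity (\sum_(j <- [:: i]) F j (pr j u)).
  rewrite /gsum.
  apply: big_supp; rewrite ?gsupp_uniq //.
    by move=> j /pr_out->; rewrite zm0.
  by move=> j; rewrite inE (pr_id j hu) => /negPf->; rewrite zm0.
by rewrite big_seq1 (pr_id i hu) eqxx.
Qed.

End Grading.

Lemma gr_signZ (A : comNzRingType) (L : lmodType A) (h : int -> L -> Prop) i k u :
  grading h -> h i u -> h i ((-1) ^+ k *: u).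
Proof.
move=> hh hu; rewrite -signr_odd; case: (odd k); rewrite ?expr0 ?scale1r //.
by rewrite expr1 scaleN1r; apply: grN.
Qed.

Lemma grading_proj (V : zmodType) (g : int -> V -> Prop) (p : int -> V -> V) :
    (forall i, g i 0) -> (forall i u v, g i u -> g i v -> g i (u - v)) ->
    (forall v, exists (s : seq int) (f : int -> V),
      (forall i, g i (f i)) /\ v = \sum_(i <- s) f i) ->
    (forall i, zmod_morphism (p i)) ->
    (forall i j u, g i u -> p j u = if j == i then u else 0) ->
  grading g.
Proof.
move=> h0 hB hs pB pid; split=> // s f us hf e i hi.
have := congr1 (p i) e; rewrite zm_sum // zm0 // (bigD1_seq i) //= big1.
  by rewrite (pid i) // eqxx addr0.
by move=> j /negPf nj; rewrite (pid j) // eq_sym nj.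
Qed.

Record gradedRing := GradedRing {
  gring :> comNzRingType;
  rdeg : int -> gring -> Prop;
  rdeg_grading : grading rdeg;
  rdeg1 : rdeg 0 1;
  rdegM : forall i j a b, rdeg i a -> rdeg j b -> rdeg (i + j) (a * b) }.

Record gradedSubring (A : gradedRing) := GradedSubring {
  smem :> A -> Prop;
  smem1 : smem 1;
  smemB : forall a b, smem a -> smem b -> smem (a - b);
  smemM : forall a b, smem a -> smem b -> smem (a * b);
  smem_span : forall a, smem a -> exists (s : seq int) (f : int -> A),
    (forall i, rdeg i (f i) /\ smem (f i)) /\ a = \sum_(i <- s) f i }.

(* A graded (A, A)-bimodule: the left action is the scaling of the underlying
   lmodType, the right action is ract. *)
Record gbimod (A : gradedRing) := GBimod {
  gcar :> lmodType A;
  ract : gcar -> A -> gcar;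
  ractDl : forall a m m', ract (m + m') a = ract m a + ract m' a;
  ractDr : forall a b m, ract m (a + b) = ract m a + ract m b;
  ractA : forall a b m, ract m (a * b) = ract (ract m a) b;
  ract1 : forall m, ract m 1 = m;
  ractZ : forall a b m, a *: ract m b = ract (a *: m) b;
  gdeg : int -> gcar -> Prop;
  gdeg_grading : grading gdeg;
  gdegl : forall i j a m, rdeg i a -> gdeg j m -> gdeg (i + j) (a *: m);
  gdegr : forall i j a m, gdeg i m -> rdeg j a -> gdeg (i + j) (ract m a) }.

Section Bimodules.
Variable A : gradedRing.
Implicit Types M N : gbimod A.

Lemma ractl_additive M a : zmod_morphism (fun m : M => ract m a).
Proof. by move=> m m'; apply: (canRL (addrK _)); rewrite -ractDl subrK. Qed.

Lemma ractr_additive M (m : M) : zmod_morphism (ract m).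
Proof. by move=> a b; apply: (canRL (addrK _)); rewrite -ractDr subrK. Qed.

Lemma scalel_additive M a : zmod_morphism (fun m : M => a *: m).
Proof. by move=> m m'; rewrite scalerBr. Qed.

Lemma scaler_additive M (m : M) : zmod_morphism (fun a => a *: m).
Proof. by move=> a b; rewrite scalerBl. Qed.

(* Morphisms have internal degree 0. *)
Record bhom M N := BHom {
  bfun :> {linear M -> N};
  bhomr : forall m a, bfun (ract m a) = ract (bfun m) a;
  bhom_deg : forall i m, gdeg i m -> gdeg i (bfun m) }.

Definition mk_bhom M N (f : M -> N) (fl : linear f)
    (fr : forall m a, f (ract m a) = ract (f m) a)
    (fd : forall i m, gdeg i m -> gdeg i (f m)) : bhom M N :=
  @BHom M N (HB.pack f (GRing.isLinear.Build A M N *:%R f fl)) fr fd.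

Lemma bhomB M N (f : bhom M N) : zmod_morphism f.
Proof. exact: linearB. Qed.

Definition bid M : bhom M M.
Proof. by apply: (@mk_bhom M M id). Defined.

Definition bcomp M N K (f : bhom N K) (g : bhom M N) : bhom M K.
Proof.
apply: (@mk_bhom M K (f \o g)) => [a u v|m a|i m h] /=.
- by rewrite !linearP.
- by rewrite !bhomr.
- by do 2!apply: bhom_deg.
Defined.

Definition bzero_hom M N : bhom M N.
Proof.
apply: (@mk_bhom M N (fun=> 0)) => [a u v|m a|i m h] /=.
- by rewrite scaler0 addr0.
- by rewrite (zm0 (@ractl_additive N a)).
- exact: gr0 (gdeg_grading N) i.
Defined.

Definition biso M N : Prop :=
  exists (f : bhom M N) (g : bhom N M), cancel f g /\ cancel g f.

Definition is_zero M : Prop := forall m : M, m = 0.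

Definition bzero : gbimod A.
Proof.
apply: (@GBimod A 'rV[A]_0 (fun m _ => m) _ _ _ _ _ (fun _ _ => True)) => //.
all: try by move=> *; rewrite ?thinmx0 // [RHS]thinmx0 [LHS]thinmx0.
split=> //.
  by move=> v; exists [::], (fun=> 0); rewrite big_nil thinmx0.
by move=> *; rewrite thinmx0.
Defined.

Definition breg : gbimod A.
Proof.
apply: (@GBimod A A^o (fun m a => m * a) _ _ _ _ _ (@rdeg A)).
- by move=> a m m'; rewrite mulrDl.
- by move=> a b m; rewrite mulrDr.
- by move=> a b m; rewrite mulrA.
- by move=> m; rewrite mulr1.
- by move=> a b m; rewrite /GRing.scale /= mulrA.
- exact: rdeg_grading.
- by move=> i j a m; apply: rdegM.
- by move=> i j a m; apply: rdegM.
Defined.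

(* M(k), with M(k)_i = M_(i - k) *)
Definition bshift (k : int) M : gbimod A.
Proof.
apply: (@GBimod A M (@ract A M) _ _ _ _ _ (fun i => @gdeg A M (i - k))).
- exact: ractDl.
- exact: ractDr.
- exact: ractA.
- exact: ract1.
- exact: ractZ.
- split.
  + by move=> i; apply: (gr0 (gdeg_grading M)).
  + by move=> i u v; apply: (grB (gdeg_grading M)).
  + move=> v; have [s [f [hf ->]]] := gr_span (gdeg_grading M) v.
    exists [seq i + k | i <- s], (fun i => f (i - k)); split=> [i //|].
    by rewrite big_map; apply: eq_bigr => i _; rewrite addrK.
  + move=> s f us hf e i si; rewrite -[i](subrK k).
    apply: (gr_indep (gdeg_grading M) (s := [seq j - k | j <- s])
      (f := fun j => f (j + k))).
    * by rewrite map_inj_uniq // => x y /addIr.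
    * by move=> j; have := hf (j + k); rewrite addrK.
    * by rewrite big_map -[RHS]e; apply: eq_bigr => j _; rewrite subrK.
    * exact: map_f.
- by move=> i j a m ha; rewrite -addrA; apply: gdegl.
- by move=> i j a m hm ha; rewrite addrAC; apply: gdegr.
Defined.

Definition bsum M N : gbimod A.
Proof.
apply: (@GBimod A (M * N)%type (fun m a => (ract m.1 a, ract m.2 a))
  _ _ _ _ _ (fun i m => gdeg i m.1 /\ gdeg i m.2)).
- by move=> a m m'; rewrite /= !ractDl.
- by move=> a b m; rewrite !ractDr.
- by move=> a b m; rewrite !ractA.
- by case=> m n; rewrite !ract1.
- by move=> a b [m n]; exact: (congr2 pair (ractZ a b m) (ractZ a b n)).
- have hM := gdeg_grading M; have hN := gdeg_grading N.
  apply: (grading_proj (p := fun i m => (pr hM i m.1, pr hN i m.2))).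
  + by move=> i; split; apply: gr0.
  + by move=> i u v [? ?] [? ?]; split; [apply: (grB hM)|apply: (grB hN)].
  + move=> [m n]; pose s := undup (gsupp hM m ++ gsupp hN n).
    exists s, (fun i => (pr hM i m, pr hN i n)); split=> [i|].
      by split; apply: pr_gr.
    transitivity (\sum_(i <- s) pr hM i m, \sum_(i <- s) pr hN i n); last first.
      by elim: s => [|i s IH]; rewrite ?big_nil // !big_cons -IH.
    rewrite {1}(pr_sum hM m) {1}(pr_sum hN n); congr pair; apply: big_supp;
      rewrite ?undup_uniq ?gsupp_uniq //; try by move=> i /pr_out.
      by move=> i; rewrite /s mem_undup mem_cat negb_or => /andP[/pr_out ? /pr_out].
    by move=> i; rewrite /s mem_undup mem_cat negb_or => /andP[/pr_out ? /pr_out].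
  + by move=> i u v; rewrite /= !prB.
  + move=> i j [u v] [/= hu hv]; rewrite (pr_id hM j hu) (pr_id hN j hv).
    by case: ifP.
- by move=> i j a m ha [? ?]; split; apply: gdegl.
- by move=> i j a m [? ?] ha; split; apply: gdegr.
Defined.

End Bimodules.

Inductive span (V : zmodType) (G : V -> Prop) : V -> Prop :=
| span_gen v : G v -> span G v
| span0 : span G 0
| spanB u v : span G u -> span G v -> span G (u - v).

Lemma spanN (V : zmodType) (G : V -> Prop) v : span G v -> span G (- v).
Proof. by move=> h; rewrite -sub0r; apply: spanB => //; exact: span0. Qed.

Lemma spanD (V : zmodType) (G : V -> Prop) u v :
  span G u -> span G v -> span G (u + v).
Proof. by move=> hu /spanN hv; rewrite -[v]opprK; apply: spanB. Qed.

Definition subgrp (V : zmodType) (G : V -> Prop) : {pred V} :=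
  fun v => `[< span G v >].

Lemma subgrp_closed (V : zmodType) (G : V -> Prop) : zmod_closed (subgrp G).
Proof.
split; first by apply/asboolP; exact: span0.
by move=> u v /asboolP hu /asboolP hv; apply/asboolP; exact: spanB.
Qed.

HB.instance Definition _ (V : zmodType) (G : V -> Prop) :=
  GRing.isZmodClosed.Build V (subgrp G) (subgrp_closed G).

Section FreeLift.
Variables (X : choiceType) (Z : zmodType) (f : X -> Z).

Definition freelift (D : {freeg X}) : Z := fglift (f : X -> zmodule Z) D.

Lemma freelift_additive : zmod_morphism freelift.
Proof. exact: (lift_is_additive (f : X -> zmodule Z)). Qed.

Lemma freeliftU x : freelift << x >> = f x.
Proof. by rewrite /freelift liftU scale1r. Qed.
End FreeLift.

Section Tensor.
Variables (A : gradedRing) (S : gradedSubring A) (M N : gbimod A).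

(* tens S M N is M (x)_S N, for a subring S of A: the free abelian group on
   M x N modulo biadditivity and (m s, n) = (m, s n) for s in S. *)
Inductive tens_rel : {freeg (M * N)%type} -> Prop :=
| tens_relDl m m' n : tens_rel (<< (m + m', n) >> - << (m, n) >> - << (m', n) >>)
| tens_relDr m n n' : tens_rel (<< (m, n + n') >> - << (m, n) >> - << (m, n') >>)
| tens_relM m a n : smem S a -> tens_rel (<< (ract m a, n) >> - << (m, a *: n) >>).

Definition tens : Type := Quotient.quot (subgrp tens_rel).

HB.instance Definition _ := GRing.Zmodule.on tens.

Definition pure (m : M) (n : N) : tens := \pi << (m, n) >>.

Definition balanced (Z : zmodType) (f : M -> N -> Z) : Prop :=
  [/\ forall n, zmod_morphism (f^~ n), forall m, zmod_morphism (f m)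
    & forall m a n, smem S a -> f (ract m a) n = f m (a *: n)].

Definition tlift (Z : zmodType) (f : M -> N -> Z) (t : tens) : Z :=
  freelift (fun x => f x.1 x.2) (repr t).

Lemma tpi_additive : zmod_morphism (\pi : {freeg (M * N)%type} -> tens).
Proof. by move=> u v; rewrite !piE. Qed.

Lemma eq_tens u v : subgrp tens_rel (u - v) -> \pi u = \pi v :> tens.
Proof. by move=> h; apply/eqP; rewrite piE. Qed.

Lemma pureDl m m' n : pure (m + m') n = pure m n + pure m' n.
Proof.
rewrite /pure -(zmD tpi_additive); apply: eq_tens; apply/asboolP.
by rewrite opprD addrA; apply/span_gen/tens_relDl.
Qed.

Lemma pureDr m n n' : pure m (n + n') = pure m n + pure m n'.
Proof.
rewrite /pure -(zmD tpi_additive); apply: eq_tens; apply/asboolP.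
by rewrite opprD addrA; apply/span_gen/tens_relDr.
Qed.

Lemma pureM m a n : smem S a -> pure (ract m a) n = pure m (a *: n).
Proof. by move=> h; apply: eq_tens; apply/asboolP/span_gen/tens_relM. Qed.

Lemma pureBl n : zmod_morphism (pure^~ n).
Proof. by move=> m m'; apply: (canRL (addrK _)); rewrite -pureDl subrK. Qed.

Lemma pureBr m : zmod_morphism (pure m).
Proof. by move=> n n'; apply: (canRL (addrK _)); rewrite -pureDr subrK. Qed.

Lemma pure_balanced : balanced pure.
Proof. by split=> [n|m|m a n]; [exact: pureBl|exact: pureBr|exact: pureM]. Qed.

Lemma tens_span t : span (fun u : tens => exists m n, u = pure m n) t.
Proof.
rewrite -[t]reprK -(freeg_sumE (repr t)) (zm_sum tpi_additive).
apply: big_ind => [|u v|z _]; [exact: span0|exact: spanD|].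
have h : span (fun u : tens => exists m n, u = pure m n) (\pi << z >>).
  by apply: span_gen; exists z.1, z.2; rewrite /pure -surjective_pairing.
have hn k : span (fun u : tens => exists m n, u = pure m n) (\pi << k%:Z *g z >>).
  elim: k => [|k IH]; first by rewrite freegU0 (zm0 tpi_additive); exact: span0.
  by rewrite intS -freegUD (zmD tpi_additive); apply: spanD.
case: (coeff z _) => k //; rewrite NegzE -freegUN (zmN tpi_additive).
exact: spanN.
Qed.

Lemma tens_ext (Z : zmodType) (f h : tens -> Z) :
    zmod_morphism f -> zmod_morphism h ->
  (forall m n, f (pure m n) = h (pure m n)) -> f =1 h.
Proof.
move=> hf hh e t; elim: (tens_span t) => [_ [m [n ->]]||u v _ eu _ ev].
- exact: e.
- by rewrite !zm0.
- by rewrite hf hh eu ev.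
Qed.

Section Lift.
Variables (Z : zmodType) (f : M -> N -> Z).
Hypothesis hf : balanced f.

Lemma freelift_rel D : subgrp tens_rel D -> freelift (fun x => f x.1 x.2) D = 0.
Proof.
case: hf => hl hr hm; move/asboolP; elim=> {D} [_ [m m' n|m n n'|m a n sa]||u v _ eu _ ev].
- rewrite !freelift_additive !freeliftU /= (zmD (hl n)).
  by rewrite [_ + f m' n]addrC addrK subrr.
- rewrite !freelift_additive !freeliftU /= (zmD (hr m)).
  by rewrite [_ + f m n']addrC addrK subrr.
- by rewrite freelift_additive !freeliftU /= hm // subrr.
- by rewrite (zm0 (freelift_additive _)).
- by rewrite freelift_additive eu ev subrr.
Qed.

Lemma tliftE D : tlift f (\pi D) = freelift (fun x => f x.1 x.2) D.
Proof.
apply/eqP; rewrite -subr_eq0 -freelift_additive; apply/eqP/freelift_rel.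
by have /eqP := reprK (\pi D : tens); rewrite piE.
Qed.

Lemma tlift_additive : zmod_morphism (tlift f).
Proof.
move=> t u; rewrite -[t]reprK -[u]reprK -tpi_additive !tliftE.
exact: freelift_additive.
Qed.

Lemma tlift_pure m n : tlift f (pure m n) = f m n.
Proof. by rewrite tliftE freeliftU. Qed.
End Lift.
End Tensor.

Section TensorBimodule.
Variables (A : gradedRing) (S : gradedSubring A) (M N : gbimod A).
Local Notation T := (tens S M N).
Local Notation "m (x) n" := (pure S m n) (at level 40).

Definition tscale (a : A) : T -> T := tlift (fun m n => (a *: m) (x) n).
Definition tract (t : T) (a : A) : T := tlift (fun m n => m (x) ract n a) t.

Lemma tscale_balanced a : balanced S (fun (m : M) (n : N) => (a *: m) (x) n).
Proof.
split=> [n m m'|m|m b n sb].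
- by rewrite scalerBr pureBl.
- exact: pureBr.
- by rewrite ractZ pureM.
Qed.

Lemma tract_balanced a : balanced S (fun (m : M) (n : N) => m (x) ract n a).
Proof.
split=> [n|m n n'|m b n sb].
- exact: pureBl.
- by rewrite ractl_additive pureBr.
- by rewrite pureM // ractZ.
Qed.

Lemma tscale_additive a : zmod_morphism (tscale a).
Proof. exact: tlift_additive (tscale_balanced a). Qed.

Lemma tract_additive a : zmod_morphism (tract^~ a).
Proof. exact: tlift_additive (tract_balanced a). Qed.

Lemma tscale_pure a m n : tscale a (m (x) n) = (a *: m) (x) n.
Proof. exact: tlift_pure (tscale_balanced a) m n. Qed.

Lemma tract_pure a m n : tract (m (x) n) a = m (x) ract n a.
Proof. exact: tlift_pure (tract_balanced a) m n. Qed.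

Lemma tscaleA a b (t : T) : tscale a (tscale b t) = tscale (a * b) t.
Proof.
move: t; apply: tens_ext; try exact: tscale_additive.
  by move=> t u; rewrite !tscale_additive.
by move=> m n; rewrite !tscale_pure scalerA.
Qed.

Lemma tscale1 (t : T) : tscale 1 t = t.
Proof.
move: t; apply: tens_ext; try exact: tscale_additive; first by [].
by move=> m n; rewrite tscale_pure scale1r.
Qed.

Lemma tscaleDr : right_distributive tscale +%R.
Proof. by move=> a t u; apply: zmD; exact: tscale_additive. Qed.

Lemma tscaleDl (t : T) : {morph tscale^~ t : a b / a + b}.
Proof.
move=> a b /=; move: t; apply: tens_ext; try exact: tscale_additive.
  by move=> t u; rewrite !tscale_additive opprD addrACA.
by move=> m n; rewrite !tscale_pure scalerDl pureDl.
Qed.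

HB.instance Definition _ :=
  GRing.Zmodule_isLmodule.Build A T tscaleA tscale1 tscaleDr tscaleDl.

Lemma scale_pure a m n : a *: (m (x) n) = (a *: m) (x) n.
Proof. exact: tscale_pure. Qed.

Let hM := gdeg_grading M.
Let hN := gdeg_grading N.

(* The degree k part is spanned by the m (x) n with deg m + deg n = k. *)
Definition tdeg (k : int) : T -> Prop :=
  span (fun t => exists i j m n,
    [/\ gdeg i m, gdeg j n, i + j = k & t = m (x) n]).

Definition tpr_fun (k : int) (m : M) (n : N) : T :=
  gsum hM (fun i m => m (x) pr hN (k - i) n) m.

Lemma tpr_fun_homog k i m n : gdeg i m -> tpr_fun k m n = m (x) pr hN (k - i) n.
Proof. by move=> hm; apply: (gsum_gr hM) hm => j; exact: pureBl. Qed.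

Lemma tpr_fun_additivel k n : zmod_morphism (tpr_fun k ^~ n).
Proof. by apply: gsum_is_additive => i; exact: pureBl. Qed.

Lemma tpr_fun_additiver k m : zmod_morphism (tpr_fun k m).
Proof.
move=> n n'; rewrite /tpr_fun /gsum -sumrB; apply: eq_bigr => i _.
by rewrite prB pureBr.
Qed.

Lemma pr_scale d j a n : rdeg d a -> pr hN j (a *: n) = a *: pr hN (j - d) n.
Proof.
move=> ha; move: n; apply: (eq_homog hN) => [n n'|n n'|i n hn].
- by rewrite scalerBr prB.
- by rewrite prB scalerBr.
rewrite (pr_id hN _ (gdegl ha hn)) (pr_id hN _ hn) subr_eq [i + d]addrC.
by case: ifP; rewrite ?scaler0.
Qed.

Lemma tpr_balanced k : balanced S (tpr_fun k).
Proof.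
split=> [n|m|m a n sa]; [exact: tpr_fun_additivel|exact: tpr_fun_additiver|].
have [s [f [hf ->]]] := smem_span sa.
rewrite (zm_sum (ractr_additive m)) (zm_sum (tpr_fun_additivel k n)).
rewrite (zm_sum (scaler_additive n)) (zm_sum (tpr_fun_additiver k m)).
apply: eq_bigr => d _; case: (hf d) => da {}sa.
move: m; apply: (eq_homog hM) => [m m'|m m'|i m hm].
- by rewrite ractl_additive tpr_fun_additivel.
- by rewrite tpr_fun_additivel.
rewrite (tpr_fun_homog k n (gdegr hm da)) (tpr_fun_homog k _ hm) pureM //.
by rewrite (pr_scale _ _ da) opprD addrA.
Qed.

Lemma tdeg_grading : grading tdeg.
Proof.
have t0 i : tdeg i 0 by exact: span0.
have tB i u v : tdeg i u -> tdeg i v -> tdeg i (u - v) by exact: spanB.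
have pB k := tlift_additive (tpr_balanced k).
apply: (grading_proj (p := fun k => tlift (tpr_fun k))) => //.
- move=> t; elim: (tens_span t) => [_ [m [n ->]]||u v _ du _ dv].
  + rewrite (pr_sum hM m) (zm_sum (pureBl S n)).
    apply: decomp_sum => // i.
    rewrite (pr_sum hN n) (zm_sum (pureBr S _)).
    apply: decomp_sum => // j.
    apply: (@decomp_homog _ _ t0 (i + j)); apply: span_gen.
    by exists i, j, (pr hM i m), (pr hN j n); split=> //; exact: pr_gr.
  + exact: (@decomp_homog _ _ t0 0).
  + exact: decompB.
- move=> k l t; elim=> {t} [_ [i [j [m [n [hm hn <- ->]]]]]||u v _ eu _ ev].
  + rewrite (tlift_pure (tpr_balanced l)) (tpr_fun_homog l n hm) (pr_id hN _ hn).
    rewrite subr_eq [j + i]addrC; case: ifP => // _.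
    exact: zm0 (pureBr S m).
  + by rewrite zm0 //; case: ifP.
  + by rewrite pB eu ev; case: ifP => // _; rewrite subrr.
Qed.

Definition btens : gbimod A.
Proof.
apply: (@GBimod A T tract _ _ _ _ _ tdeg).
- by move=> a t u; apply: zmD; exact: tract_additive.
- move=> a b; apply: tens_ext; try exact: tract_additive.
    by move=> t u; rewrite !tract_additive opprD addrACA.
  by move=> m n; rewrite !tract_pure ractDr pureDr.
- move=> a b; apply: tens_ext; try exact: tract_additive.
    by move=> t u; rewrite !tract_additive.
  by move=> m n; rewrite !tract_pure ractA.
- apply: tens_ext; [exact: tract_additive|by []|].
  by move=> m n; rewrite !tract_pure ract1.
- move=> a b; apply: tens_ext.
  + by move=> t u; rewrite tract_additive scalerBr.
  + by move=> t u; rewrite scalerBr tract_additive.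
  + by move=> m n; rewrite tract_pure !scale_pure tract_pure.
- exact: tdeg_grading.
- move=> d k a t ha; elim=> {t} [_ [i [j [m [n [hm hn <- ->]]]]]||u v _ du _ dv].
  + rewrite scale_pure; apply: span_gen; exists (d + i), j, (a *: m), n.
    by split=> //; [exact: gdegl|rewrite addrA].
  + by rewrite scaler0; exact: span0.
  + by rewrite scalerBr; exact: spanB.
- move=> k d a t + ha; elim=> {t} [_ [i [j [m [n [hm hn <- ->]]]]]||u v _ du _ dv].
  + rewrite tract_pure; apply: span_gen; exists i, (j + d), m, (ract n a).
    by split=> //; [exact: gdegr|rewrite addrA].
  + by rewrite (zm0 (tract_additive a)); exact: span0.
  + by rewrite tract_additive; exact: spanB.
Defined.

End TensorBimodule.

Section DirectSum.
Variables (A : gradedRing) (I : choiceType) (M : I -> gbimod A).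

Record dsum := Dsum {
  dfun :> forall i, M i;
  dfin : exists s : seq I, forall i, i \notin s -> dfun i = 0 }.

HB.instance Definition _ := gen_eqMixin dsum.
HB.instance Definition _ := gen_choiceMixin dsum.

Lemma dsum_ext (x y : dsum) : (forall i, x i = y i) -> x = y.
Proof.
case: x y => [x hx] [y hy] /= e.
have {}e : x = y by apply: functional_extensionality_dep.
by case: _ / e hy => hy; congr Dsum; exact: Prop_irrelevance.
Qed.

Definition dsum_zero : dsum.
Proof. by exists (fun=> 0); exists [::]. Defined.

Definition dsum_opp (x : dsum) : dsum.
Proof.
exists (fun i => - x i); case: (dfin x) => s hs; exists s => i /hs->.
exact: oppr0.
Defined.

Definition dsum_add (x y : dsum) : dsum.
Proof.
exists (fun i => x i + y i); case: (dfin x) (dfin y) => [s hs] [t ht].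
exists (s ++ t) => i; rewrite mem_cat negb_or => /andP[/hs-> /ht->].
exact: addr0.
Defined.

Definition dsum_scale (a : A) (x : dsum) : dsum.
Proof.
exists (fun i => a *: x i); case: (dfin x) => s hs; exists s => i /hs->.
exact: scaler0.
Defined.

Definition dsum_ract (x : dsum) (a : A) : dsum.
Proof.
exists (fun i => ract (x i) a); case: (dfin x) => s hs; exists s => i /hs->.
exact: zm0 (ractl_additive a).
Defined.

Lemma dsum_addA : associative dsum_add.
Proof. by move=> x y z; apply: dsum_ext => i; exact: addrA. Qed.
Lemma dsum_addC : commutative dsum_add.
Proof. by move=> x y; apply: dsum_ext => i; exact: addrC. Qed.
Lemma dsum_add0 : left_id dsum_zero dsum_add.
Proof. by move=> x; apply: dsum_ext => i; exact: add0r. Qed.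
Lemma dsum_addN : left_inverse dsum_zero dsum_opp dsum_add.
Proof. by move=> x; apply: dsum_ext => i; exact: addNr. Qed.

HB.instance Definition _ :=
  GRing.isZmodule.Build dsum dsum_addA dsum_addC dsum_add0 dsum_addN.

Lemma dsum_scaleA a b x : dsum_scale a (dsum_scale b x) = dsum_scale (a * b) x.
Proof. by apply: dsum_ext => i; exact: scalerA. Qed.
Lemma dsum_scale1 : left_id 1 dsum_scale.
Proof. by move=> x; apply: dsum_ext => i; exact: scale1r. Qed.
Lemma dsum_scaleDr : right_distributive dsum_scale +%R.
Proof. by move=> a x y; apply: dsum_ext => i; exact: scalerDr. Qed.
Lemma dsum_scaleDl x : {morph dsum_scale^~ x : a b / a + b}.
Proof. by move=> a b; apply: dsum_ext => i; exact: scalerDl. Qed.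

HB.instance Definition _ := GRing.Zmodule_isLmodule.Build A dsum
  dsum_scaleA dsum_scale1 dsum_scaleDr dsum_scaleDl.

Lemma dsum_evalB i : zmod_morphism (fun x : dsum => x i).
Proof. by []. Qed.

Lemma dsum_evalZ i a (x : dsum) : (a *: x) i = a *: x i.
Proof. by []. Qed.

Definition dsupp (x : dsum) : seq I := undup (projT1 (cid (dfin x))).

Lemma dsupp_uniq x : uniq (dsupp x).
Proof. exact: undup_uniq. Qed.

Lemma dsupp_out x i : i \notin dsupp x -> x i = 0.
Proof. by rewrite /dsupp mem_undup; case: cid => s /= h /h. Qed.

Definition dinc i (u : M i) : dsum.
Proof.
exists (dfwith (fun j => 0 : M j) u); exists [:: i] => j.
by rewrite inE => ij; rewrite dfwith_out // eq_sym.
Defined.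

Lemma dinc_in i (u : M i) : dinc u i = u.
Proof. exact: dfwith_in. Qed.

Lemma dinc_out i j (u : M i) : j != i -> dinc u j = 0.
Proof. by move=> h; apply: dfwith_out; rewrite eq_sym. Qed.

Lemma dincP i (P : forall j, M j -> Prop) (u : M i) :
  P i u -> (forall j, P j 0) -> forall j, P j (dinc u j).
Proof.
move=> hu h0 j; have [->|ji] := eqVneq j i; first by rewrite dinc_in.
by rewrite dinc_out.
Qed.

Lemma dinc_additive i : zmod_morphism (@dinc i).
Proof.
move=> u v; apply: dsum_ext => j; rewrite dsum_evalB.
have [->|ji] := eqVneq j i; first by rewrite !dinc_in.
by rewrite !dinc_out // subrr.
Qed.

Lemma dincZ i a (u : M i) : dinc (a *: u) = a *: dinc u.
Proof.
apply: dsum_ext => j; rewrite dsum_evalZ.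
have [->|ji] := eqVneq j i; first by rewrite !dinc_in.
by rewrite !dinc_out // scaler0.
Qed.

Lemma dinc_ract i a (u : M i) : dinc (ract u a) = dsum_ract (dinc u) a.
Proof.
apply: dsum_ext => j; rewrite /=.
have [->|ji] := eqVneq j i; first by rewrite !dfwith_in.
by rewrite !dfwith_out ?(zm0 (ractl_additive a)) // eq_sym.
Qed.

Lemma dsum_decomp (x : dsum) : x = \sum_(i <- dsupp x) dinc (x i).
Proof.
apply: dsum_ext => j; rewrite (zm_sum (dsum_evalB j)).
have -> : \sum_(i <- dsupp x) dinc (x i) j =
    \sum_(i <- dsupp x) (if i == j then x j else 0).
  apply: eq_bigr => i _; case: eqVneq => [->|ij]; first exact: dinc_in.
  by apply: dinc_out; rewrite eq_sym.
transitivity (\sum_(i <- [:: j]) (if i == j then x j else 0)).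
  by rewrite big_seq1 eqxx.
apply: big_supp; rewrite ?dsupp_uniq //.
- by move=> i; rewrite inE => /negPf->.
- by move=> i; case: eqP => // -> /dsupp_out.
Qed.

Section Lift.
Variables (Z : zmodType) (F : forall i, M i -> Z).

Definition dlift (x : dsum) : Z := \sum_(i <- dsupp x) F (x i).

Hypothesis hF : forall i, zmod_morphism (@F i).

Lemma dliftE (x : dsum) (s : seq I) : uniq s ->
  (forall i, i \notin s -> x i = 0) -> dlift x = \sum_(i <- s) F (x i).
Proof.
move=> us hs; apply: big_supp; rewrite ?dsupp_uniq //.
- by move=> i /dsupp_out->; rewrite zm0.
- by move=> i /hs->; rewrite zm0.
Qed.

Lemma dlift_additive : zmod_morphism dlift.
Proof.
move=> x y; pose s := undup (dsupp x ++ dsupp y).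
have hs i : i \notin s -> x i = 0 /\ y i = 0.
  by rewrite mem_undup mem_cat negb_or => /andP[/dsupp_out ? /dsupp_out].
rewrite !(@dliftE _ s) ?undup_uniq //; try by move=> i /hs[].
  by rewrite -sumrB; apply: eq_bigr => i _; rewrite dsum_evalB hF.
by move=> i /hs[xi yi]; rewrite dsum_evalB xi yi subrr.
Qed.

Lemma dlift_inc i (u : M i) : dlift (dinc u) = F u.
Proof.
rewrite (@dliftE _ [:: i]) //; first by rewrite big_seq1 dinc_in.
by move=> j; rewrite inE; exact: dinc_out.
Qed.
End Lift.

Lemma eq_dsum (Z : zmodType) (f h : dsum -> Z) :
    zmod_morphism f -> zmod_morphism h ->
  (forall i (u : M i), f (dinc u) = h (dinc u)) -> f =1 h.
Proof.
move=> hf hh e x; rewrite (dsum_decomp x) !zm_sum //.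
by apply: eq_bigr => i _; exact: e.
Qed.

Lemma dsum_grading : grading (fun k (x : dsum) => forall i, gdeg k (x i)).
Proof.
have h0 k : forall i, gdeg k ((0 : dsum) i).
  by move=> i; apply: (gr0 (gdeg_grading (M i))).
have hB k (x y : dsum) : (forall i, gdeg k (x i)) -> (forall i, gdeg k (y i)) ->
    forall i, gdeg k ((x - y) i).
  by move=> hx hy i; apply: (grB (gdeg_grading (M i))).
pose dS := decomp_sum (g := fun k (x : dsum) => forall i, gdeg k (x i)) h0 hB.
split=> //.
- move=> x; rewrite (dsum_decomp x); apply: (dS) => i.
  rewrite (pr_sum (gdeg_grading (M i)) (x i)) (zm_sum (@dinc_additive i)).
  apply: (dS) => k; apply: (decomp_homog h0 (i := k)).
  apply: (dincP (P := fun j u => gdeg k u)); first exact: pr_gr.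
  by move=> j; apply: (gr0 (gdeg_grading (M j))).
- move=> s f us hf e k ks; apply: dsum_ext => i.
  apply: (gr_indep (gdeg_grading (M i)) (f := fun k => f k i) us) => //.
  by rewrite -(zm_sum (dsum_evalB i)) e.
Qed.

Definition bdsum : gbimod A.
Proof.
apply: (@GBimod A dsum dsum_ract _ _ _ _ _ (fun k x => forall i, gdeg k (x i))).
- by move=> a x y; apply: dsum_ext => i; exact: ractDl.
- by move=> a b x; apply: dsum_ext => i; exact: ractDr.
- by move=> a b x; apply: dsum_ext => i; exact: ractA.
- by move=> x; apply: dsum_ext => i; exact: ract1.
- by move=> a b x; apply: dsum_ext => i; exact: ractZ.
- exact: dsum_grading.
- by move=> i j a x ha hx k; exact: gdegl.
- by move=> i j a x hx ha k; exact: gdegr.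
Defined.

Lemma dlift_deg (N : gbimod A) (F : forall i, M i -> N) k (x : dsum) :
    (forall i (u : M i), gdeg k u -> gdeg k (F i u)) ->
  (forall i, gdeg k (x i)) -> gdeg k (dlift F x).
Proof. by move=> hF hx; apply: (gr_sum (gdeg_grading N)) => i _; exact: hF. Qed.

Definition bdlift (N : gbimod A) (F : forall i, bhom (M i) N) : bhom bdsum N.
Proof.
apply: (@mk_bhom _ bdsum N (dlift (fun i => F i))) => [a x y|x a|k x hx].
- rewrite (zmD (dlift_additive (fun i => bhomB (F i)))); congr (_ + _).
  rewrite (@dliftE _ _ (fun i => bhomB (F i)) _ (dsupp x)) ?dsupp_uniq //.
    by rewrite scaler_sumr; apply: eq_bigr => i _; rewrite -linearZ.
  by move=> i /dsupp_out e; rewrite dsum_evalZ e scaler0.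
- rewrite (@dliftE _ _ (fun i => bhomB (F i)) _ (dsupp x)) ?dsupp_uniq //.
    rewrite (zm_sum (ractl_additive a)); apply: eq_bigr => i _.
    exact: bhomr.
  by move=> i /dsupp_out e; rewrite /= e (zm0 (ractl_additive a)).
- by apply: dlift_deg => // i u; exact: bhom_deg.
Defined.

Definition bdinc i : bhom (M i) bdsum.
Proof.
apply: (@mk_bhom _ (M i) bdsum (@dinc i)) => [a u v|u a|k u hu].
- by rewrite (zmD (@dinc_additive i)) dincZ.
- exact: dinc_ract.
- apply: (dincP (P := fun j u => gdeg k u)) => // j.
  by apply: (gr0 (gdeg_grading (M j))).
Defined.

End DirectSum.

Section Morphisms.
Variable A : gradedRing.
Implicit Types M N : gbimod A.

Definition badd M N (f g : bhom M N) : bhom M N.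
Proof.
apply: (@mk_bhom _ M N (fun x => f x + g x)) => [a u v|m a|i m h].
- by rewrite !linearP scalerDr addrACA.
- by rewrite !bhomr ractDl.
- by apply: (grD (gdeg_grading N)); exact: bhom_deg.
Defined.

Definition bsign (k : nat) M N (f : bhom M N) : bhom M N.
Proof.
apply: (@mk_bhom _ M N (fun x => (-1) ^+ k *: f x)) => [a u v|m a|i m h].
- by rewrite linearP scalerDr !scalerA mulrC.
- by rewrite bhomr ractZ.
- by apply: gr_signZ; [exact: gdeg_grading | exact: bhom_deg].
Defined.

Definition bpair M N K (f : bhom K M) (g : bhom K N) : bhom K (bsum M N).
Proof.
apply: (@mk_bhom _ K (bsum M N) (fun x => (f x, g x))) => [a u v|m a|i m h].
- by rewrite !linearP.
- by rewrite !bhomr.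
- by split; exact: bhom_deg.
Defined.

Definition bfst M N : bhom (bsum M N) M.
Proof. by apply: (@mk_bhom _ (bsum M N) M fst) => // i m []. Defined.

Definition bsnd M N : bhom (bsum M N) N.
Proof. by apply: (@mk_bhom _ (bsum M N) N snd) => // i m []. Defined.

Variable S : gradedSubring A.

Lemma tmap_balanced M N M' N' (f : bhom M M') (g : bhom N N') :
  balanced S (fun (m : M) (n : N) => pure S (f m) (g n)).
Proof.
split=> [n m m'|m n n'|m a n sa].
- by rewrite linearB pureBl.
- by rewrite linearB pureBr.
- by rewrite bhomr pureM // linearZ.
Qed.

Section TensorMap.
Variables (M N M' N' : gbimod A) (f : bhom M M') (g : bhom N N').

Definition tmap : tens S M N -> tens S M' N' :=
  tlift (fun m n => pure S (f m) (g n)).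

Lemma tmap_additive : zmod_morphism tmap.
Proof. exact: tlift_additive (tmap_balanced f g). Qed.

Lemma tmap_pure m n : tmap (pure S m n) = pure S (f m) (g n).
Proof. exact: tlift_pure (tmap_balanced f g) m n. Qed.

Definition btens_map : bhom (btens S M N) (btens S M' N').
Proof.
apply: (@mk_bhom _ (btens S M N) (btens S M' N') tmap) => [a u v|t a|k t].
- rewrite (zmD tmap_additive); congr (_ + _); move: u; apply: tens_ext.
  + by move=> t u; rewrite scalerBr tmap_additive.
  + by move=> t u; rewrite tmap_additive scalerBr.
  + by move=> m n; rewrite !(tmap_pure, scale_pure) linearZ.
- move: t; apply: tens_ext.
  + by move=> t u; rewrite (ractl_additive (M := btens S M N)) tmap_additive.
  + by move=> t u; rewrite tmap_additive (ractl_additive (M := btens S M' N')).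
  + by move=> m n; rewrite /= tract_pure !tmap_pure tract_pure bhomr.
- elim=> {t} [_ [i [j [m [n [hm hn <- ->]]]]]||u v _ du _ dv].
  + rewrite tmap_pure; apply: span_gen; exists i, j, (f m), (g n).
    by split=> //; exact: bhom_deg.
  + by rewrite (zm0 tmap_additive); exact: span0.
  + by rewrite tmap_additive; exact: spanB.
Defined.

Lemma btens_map_pure m n : btens_map (pure S m n) = pure S (f m) (g n).
Proof. exact: tmap_pure. Qed.
End TensorMap.

Lemma btens_map0l M N M' N' (f : bhom M M') (g : bhom N N') M''
    (f' : bhom M' M'') N'' (g' : bhom N' N'') :
  (forall m, f' (f m) = 0) -> forall t, btens_map f' g' (btens_map f g t) = 0.
Proof.
move=> h; apply: tens_ext => [t u|t u|m n]; rewrite ?linearB ?subrr //.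
by rewrite !btens_map_pure h (zm0 (pureBl S _)).
Qed.

Lemma btens_map0r M N M' N' (f : bhom M M') (g : bhom N N') M''
    (f' : bhom M' M'') N'' (g' : bhom N' N'') :
  (forall n, g' (g n) = 0) -> forall t, btens_map f' g' (btens_map f g t) = 0.
Proof.
move=> h; apply: tens_ext => [t u|t u|m n]; rewrite ?linearB ?subrr //.
by rewrite !btens_map_pure h (zm0 (pureBr S _)).
Qed.

End Morphisms.

Definition full_subring (A : gradedRing) : gradedSubring A.
Proof.
apply: (@GradedSubring A (fun=> True)) => // a _.
by have [s [f [hf ->]]] := gr_span (rdeg_grading A) a; exists s, f.
Defined.

Notation "M \tens N" := (btens (full_subring _) M N) (at level 40, left associativity).

Section Complexes.
Variable A : gradedRing.

Record cpx := Cpx {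
  cobj :> int -> gbimod A;
  cdiff : forall i, bhom (cobj i) (cobj (i + 1));
  cdiffK : forall i x, cdiff (i + 1) (cdiff i x) = 0 }.

Record cmap (C D : cpx) := CMap {
  cmor :> forall i, bhom (C i) (D i);
  cmorE : forall i x, cmor (i + 1) (cdiff C i x) = cdiff D i (cmor i x) }.

Definition cid_map (C : cpx) : cmap C C.
Proof. by exists (fun i => bid (C i)). Defined.

Definition ccomp (C D E : cpx) (f : cmap D E) (g : cmap C D) : cmap C E.
Proof. by exists (fun i => bcomp (f i) (g i)) => i x /=; rewrite !cmorE. Defined.

(* Since the component of h in degree i + 1 is written h i : C (i + 1) -> D i,
   the homotopy identity is stated in degree i + 1; every integer has this form. *)
Definition homotopic (C D : cpx) (f g : cmap C D) : Prop :=
  exists h : forall i, bhom (C (i + 1)) (D i), forall i x,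
    f (i + 1) x - g (i + 1) x = cdiff D i (h i x) + h (i + 1) (cdiff C (i + 1) x).

Definition is_hequiv (C D : cpx) (f : cmap C D) : Prop :=
  exists g : cmap D C,
    homotopic (ccomp g f) (cid_map C) /\ homotopic (ccomp f g) (cid_map D).

Definition hequiv (C D : cpx) : Prop := exists f : cmap C D, is_hequiv f.

Definition bounded_above (C : cpx) : Prop :=
  exists N : int, forall i, N < i -> is_zero (C i).

Definition conc (M : gbimod A) : cpx.
Proof.
by exists (fun i => if i == 0 then M else bzero A) (fun i => bzero_hom _ _).
Defined.

Definition czero : cpx := conc (bzero A).

(* cone f in degree i is C (i + 1) (+) D i, with d (x, y) = (- d x, f x + d y). *)
Definition cone (C D : cpx) (f : cmap C D) : cpx.
Proof.
exists (fun i => bsum (C (i + 1)) (D i)) (fun i =>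
  bpair (bsign 1 (bcomp (cdiff C (i + 1)) (bfst _ _)))
    (badd (bcomp (f (i + 1)) (bfst _ _)) (bcomp (cdiff D i) (bsnd _ _)))).
move=> i [x y]; rewrite /= !expr1 !scaleN1r !(zmN (bhomB _)) cdiffK !oppr0.
by rewrite linearD cdiffK addr0 -cmorE addNr.
Defined.

Definition ctensr (C : cpx) (N : gbimod A) : cpx.
Proof.
exists (fun i => C i \tens N) (fun i => btens_map _ (cdiff C i) (bid N)).
by move=> i; apply: btens_map0l; exact: cdiffK.
Defined.

Definition ctensl (M : gbimod A) (C : cpx) : cpx.
Proof.
exists (fun i => M \tens C i) (fun i => btens_map _ (bid M) (cdiff C i)).
by move=> i; apply: btens_map0r; exact: cdiffK.
Defined.

Section Total.
Variables C D : cpx.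

Definition tot_idx (k : int) := {p : int * int | p.1 + p.2 == k}.

Definition nextl k (p : tot_idx k) : tot_idx (k + 1).
Proof.
by exists ((val p).1 + 1, (val p).2); rewrite /= addrAC (eqP (valP p)).
Defined.

Definition nextr k (p : tot_idx k) : tot_idx (k + 1).
Proof.
by exists ((val p).1, (val p).2 + 1); rewrite /= addrA (eqP (valP p)).
Defined.

Definition tot_term (k : int) (p : tot_idx k) : gbimod A :=
  C (val p).1 \tens D (val p).2.

(* d (m (x) n) = d m (x) n + (-1) ^ i m (x) d n, for m in C i *)
Definition tot_diff (k : int) :
    bhom (bdsum (@tot_term k)) (bdsum (@tot_term (k + 1))) :=
  bdlift (fun p : tot_idx k =>
    badd
      (bcomp (bdinc (@tot_term (k + 1)) (nextl p))
        (btens_map _ (cdiff C (val p).1) (bid (D (val p).2))))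
      (bsign `|(val p).1|
        (bcomp (bdinc (@tot_term (k + 1)) (nextr p))
          (btens_map _ (bid (C (val p).1)) (cdiff D (val p).2))))).

Definition tot_pure k (p : tot_idx k) (m : C (val p).1) (n : D (val p).2) :
    bdsum (@tot_term k) :=
  @dinc A (tot_idx k) (@tot_term k) p (pure (full_subring A) m n).

Lemma tot_pure_irr k (q : int * int) (h h' : q.1 + q.2 == k) m n :
  @tot_pure k (exist _ q h) m n = @tot_pure k (exist _ q h') m n.
Proof. by rewrite (bool_irrelevance h h'). Qed.

Lemma tot_pure0l k (p : tot_idx k) n : @tot_pure k p 0 n = 0.
Proof.
by rewrite /tot_pure (zm0 (pureBl (full_subring A) n)) (zm0 (@dinc_additive _ _ _ p)).
Qed.

Lemma tot_pure0r k (p : tot_idx k) m : @tot_pure k p m 0 = 0.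
Proof.
by rewrite /tot_pure (zm0 (pureBr (full_subring A) m)) (zm0 (@dinc_additive _ _ _ p)).
Qed.

Lemma sign_succ (i : int) : (-1) ^+ `|i + 1| = - (-1) ^+ `|i| :> A.
Proof.
case: i => k; first by rewrite -PoszD addn1 /= exprS mulN1r.
have -> : Negz k + 1 = - k%:Z by rewrite NegzE intS opprD addrAC addNr add0r.
by rewrite abszN /= exprS mulN1r opprK.
Qed.

Lemma tot_diffE k (p : tot_idx k) m n :
  tot_diff k (tot_pure (p := p) m n) =
  @tot_pure _ (nextl p) (cdiff C _ m) n +
  (-1) ^+ `|(val p).1| *: @tot_pure _ (nextr p) m (cdiff D _ n).
Proof.
rewrite [LHS]dlift_inc; last by move=> i; exact: bhomB.
by rewrite /= !tmap_pure.
Qed.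

Lemma tot_diffK k x : tot_diff (k + 1) (tot_diff k x) = 0.
Proof.
move: x; apply: eq_dsum => [x y|x y|p].
- by rewrite !linearB.
- by rewrite subrr.
have hd : zmod_morphism (fun u : tot_term p =>
    tot_diff (k + 1) (tot_diff k (dinc (M := @tot_term k) u))).
  by move=> u v; rewrite dinc_additive !linearB.
apply: (tens_ext hd (h := fun=> 0)) => [t u|m n]; first by rewrite subrr.
rewrite -[dinc _]/(@tot_pure k p m n) tot_diffE linearD linearZ !tot_diffE.
rewrite !cdiffK tot_pure0l tot_pure0r scaler0 addr0 add0r sign_succ scaleNr.
apply/eqP; rewrite addr_eq0 eqr_opp; apply/eqP; congr (_ *: _).
exact: tot_pure_irr.
Qed.

(* The direct sum over all i + j = k; it has finitely many nonzero terms when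
   C and D are bounded above. *)
Definition ctens : cpx :=
  {| cobj := fun k => bdsum (@tot_term k); cdiff := tot_diff; cdiffK := tot_diffK |}.

End Total.
End Complexes.

Section Soergel.
Variable n : nat.

(* deg x_i = 2 *)
Definition pdeg (d : int) (p : {mpoly rat[n]}) : Prop :=
  forall m, m \in msupp p -> d = (2 * mdeg m)%N%:Z.

Lemma pdegE k p : pdeg (k.*2)%:Z p <-> p \is k.-homog.
Proof.
split=> [h|/dhomogP h].
  by apply/dhomogP => m /h[]; rewrite mul2n => /double_inj.
by move=> m /h <-; rewrite mul2n.
Qed.

Lemma pihomog_pdeg k p : pdeg (k.*2)%:Z (pihomog mdeg k p).
Proof. by apply/pdegE; exact: pihomogP. Qed.

Lemma poly_decomp (P : {mpoly rat[n]} -> Prop) p : P 0 ->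
    (forall k, P (pihomog mdeg k p)) ->
  exists (s : seq int) (f : int -> {mpoly rat[n]}),
    (forall i, pdeg i (f i) /\ P (f i)) /\ p = \sum_(i <- s) f i.
Proof.
move=> P0 hP; pose f (d : int) := if d is Posz k then
  (if odd k then 0 else pihomog mdeg k./2 p) else 0.
exists [seq (k.*2)%:Z | k <- index_iota 0 (msize p)], f; split=> [d|].
  case: d => k; rewrite /f; last by split=> // m; rewrite msupp0.
  case: ifP => ko; first by split=> // m; rewrite msupp0.
  split=> //; have {1}-> : k = k./2.*2 by rewrite -[LHS]odd_double_half ko.
  exact: pihomog_pdeg.
rewrite big_map big_mkord.
rewrite {1}(pihomog_partitionE (leqnn (msize p))).
by apply: eq_bigr => k _; rewrite /f odd_double doubleK.
Qed.

Lemma pdeg_coeff d p m : pdeg d p -> d != (2 * mdeg m)%N%:Z -> p@_m = 0.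
Proof.
move=> hp /eqP hd; apply/eqP; rewrite mcoeff_eq0.
by apply/negP => /hp.
Qed.

Lemma pdeg_grading : grading pdeg.
Proof.
split.
- by move=> i m; rewrite msupp0.
- by move=> i u v hu hv m /msuppB_le; rewrite mem_cat => /orP[/hu|/hv].
- move=> p.
  have [s [f [hf ->]]] := poly_decomp (P := fun=> True) (p := p) I (fun=> I).
  by exists s, f; split=> // i; case: (hf i).
- move=> s f us hf e i si; apply/mpolyP => m; rewrite mcoeff0.
  have [ei|/(pdeg_coeff (hf i)) //] := eqVneq i (2 * mdeg m)%N%:Z.
  have := congr1 (mcoeff m) e; rewrite mcoeff0 raddf_sum (bigD1_seq i) //=.
  rewrite big1 ?addr0 // => j ji; apply: (pdeg_coeff (hf j)).
  by rewrite -ei.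
Qed.

Lemma pdeg1 : pdeg 0 1.
Proof. by move=> m; rewrite msupp1 inE => /eqP->; rewrite mdeg0. Qed.

Lemma pdegM i j p q : pdeg i p -> pdeg j q -> pdeg (i + j) (p * q).
Proof.
move=> hp hq m /msuppM_le /allpairsP[[m1 m2] /= [/hp-> /hq-> ->]].
by rewrite mdegD mulnDr PoszD.
Qed.

Definition polyR : gradedRing := GradedRing pdeg_grading pdeg1 pdegM.

Definition invariants (H : {set 'S_n}) : gradedSubring polyR.
Proof.
apply: (@GradedSubring polyR (fun p => forall w, w \in H -> msym w p = p)).
- by move=> w _; rewrite msym1.
- by move=> a b ha hb w hw; rewrite msymB ha ?hb.
- by move=> a b ha hb w hw; rewrite msymM ha ?hb.
- move=> a ha.
  apply: (poly_decomp (P := fun p => forall w, w \in H -> msym w p = p)).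
    by move=> w _; rewrite msym0.
  by move=> k w hw; rewrite msym_pihomog ha.
Defined.

(* R (x)_(R^H) R *)
Definition induced (H : {set 'S_n}) : gbimod polyR :=
  btens (invariants H) (breg polyR) (breg polyR).

Definition Bs (s : 'S_n) : gbimod polyR := bshift (-1) (induced [set s]).

(* The longest element has length n (n - 1) / 2. *)
Definition Bw0 : gbimod polyR :=
  bshift (- ((n * n.-1)./2)%:Z) (induced [set: 'S_n]).

(* soergel_summand also yields the zero bimodule and closure under isomorphism. *)
Inductive soergel : gbimod polyR -> Prop :=
| soergel_R : soergel (breg polyR)
| soergel_Bs (i j : 'I_n) : j = i.+1 :> nat -> soergel (Bs (tperm i j))
| soergel_sum M N : soergel M -> soergel N -> soergel (bsum M N)
| soergel_summand M N L : soergel L -> biso L (bsum M N) -> soergel M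
| soergel_shift k M : soergel M -> soergel (bshift k M)
| soergel_tens M N : soergel M -> soergel N -> soergel (M \tens N).

Definition in_Kminus (C : cpx polyR) : Prop :=
  bounded_above C /\ forall i, soergel (C i).

Definition sum_of_Bw0 (M : gbimod polyR) : Prop :=
  exists (r : nat) (k : 'I_r -> int), biso M (bdsum (fun i => bshift (k i) Bw0)).

Definition resolved_by_Bw0 (P : cpx polyR) : Prop :=
  exists Q : cpx polyR,
    [/\ in_Kminus Q, forall i, sum_of_Bw0 (Q i) & hequiv P Q].

Definition cone_killed_by_Bw0 (P : cpx polyR) (eps : cmap P (conc (breg polyR))) : Prop :=
  hequiv (ctensr (cone eps) Bw0) (czero polyR) /\
  hequiv (ctensl Bw0 (cone eps)) (czero polyR).

Definition tens_idempotent (P : cpx polyR) : Prop := hequiv (ctens P P) P.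

End Soergel.

(* Main.v *)
(* The complex P is the bar resolution of R relative to R^W: with
   C = R (x)_(R^W) R, its term in degree - k is the (k+1)-fold power of C over R,
   and the differential is the alternating sum of the counits C -> R.  The
   augmented complex is exact because m |-> (1 (x) 1) (x) m contracts it.

   R is a graded Frobenius extension of R^W: the trace is the divided difference
   operator d_w0 = D_(n-1) ... D_0 with D_k = d_0 ... d_(k-1), and dual bases are
   obtained one variable at a time, along the tower R^W[x_k, ..., x_(n-1)].  The
   dual bases show that C (x) C is a sum of shifts of C, that tensoring with C
   preserves and reflects exactness, and that C is a summand of the Bott-Samelson
   bimodule of the word of d_w0, so that it is a Soergel bimodule.

   Finally C(k) is projective among the bimodules on which the two actions of R^W
   agree, since maps out of it are elements of degree k.  Maps from a bounded above
   complex of sums of shifts of C into an exact complex of such bimodules are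
   therefore null-homotopic; this yields (P2), (P3) and the uniqueness statement. *)
From HB Require Import structures.
From mathcomp Require Import all_boot all_order all_algebra all_fingroup.
From mathcomp Require Import zify ring boolp.
From mathcomp Require Import freeg mpoly.
Require Import Defs.

Set Implicit Arguments.
Unset Strict Implicit.
Unset Printing Implicit Defensive.

Import Order.TTheory GRing.Theory Num.Theory.
Local Open Scope ring_scope.

(** * Homotopies into exact complexes *)

(** Projectivity of C is relative to bimodules on which the two actions of R^W agree, so every
    lifting argument carries this centrality along; all Soergel bimodules have it because R^W lies
    in each R^s. The contraction of the augmented bar complex is right linear but not left linear:
    it gives exactness only, and the bimodule homotopies come from projectivity afterwards. In the
    same way a pair with (P1) and (P2) is a relative projective resolution of R: the cone becomes
    contractible, hence exact, after tensoring with B_w0, and as abelian groups that tensor product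
    is a finite nonempty sum of copies of the cone.

    The operator d_w0 is carried as an explicit word, since the same word spells a Bott-Samelson
    bimodule. Its length l is half the degree drop of the trace; this is what makes C(-l), with no
    other shift, a retract.

    The obstacle of the formalization is that the objects in degrees i + 1 - 1 and i are only
    propositionally equal. Families are therefore reindexed once and for all, or maps are defined
    between arbitrary degrees with value 0 where the degrees do not fit. *)

Lemma int_succ (j : int) : exists i, j = i + 1.
Proof. by exists (j - 1); rewrite subrK. Qed.

(** The entries of a null-homotopy are indexed by successors; this turns their components into a
    family that can serve as a chain map or a homotopy. The cast vanishes at i + 1 because equality
    proofs on [int] are unique. *)
Lemma reindex_succ (T : int -> Type) (u : forall i, T (i + 1)) :
  exists w : forall i, T i, forall i, w (i + 1) = u i.
Proof.
pose w j := ecast k (T k) (subrK 1 j) (u (j - 1)).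
exists w => i; rewrite /w; move: (subrK 1 (i + 1)).
by rewrite (addrK 1 i) => e; rewrite eq_axiomK.
Qed.

(* The equation at i couples the entries at i and i + 1.  Each stage of the
   recursion is a full family, changed only at one index, so that no transport
   along equalities of indices is needed. *)
Lemma downward_choice (T : int -> Type) (Q : forall i, T i -> T (i + 1) -> Prop)
    (N : int) (t0 : forall i, T i) :
    (forall i, (N < i)%R -> Q i (t0 i) (t0 (i + 1))) ->
    (forall i a b, Q (i + 1) a b -> exists c, Q i c a) ->
  exists t : forall i, T i, forall i, Q i (t i) (t (i + 1)).
Proof.
move=> Q0 step.
pose good (k : nat) (t : forall i, T i) := forall i, (N - k%:Z < i)%R -> Q i (t i) (t (i + 1)).
have stepk k t : good k t -> exists t', good k.+1 t' /\
    forall i, (N - k%:Z < i)%R -> t' i = t i.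
  move=> gt; have hN : (N - k%:Z < N - k%:Z + 1)%R by lia.
  have [c hc] := step (N - k%:Z) _ _ (gt _ hN).
  exists (dfwith t c); split=> [i|i hi]; last first.
    by rewrite dfwith_out // lt_eqF.
  move=> hi; have [->|ni] := eqVneq i (N - k%:Z).
    by rewrite dfwith_in dfwith_out // lt_eqF.
  rewrite !dfwith_out; [apply: gt | |]; move: hi ni; lia.
have [f hf] : exists f : forall k, {t | good k t},
    forall k i, (N - k%:Z < i)%R -> sval (f k.+1) i = sval (f k) i.
  have g0 : good 0%N t0 by move=> i; rewrite subr0; exact: Q0.
  pose next k (t : {t | good k t}) : {t | good k.+1 t} :=
    exist _ _ (projT2 (cid (stepk k _ (svalP t)))).1.
  pose f := nat_rect (fun k => {t | good k t}) (exist _ t0 g0) next.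
  exists f => k i hi; exact: (projT2 (cid (stepk k _ (svalP (f k))))).2.
have stable k l i : (N - k%:Z < i)%R -> sval (f (k + l)%N) i = sval (f k) i.
  move=> hi; elim: l => [|l IH]; rewrite ?addn0 // addnS hf //.
  by move: hi; lia.
(* The entry at i is final from stage [K i] on, so stage [K i + K (i + 1)] is final for both entries
   in the equation at i. *)
pose K (i : int) := `|N - i|%N.+1.
have hK i : (N - (K i)%:Z < i)%R.
  by rewrite /K; lia.
exists (fun i => sval (f (K i)) i) => i.
have -> : sval (f (K i)) i = sval (f (K i + K (i + 1)%R)%N) i by rewrite stable.
have -> : sval (f (K (i + 1))) (i + 1) = sval (f (K i + K (i + 1)%R)%N) (i + 1).
  by rewrite addnC stable.
by apply: (svalP (f _)); move: (hK i); lia.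
Qed.

Section Homological.
Variables (A : gradedRing) (S : gradedSubring A).
Implicit Types (M N K X Y : gbimod A) (C D E : cpx A).

Lemma bhom0 M N (f : bhom M N) : f 0 = 0.
Proof. exact: linear0. Qed.

Lemma bhomN M N (f : bhom M N) x : f (- x) = - f x.
Proof. exact: linearN. Qed.

Definition bisub M N (f g : bhom M N) : bhom M N := badd f (bsign 1 g).

Lemma bisubE M N (f g : bhom M N) x : bisub f g x = f x - g x.
Proof. by rewrite /= expr1 scaleN1r. Qed.

Definition scentral M := forall a, smem S a -> forall m : M, a *: m = ract m a.

(* Projectivity among bimodules on which the two actions of S agree. *)
Definition projective X := forall M N K (p : bhom M N) (q : bhom N K),
  scentral M -> (forall y, q y = 0 -> exists x, p x = y) ->
  forall f : bhom X N, (forall x, q (f x) = 0) ->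
  exists g : bhom X M, forall x, p (g x) = f x.

Lemma projective_retract X Y (i : bhom X Y) (r : bhom Y X) :
  cancel i r -> projective Y -> projective X.
Proof.
move=> ir hY M N K p q hM ex f qf.
have [|g hg] := hY M N K p q hM ex (bcomp f r); first by move=> x; exact: qf.
by exists (bcomp g i) => x /=; rewrite hg /= ir.
Qed.

Lemma projective_bdsum (I : choiceType) (F : I -> gbimod A) :
  (forall i, projective (F i)) -> projective (bdsum F).
Proof.
move=> hF M N K p q hM ex f qf.
have lft i : {g : bhom (F i) M | forall x, p (g x) = f (bdinc F i x)}.
  apply: cid; have [|g hg] := hF i M N K p q hM ex (bcomp f (bdinc F i)).
    by move=> x; exact: qf.
  by exists g.
pose g i := sval (lft i); have hg i : forall x, p (g i x) = f (bdinc F i x) := svalP (lft i).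
exists (bdlift g); apply: eq_dsum => [x y|x y|i u]; rewrite ?linearB //.
by rewrite /= dlift_inc ?hg // => j; exact: bhomB.
Qed.

Lemma projective_bsum X Y : projective X -> projective Y -> projective (bsum X Y).
Proof.
move=> hX hY M N K p q hM ex f qf.
have [|g hg] := hX M N K p q hM ex (bcomp f (bpair (bid X) (bzero_hom X Y))).
  by move=> x; exact: qf.
have [|h hh] := hY M N K p q hM ex (bcomp f (bpair (bzero_hom Y X) (bid Y))).
  by move=> x; exact: qf.
exists (badd (bcomp g (bfst X Y)) (bcomp h (bsnd X Y))) => -[x y] /=.
rewrite linearD hg hh /= -linearD; congr (f _).
by congr pair; rewrite /= ?addr0 ?add0r.
Qed.

Definition exact_cpx E := forall i (y : E (i + 1)),
  cdiff E (i + 1) y = 0 -> exists x, cdiff E i x = y.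

Definition null_homotopic C D (f : forall i, bhom (C i) (D i)) :=
  exists h : forall i, bhom (C (i + 1)) (D i), forall i x,
    f (i + 1) x = cdiff D i (h i x) + h (i + 1) (cdiff C (i + 1) x).

(** Above the bound of C the zero homotopy works. Below it, f - h d takes values in cycles by the
    identity one degree higher, hence in boundaries, and projectivity of the source lifts it through
    the differential of E. *)
Lemma null_homotopicP C E (f : cmap C E) :
    bounded_above C -> (forall i, projective (C i)) ->
    (forall i, scentral (E i)) -> exact_cpx E -> null_homotopic f.
Proof.
move=> [N hN] pC cE exE.
pose Q i (a : bhom (C (i + 1)) (E i)) (b : bhom (C (i + 1 + 1)) (E (i + 1))) :=
  forall x, f (i + 1) x = cdiff E i (a x) + b (cdiff C (i + 1) x).
apply: (downward_choice (Q := Q) (N := N) (t0 := fun i => bzero_hom _ _)).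
  move=> i hi x; rewrite (hN (i + 1) _ x) ?linear0 ?addr0 //.
  by lia.
move=> i a b hab.
have [|x|c hc] := pC (i + 1) (E i) (E (i + 1)) (E (i + 1 + 1)) (cdiff E i)
  (cdiff E (i + 1)) (cE i) _ (bisub (f (i + 1)) (bcomp a (cdiff C (i + 1)))).
- exact: exE.
- rewrite bisubE linearB -cmorE hab /= cdiffK linear0 addr0 subrr //.
by exists c => x; rewrite hc bisubE /= subrK.
Qed.

Lemma homotopic_sym C D (f g : cmap C D) : homotopic f g -> homotopic g f.
Proof.
move=> [h hh]; exists (fun i => bsign 1 (h i)) => i x.
by rewrite /= !expr1 !scaleN1r linearN -opprD -hh opprB.
Qed.

Lemma homotopic_trans C D (f g k : cmap C D) :
  homotopic f g -> homotopic g k -> homotopic f k.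
Proof.
move=> [h hh] [l hl]; exists (fun i => badd (h i) (l i)) => i x.
by rewrite /= linearD addrACA -hh -hl addrA subrK.
Qed.

Lemma homotopic_compl C D E (k : cmap D E) (f g : cmap C D) :
  homotopic f g -> homotopic (ccomp k f) (ccomp k g).
Proof.
move=> [h hh]; exists (fun i => bcomp (k i) (h i)) => i x /=.
by rewrite -linearB hh linearD cmorE.
Qed.

Lemma homotopic_compr C D E (k : cmap C D) (f g : cmap D E) :
  homotopic f g -> homotopic (ccomp f k) (ccomp g k).
Proof.
move=> [h hh]; exists (fun i => bcomp (h i) (k (i + 1))) => i x /=.
by rewrite hh cmorE.
Qed.

Lemma homotopic_ext C D (f g : cmap C D) : (forall i x, f i x = g i x) -> homotopic f g.
Proof.
move=> e; exists (fun i => bzero_hom _ _) => i x.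
by rewrite /= e subrr linear0 addr0.
Qed.

Section Cone.
Variables (P Y : cpx A) (eps : cmap P Y).

Lemma cone_diffE i (x : P (i + 1)) (y : Y i) :
  cdiff (cone eps) i (x, y) = (- cdiff P (i + 1) x, eps (i + 1) x + cdiff Y i y).
Proof. by rewrite /= expr1 scaleN1r. Qed.

Hypothesis exE : exact_cpx (cone eps).
Hypothesis cE : forall i, scentral (cone eps i).
Variable X : cpx A.
Hypothesis bX : bounded_above X.
Hypothesis pX : forall i, projective (X i).

(** The chain map x |-> (0, phi x) into the cone is null-homotopic. The first component of the
    null-homotopy is the lift; the second, negated, is the homotopy between its composite with eps
    and phi. *)
Lemma cone_lift (phi : cmap X Y) : exists Phi : cmap X P, homotopic (ccomp eps Phi) phi.
Proof.
pose f i : bhom (X i) (cone eps i) := bpair (bzero_hom (X i) (P (i + 1))) (phi i).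
have fE i x : f (i + 1) (cdiff X i x) = cdiff (cone eps) i (f i x).
  by rewrite cone_diffE /= !bhom0 oppr0 add0r cmorE.
have [h hh] := null_homotopicP (@CMap _ X (cone eps) f fE) bX pX cE exE.
have [u hu] := reindex_succ (T := fun j => bhom (X j) (P j)) (fun i => bcomp (bfst _ _) (h i)).
have uE i x : u (i + 1) (cdiff X i x) = cdiff P i (u i x).
  case: (int_succ i) x => {}i -> x; have /= := congr1 fst (hh i x).
  rewrite !hu /= expr1 scaleN1r.
  by move/esym/(canRL (addKr _)); rewrite opprK addr0.
exists (@CMap _ X P u uE); exists (fun i => bsign 1 (bcomp (bsnd _ _) (h i))) => i x.
have /= -> := congr1 snd (hh i x).
rewrite !hu /= !expr1 !scaleN1r bhomN.
have aux (V : zmodType) (a b c : V) : a - (a + b + c) = - b - c.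
  by rewrite -addrA opprD addrA subrr add0r opprD.
exact: aux.
Qed.

(** The difference Phi - Psi and the homotopy v are the two components of a chain map from the
    shifted complex X[1] to the cone. The first component of its null-homotopy gives, up to sign,
    the homotopy sought. *)
Lemma cone_lift_uniq (Phi Psi : cmap X P) :
  homotopic (ccomp eps Phi) (ccomp eps Psi) -> homotopic Phi Psi.
Proof.
move=> [v hv].
have dX' i x : bsign 1 (cdiff X (i + 1 + 1)) (bsign 1 (cdiff X (i + 1)) x) = 0.
  by rewrite /= !expr1 !scaleN1r linearN cdiffK !oppr0.
pose X' := @Cpx A (fun i => X (i + 1)) (fun i => bsign 1 (cdiff X (i + 1))) dX'.
pose F i : bhom (X' i) (cone eps i) :=
  bpair (bisub (Phi (i + 1)) (Psi (i + 1))) (bsign 1 (v i)).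
have FE i x : F (i + 1) (cdiff X' i x) = cdiff (cone eps) i (F i x).
  rewrite cone_diffE; congr pair; rewrite !bisubE /= !expr1 !scaleN1r !bhomN.
    by rewrite !cmorE linearB opprD.
  have aux (V : zmodType) (a b c d : V) : a - b = c + d -> d = a - b - c.
    by move=> ->; rewrite addrAC subrr add0r.
  rewrite opprK linearB; exact: aux (hv i x).
have bX' : bounded_above X'.
  case: bX => N hN; exists N => i hi; apply: hN; lia.
have pX' i : projective (X' i) by exact: pX.
have [h hh] := null_homotopicP (@CMap _ X' (cone eps) F FE) bX' pX' cE exE.
have [w hw] := reindex_succ
  (T := fun j => bhom (X (j + 1)) (P j)) (fun i => bcomp (bfst _ _) (h i)).
exists (fun i => bsign 1 (w i)) => i x.
case: (int_succ i) x => {}i -> x; have /= := congr1 fst (hh i x).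
rewrite !expr1 !scaleN1r !hw /= => ->.
by rewrite !bhomN.
Qed.
End Cone.

(** (P1) holds only up to homotopy equivalence: the terms of P' itself may fail to be projective, so
    the lifting results are transported from a replacement Q. *)
Definition projectively_resolved C :=
  exists Q : cpx A, [/\ hequiv C Q, bounded_above Q & forall i, projective (Q i)].

Lemma projectively_resolved_refl C :
  bounded_above C -> (forall i, projective (C i)) -> projectively_resolved C.
Proof.
move=> bC pC; exists C; split=> //; exists (cid_map C), (cid_map C).
by split; apply: homotopic_ext.
Qed.

Section ResolvedLift.
Variables (P Y : cpx A) (eps : cmap P Y) (X : cpx A).
Hypothesis exE : exact_cpx (cone eps).
Hypothesis cE : forall i, scentral (cone eps i).
Hypothesis rX : projectively_resolved X.

Lemma resolved_lift (phi : cmap X Y) :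
  exists Phi : cmap X P, homotopic (ccomp eps Phi) phi.
Proof.
case: rX => Q [[f [g [gf fg]]] bQ pQ].
have [u hu] := cone_lift exE cE bQ pQ (ccomp phi g).
exists (ccomp u f); apply: (@homotopic_trans _ _ _ (ccomp (ccomp phi g) f)).
  exact: (homotopic_compr f hu).
apply: (@homotopic_trans _ _ _ (ccomp phi (cid_map X))).
  exact: (homotopic_compl phi gf).
exact: homotopic_ext.
Qed.

Lemma resolved_lift_uniq (Phi Psi : cmap X P) :
  homotopic (ccomp eps Phi) (ccomp eps Psi) -> homotopic Phi Psi.
Proof.
case: rX => Q [[f [g [gf fg]]] bQ pQ] h.
have hg := cone_lift_uniq exE cE bQ pQ (Phi := ccomp Phi g) (Psi := ccomp Psi g)
  (homotopic_compr g h).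
have back (T : cmap X P) : homotopic (ccomp (ccomp T g) f) T.
  apply: (@homotopic_trans _ _ _ (ccomp T (cid_map X))); last exact: homotopic_ext.
  exact: (homotopic_compl T gf).
apply: homotopic_trans (homotopic_sym (back Phi)) _.
exact: homotopic_trans (homotopic_compr f hg) (back Psi).
Qed.
End ResolvedLift.

(** The comparison theorem: the augmentations lift in both directions, and each composite is
    homotopic to the identity because both lift the same augmentation. *)
Lemma resolution_unique (P P' Y : cpx A) (eps : cmap P Y) (eps' : cmap P' Y) :
    projectively_resolved P -> exact_cpx (cone eps) ->
    (forall i, scentral (cone eps i)) ->
    projectively_resolved P' -> exact_cpx (cone eps') ->
    (forall i, scentral (cone eps' i)) ->
  exists Phi : cmap P' P, [/\ is_hequiv Phi, homotopic (ccomp eps Phi) eps'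
    & forall Psi : cmap P' P, homotopic (ccomp eps Psi) eps' -> homotopic Psi Phi].
Proof.
move=> rP ex c rP' ex' c'.
have [u hu] := resolved_lift ex c rP' eps'.
have [v hv] := resolved_lift ex' c' rP eps.
exists u; split=> //.
  exists v; split.
    apply: (resolved_lift_uniq ex' c' rP').
    apply: (@homotopic_trans _ _ _ (ccomp eps u)).
      exact: (homotopic_compr u hv).
    exact: hu.
  apply: (resolved_lift_uniq ex c rP).
  apply: (@homotopic_trans _ _ _ (ccomp eps' v)).
    exact: (homotopic_compr v hu).
  exact: hv.
move=> w hw; apply: (resolved_lift_uniq ex c rP').
exact: homotopic_trans hw (homotopic_sym hu).
Qed.

Lemma exact_cone_id C : exact_cpx (cone (cid_map C)).
Proof.
move=> i [x y]; rewrite cone_diffE => -[_ e].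
exists (y, 0); rewrite cone_diffE bhom0 addr0.
by congr pair; apply/esym/eqP; rewrite -addr_eq0; apply/eqP.
Qed.

Lemma scentral_bsum M N : scentral M -> scentral N -> scentral (bsum M N).
Proof. by move=> hM hN a sa [m n]; rewrite /= -hM // -hN. Qed.

(** Both f : C -> D and the identity of D are resolutions of the complex D, so uniqueness of
    resolutions compares C with D. *)
Lemma hequiv_of_exact_cone C D (f : cmap C D) :
    bounded_above C -> (forall i, projective (C i)) -> (forall i, scentral (C i)) ->
    bounded_above D -> (forall i, projective (D i)) -> (forall i, scentral (D i)) ->
    exact_cpx (cone f) ->
  hequiv C D.
Proof.
move=> bC pC cC bD pD cD ex.
have cc E E' (g : cmap E E') : (forall i, scentral (E i)) ->
    (forall i, scentral (E' i)) -> forall i, scentral (cone g i).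
  by move=> cE cE' i; apply: scentral_bsum.
have [u [hu _ _]] := resolution_unique
  (projectively_resolved_refl bD pD) (@exact_cone_id D) (cc _ _ _ cD cD)
  (projectively_resolved_refl bC pC) ex (cc _ _ _ cC cD).
by exists u.
Qed.

Lemma czero0 j (z : czero A j) : z = 0.
Proof. by move: z; rewrite /= /czero /conc; case: ifP => _ z; exact: (thinmx0 z). Qed.

Lemma hequiv_zero_of_exact E : bounded_above E -> (forall i, projective (E i)) ->
  (forall i, scentral (E i)) -> exact_cpx E -> hequiv E (czero A).
Proof.
move=> bE pE cE exE.
have [h hh] := null_homotopicP (cid_map E) bE pE cE exE.
have f0 (C D : cpx A) : exists f : cmap C D, forall i x, f i x = 0.
  have fE i (x : C i) : bzero_hom (C (i + 1)) (D (i + 1)) (cdiff C i x) =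
      cdiff D i (bzero_hom (C i) (D i) x) by rewrite /= bhom0.
  by exists (@CMap _ C D (fun i => bzero_hom (C i) (D i)) fE).
have [f hf] := f0 E (czero A); have [g hg] := f0 (czero A) E.
exists f, g; split.
  exists (fun i => bsign 1 (h i)) => i x.
  by rewrite /= hg expr1 !scaleN1r sub0r bhomN -opprD -hh.
exists (fun i => bzero_hom _ _) => i x.
by rewrite [LHS]czero0 [RHS]czero0.
Qed.

Lemma exact_of_hequiv_zero E : hequiv E (czero A) -> exact_cpx E.
Proof.
move=> [f [g [[h hh] _]]] i y dy.
exists (- h i y); rewrite bhomN; have := hh i y.
rewrite dy bhom0 addr0 => <-.
by rewrite /= (czero0 (f (i + 1) y)) bhom0 sub0r opprK.
Qed.
End Homological.

(** * The Frobenius structure on polynomials over symmetric polynomials *)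

Lemma mpoly_gen_ind (n : nat) (T : comNzRingType) (P : {mpoly T[n]} -> Prop) :
    (forall c, P c%:MP) -> (forall i : 'I_n, P 'X_i) ->
    (forall p q, P p -> P q -> P (p + q)) -> (forall p q, P p -> P q -> P (p * q)) ->
  forall p, P p.
Proof.
move=> hC hX hD hM; elim/mpolyind => [|c mm p _ _ hp]; first by rewrite -mpolyC0.
apply: hD => //; rewrite -mul_mpolyC; apply: (hM) => //; rewrite mpolyXE_id.
apply: (big_ind P) => [||i _]; [by rewrite -mpolyC1 | exact: hM |].
by elim: (mm i) => [|k IH]; rewrite ?expr0 -?mpolyC1 // exprS; apply: hM.
Qed.

Lemma big_nat_eq0 (V : nmodType) a b (F : nat -> V) :
  (forall l, (a <= l < b)%N -> F l = 0) -> \sum_(a <= l < b) F l = 0.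
Proof. by move=> h; rewrite big_nat big1. Qed.

(** * Complete homogeneous symmetric polynomials *)

Section CompleteSymmetric.
Variable T : comNzRingType.

(** The complete homogeneous symmetric polynomial h_k evaluated at the entries of Y. Its recursion
    shortens the list or lowers the degree, hence the nested fixpoint. *)
Fixpoint hsym (Y : seq T) : nat -> T :=
  if Y is a :: Y' then
    fix g m := if m is m'.+1 then hsym Y' m + a * g m' else 1
  else fun m => (m == 0%N)%:R.

Lemma hsym0 Y : hsym Y 0 = 1.
Proof. by case: Y. Qed.

Lemma hsymS a Y k : hsym (a :: Y) k.+1 = hsym Y k.+1 + a * hsym (a :: Y) k.
Proof. by []. Qed.

(** This is the reason why a divided difference turns h_(k+1) in one of two adjacent variables into
    h_k in both. *)
Lemma hsym_swap a b Y k :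
  (a - b) * hsym (a :: b :: Y) k = hsym (a :: Y) k.+1 - hsym (b :: Y) k.+1.
Proof.
have -> : hsym (a :: Y) k.+1 - hsym (b :: Y) k.+1 =
    a * hsym (a :: Y) k - b * hsym (b :: Y) k by rewrite !hsymS; ring.
elim: k => [|k IH]; first by rewrite !hsym0; ring.
rewrite hsymS mulrDr mulrCA IH !hsymS; ring.
Qed.

Lemma hsym1 a k : hsym [:: a] k = a ^+ k.
Proof. by elim: k => [|k IH] //; rewrite hsymS IH exprS /= add0r. Qed.

Lemma hsym_morph (f : {rmorphism T -> T}) Y k : f (hsym Y k) = hsym (map f Y) k.
Proof.
elim: Y k => [|a Y IH] k /=; first by rewrite rmorph_nat.
elim: k => [|k IHk] /=; first by rewrite rmorph1.
by rewrite rmorphD rmorphM IH IHk.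
Qed.
End CompleteSymmetric.

(** * Divided differences and their iterates *)

Section DividedDifferences.
Variable m : nat.
Local Notation R := {mpoly rat[m.+1]}.
Implicit Types f g : R.

Definition xv (i : nat) : R := 'X_(inord i).
Definition sw (i : nat) : 'S_m.+1 := tperm (inord i) (inord i.+1).

Lemma msym_U (s : 'S_m.+1) (i : 'I_m.+1) : msym s ('X_i : R) = 'X_(s i).
Proof. by rewrite /msym mmapX mmap1U. Qed.

Lemma msym_C (s : 'S_m.+1) c : msym s (c%:MP : R) = c%:MP.
Proof. by rewrite -[c%:MP]mulr1 mul_mpolyC msymZ msym1. Qed.

Lemma inord_inj (i j : nat) : (i <= m)%N -> (j <= m)%N ->
  (inord i == inord j :> 'I_m.+1) = (i == j).
Proof. by move=> hi hj; rewrite -val_eqE /= !inordK. Qed.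

Lemma msym_swl i : msym (sw i) (xv i) = xv i.+1.
Proof. by rewrite msym_U tpermL. Qed.

Lemma msym_swr i : msym (sw i) (xv i.+1) = xv i.
Proof. by rewrite msym_U tpermR. Qed.

Lemma msym_swD i j : (i < m)%N -> (j <= m)%N -> j != i -> j != i.+1 ->
  msym (sw i) (xv j) = xv j.
Proof. by move=> hi hj n1 n2; rewrite msym_U tpermD // inord_inj 1?eq_sym //; lia. Qed.

Lemma xv_neq i : (i < m)%N -> xv i.+1 - xv i != 0.
Proof.
move=> hi; apply/eqP => /(congr1 (mcoeff U_(inord i))).
rewrite mcoeffB !mcoeffXU mcoeff0 eqxx inord_inj //; last exact: ltnW.
by rewrite eqn_leq ltnn.
Qed.

(** Divisibility is checked on generators and passes to products by the twisted Leibniz rule pq -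
    s(p)s(q) = (p - s(p)) q + s(p) (q - s(q)). *)
Lemma dd_exists i f : (i < m)%N ->
  exists g, f - msym (sw i) f = (xv i.+1 - xv i) * g.
Proof.
move=> hi; elim/mpoly_gen_ind: f => [c|j|p q [g hg] [h hh]|p q [g hg] [h hh]].
- by exists 0; rewrite msym_C subrr mulr0.
- have hj : 'X_j = xv j by rewrite /xv inord_val.
  have [e|n1] := eqVneq (j : nat) i.
    by exists (-1); rewrite hj e msym_swl mulrN1 opprB.
  have [e|n2] := eqVneq (j : nat) i.+1.
    by exists 1; rewrite hj e msym_swr mulr1.
  exists 0; rewrite hj msym_swD // ?subrr ?mulr0 //.
  by rewrite -ltnS.
- by exists (g + h); rewrite mulrDr -hg -hh msymD opprD addrACA.
- exists (g * q + msym (sw i) p * h).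
  by rewrite mulrDr mulrA -hg mulrCA -hh msymM; ring.
Qed.

(** The sign is chosen so that d_i x_(i+1) = 1, which gives the iterated operators the value 1 on
    top powers. For i >= m there is no i-th simple transposition and the value is 0. *)
Definition dd (i : nat) (f : R) : R :=
  if pselect (i < m)%N is left h then projT1 (cid (dd_exists f h)) else 0.

Lemma ddE i f : (i < m)%N -> (xv i.+1 - xv i) * dd i f = f - msym (sw i) f.
Proof. by move=> hi; rewrite /dd; case: pselect => // h; case: cid. Qed.

Lemma dd_out i f : ~~ (i < m)%N -> dd i f = 0.
Proof. by move=> hi; rewrite /dd; case: pselect => // h; rewrite h in hi. Qed.

Lemma dd_uniq i f g : (i < m)%N -> f - msym (sw i) f = (xv i.+1 - xv i) * g -> dd i f = g.
Proof. by move=> hi e; apply: (mulfI (xv_neq hi)); rewrite ddE. Qed.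

Lemma dd_additive i : zmod_morphism (dd i).
Proof.
move=> f g; have [hi|hi] := boolP (i < m)%N.
  apply: dd_uniq => //; rewrite mulrBr !ddE // msymB; ring.
by rewrite !dd_out // subrr.
Qed.

Lemma dd_linear i c f : (i < m)%N -> msym (sw i) c = c -> dd i (c * f) = c * dd i f.
Proof. by move=> hi hc; apply: dd_uniq => //; rewrite mulrCA ddE // msymM hc mulrBr. Qed.

Lemma dd_const i c : (i < m)%N -> msym (sw i) c = c -> dd i c = 0.
Proof. by move=> hi hc; apply: dd_uniq => //; rewrite hc subrr mulr0. Qed.

Lemma dd_hsym i Y k : (i < m)%N -> map (msym (sw i)) Y = Y ->
  dd i (hsym (xv i.+1 :: Y) k.+1) = hsym (xv i :: xv i.+1 :: Y) k.
Proof.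
move=> hi hY; apply: dd_uniq => //.
rewrite -(opprB (xv i) (xv i.+1)) mulNr hsym_swap opprB; congr (_ - _).
have -> : msym (sw i) = [eta (msym (sw i) : {rmorphism R -> R})] by [].
by rewrite hsym_morph map_cons /= hY -[in RHS](msym_swr i).
Qed.

Lemma pdeg_msym s d f : pdeg d f -> pdeg d (msym s f).
Proof.
move=> hf mm; rewrite mcoeff_msupp mcoeff_sym -mcoeff_msupp => /hf ->.
by rewrite mdeg_mperm.
Qed.

Lemma pdeg_xv i : pdeg 2 (xv i).
Proof. by move=> mm; rewrite msuppX inE => /eqP->; rewrite mdeg1. Qed.

Lemma xvX_deg i j : pdeg (2 * j)%N%:Z (xv i ^+ j).
Proof.
elim: j => [|j IH]; first by rewrite expr0; exact: pdeg1.
have -> : (2 * j.+1)%N%:Z = 2 + (2 * j)%N%:Z :> int by lia.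
by rewrite exprS; apply: pdegM => //; exact: pdeg_xv.
Qed.

(** Multiplication by h shifts homogeneous components by e: for j != d the degree j component of g,
    times h, is the vanishing degree j + e component of h g, and the ring is a domain. *)
Lemma pdeg_cancel d e (h g : R) : h != 0 -> pdeg e h -> pdeg (d + e) (h * g) -> pdeg d g.
Proof.
move=> h0 eh hg; pose G := gdeg_grading (breg (polyR m.+1)).
have pg j : j != d -> pr G j (g : breg (polyR m.+1)) = 0.
  move=> jd; apply: (mulfI h0); rewrite mulr0.
  have e1 := @pr_scale (polyR m.+1) (breg (polyR m.+1)) e (j + e) h g eh.
  rewrite addrK in e1; rewrite -[LHS]e1 (pr_id G _ hg).
  by case: eqP => // /addIr e'; rewrite e' eqxx in jd.
rewrite (pr_sum G g); apply: (gr_sum G) => j _.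
have [->|/pg->] := eqVneq j d; first exact: pr_gr.
exact: gr0 G _.
Qed.

Lemma pdeg_dd i d f : pdeg d f -> pdeg (d - 2) (dd i f).
Proof.
move=> hf; have [hi|hi] := boolP (i < m)%N; last first.
  by rewrite dd_out // => mm; rewrite msupp0.
apply: (pdeg_cancel (e := 2) (xv_neq hi)).
  by apply: (grB (pdeg_grading _)); exact: pdeg_xv.
rewrite ddE // subrK; apply: (grB (pdeg_grading _)) => //; exact: pdeg_msym.
Qed.

Definition ddw (w : seq nat) (f : R) : R := foldr dd f w.

Lemma ddw_cat w1 w2 f : ddw (w1 ++ w2) f = ddw w1 (ddw w2 f).
Proof. by rewrite /ddw foldr_cat. Qed.

Lemma ddw_additive w : zmod_morphism (ddw w).
Proof. by elim: w => [|i w IH] f g //=; rewrite IH dd_additive. Qed.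

Lemma pdeg_ddw w d f : pdeg d f -> pdeg (d - (2 * size w)%N%:Z) (ddw w f).
Proof.
elim: w => [|i w IH] hf /=; first by rewrite muln0 subr0.
have -> : d - (2 * (size w).+1)%N%:Z = d - (2 * size w)%N%:Z - 2 by lia.
exact: pdeg_dd (IH hf).
Qed.

Lemma ddw_linear w c f : all (fun i => i < m)%N w ->
  (forall i, i \in w -> msym (sw i) c = c) -> ddw w (c * f) = c * ddw w f.
Proof.
elim: w => [|i w IH] //= /andP[hi hw] hc.
rewrite IH //; last by move=> j jw; apply: hc; rewrite inE jw orbT.
by rewrite dd_linear // hc // mem_head.
Qed.

(** x_k^j is h_j(x_k), and d_(k-1) acts first. Each divided difference adjoins the next lower
    variable and lowers the degree by one, so l of them give h_(j-l)(x_(k-l), ..., x_k), or 0 once l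
    exceeds j. *)
Lemma ddw_power k j : (k <= m)%N -> (j <= k)%N ->
  ddw (iota 0 k) (xv k ^+ j) = (j == k)%:R.
Proof.
move=> km jk.
have aux l : (l <= k)%N -> ddw (iota (k - l) l) (xv k ^+ j) =
    if (l <= j)%N then hsym [seq xv i | i <- iota (k - l) l.+1] (j - l) else 0.
  elim: l => [_|l IH lk]; first by rewrite !subn0; exact/esym/hsym1.
  rewrite [ddw _ _]/= -[ddw (iota _ l) _]/(ddw _ _).
  have e : (k - l.+1).+1 = (k - l)%N by lia.
  have hi : (k - l.+1 < m)%N by lia.
  have h0 c : dd (k - l.+1) (c%:MP) = 0.
    by apply: dd_const => //; rewrite msym_C.
  rewrite e IH; last exact: ltnW.
  case: (ltnP l j) => lj; last first.
    case: ifP => lj'; last by rewrite -mpolyC0 h0.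
    by have -> : (j - l = 0)%N; [lia | rewrite hsym0 -mpolyC1 h0].
  rewrite (ltnW lj).
  have -> : (j - l = (j - l.+1).+1)%N by lia.
  rewrite [iota (k - l) _]/= map_cons -{1}e dd_hsym //; first by rewrite /= e.
  rewrite -map_comp; apply/eq_in_map => i; rewrite mem_iota => hil /=.
  by apply: msym_swD => //; lia.
have := aux k (leqnn k); rewrite subnn => ->.
have [->|njk] := eqVneq j k; first by rewrite leqnn subnn hsym0.
by rewrite leqNgt ltn_neqAle njk jk.
Qed.

(** * The tower of subrings between the polynomial ring and the symmetric polynomials *)

Definition symm f := forall s : 'S_m.+1, msym s f = f.

(* The subring A_k generated by the symmetric polynomials and the x_i, i >= k;
   A_0 is the whole ring and A_(m+1) consists of the symmetric polynomials. *)
Inductive tower (k : nat) : R -> Prop :=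
| tower_sym f : symm f -> tower k f
| tower_X i : (k <= i <= m)%N -> tower k (xv i)
| towerD f g : tower k f -> tower k g -> tower k (f + g)
| towerM f g : tower k f -> tower k g -> tower k (f * g).

Lemma symm_C c : symm c%:MP.
Proof. by move=> s; rewrite msym_C. Qed.

Lemma tower_C k c : tower k c%:MP.
Proof. exact: tower_sym (symm_C c). Qed.

Lemma tower0 k : tower k 0.
Proof. by rewrite -mpolyC0; exact: tower_C. Qed.

Lemma tower1 k : tower k 1.
Proof. by rewrite -mpolyC1; exact: tower_C. Qed.

Lemma towerN k f : tower k f -> tower k (- f).
Proof. by move=> hf; rewrite -mulN1r -mpolyC1 -mpolyCN; apply: towerM => //; exact: tower_C. Qed.

Lemma tower_sum k (I : Type) (s : seq I) (F : I -> R) :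
  (forall i, tower k (F i)) -> tower k (\sum_(i <- s) F i).
Proof. by move=> h; apply: big_ind => //; [exact: tower0 | exact: towerD]. Qed.

Lemma towerX k f j : tower k f -> tower k (f ^+ j).
Proof.
by move=> hf; elim: j => [|j IH]; rewrite ?exprS; [exact: tower1 | exact: towerM].
Qed.

Lemma tower_le k l f : (k <= l)%N -> tower l f -> tower k f.
Proof.
move=> kl; elim=> {f} [f hf|i /andP[li im]|f g _ hf _ hg|f g _ hf _ hg].
- exact: tower_sym.
- by apply: tower_X; rewrite (leq_trans kl li).
- exact: towerD.
- exact: towerM.
Qed.

Lemma tower_all f : tower 0 f.
Proof.
elim/mpoly_gen_ind: f => [c|i|p q|p q]; [exact: tower_C | |exact: towerD|exact: towerM].
have -> : 'X_i = xv i by rewrite /xv inord_val.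
by apply: tower_X; rewrite /= -ltnS.
Qed.

Lemma tower_top f : tower m.+1 f -> symm f.
Proof.
elim=> {f} [f //|i /andP[h1 h2]|f g _ hf _ hg s|f g _ hf _ hg s].
- by move: (leq_trans h1 h2); rewrite ltnn.
- by rewrite msymD hf hg.
- by rewrite msymM hf hg.
Qed.

Lemma tower_inv k f i : (i.+1 < k <= m.+1)%N -> tower k f -> msym (sw i) f = f.
Proof.
move=> hik; elim=> {f} [f //|j /andP[h1 h2]|f g _ hf _ hg|f g _ hf _ hg].
- by apply: msym_swD => //; lia.
- by rewrite msymD hf hg.
- by rewrite msymM hf hg.
Qed.

(** For index k + 1 this is the monic equation of x_k over A_(k+1); it makes 1, x_k, ..., x_k^k span
    A_k over A_(k+1). *)
Definition rootpoly (k : nat) : {poly R} := \prod_(i < k) ('X - (xv i)%:P).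

Lemma rootpolyS k : rootpoly k.+1 = rootpoly k * ('X - (xv k)%:P).
Proof. by rewrite /rootpoly big_ord_recr. Qed.

Lemma rootpoly_coefS k j :
  (rootpoly k.+1)`_j.+1 = (rootpoly k)`_j - xv k * (rootpoly k)`_j.+1.
Proof. by rewrite rootpolyS mulrBr coefB coefMX coefMC mulrC. Qed.

Lemma rootpoly_coef0 k : (rootpoly k.+1)`_0 = - (xv k * (rootpoly k)`_0).
Proof. by rewrite rootpolyS mulrBr coefB coefMX coefMC mulrC sub0r. Qed.

Lemma rootpoly_out k j : (k < j)%N -> (rootpoly k)`_j = 0.
Proof.
elim: k j => [|k IH] [|j] // kj; last first.
  by rewrite rootpoly_coefS !IH ?mulr0 ?subrr // ltnW.
by rewrite /rootpoly big_ord0 coef1.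
Qed.

Lemma rootpoly_lead k : (rootpoly k)`_k = 1.
Proof.
elim: k => [|k IH]; first by rewrite /rootpoly big_ord0 coef1.
by rewrite rootpoly_coefS IH rootpoly_out // mulr0 subr0.
Qed.

(** Descending induction on k. The product over all variables has symmetric coefficients; passing
    from k + 1 to k divides by X - x_k, and synthetic division computes the quotient from the
    leading coefficient downwards using only the old coefficients and x_k. *)
Lemma rootpoly_tower k j : (k <= m.+1)%N -> tower k (rootpoly k)`_j.
Proof.
move=> km; rewrite -(subKn km); move: (m.+1 - k)%N (leq_subr k m.+1) => {km}l.
elim: l j => [|l IH] j lm.
  apply: tower_sym => s; rewrite subn0.
  have e : map_poly (msym s) (rootpoly m.+1) = rootpoly m.+1.
    rewrite /rootpoly rmorph_prod /= [RHS](reindex_inj (@perm_inj _ s)) /=.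
    apply: eq_bigr => i _; rewrite map_polyXsubC /=; congr ('X - _%:P).
    by rewrite /xv msym_U !inord_val.
  by rewrite -[in RHS]e coef_map_id0 ?msym0.
have e : (m.+1 - l = (m.+1 - l.+1).+1)%N by lia.
move: IH; rewrite e; set k' := (m.+1 - l.+1)%N => IH.
have [kj|jk] := ltnP k' j; first by rewrite rootpoly_out //; exact: tower0.
rewrite -(subKn jk); elim: (k' - j)%N => [|i IHi].
  by rewrite subn0 rootpoly_lead; exact: tower1.
have [ik|ki] := ltnP i k'; last first.
  by move: IHi; have -> : (k' - i.+1 = k' - i)%N by lia.
have e' : (k' - i = (k' - i.+1).+1)%N by lia.
have := rootpoly_coefS k' (k' - i.+1)%N; rewrite -e' => /eqP.
rewrite eq_sym subr_eq => /eqP->; apply: towerD.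
  by apply: (@tower_le _ k'.+1) => //; apply: IH; exact: ltnW.
apply: towerM => //; apply: tower_X; rewrite leqnn /=; rewrite /k'; lia.
Qed.

Lemma rootpoly_deg k j : pdeg ((2 * k)%N%:Z - (2 * j)%N%:Z) (rootpoly k)`_j.
Proof.
have G := pdeg_grading m.+1.
elim: k j => [|k IH] j.
  rewrite /rootpoly big_ord0 coef1; case: j => [|j] /=.
    by rewrite muln0 subrr; exact: pdeg1.
  exact: gr0 G _.
have e d : (2 * k.+1)%N%:Z - d = 2 + ((2 * k)%N%:Z - d) by lia.
case: j => [|j].
  rewrite rootpoly_coef0; apply: (grN G); rewrite e; apply: pdegM => //.
  exact: pdeg_xv.
rewrite rootpoly_coefS; apply: (grB G).
  by have -> : (2 * k.+1)%N%:Z - (2 * j.+1)%N%:Z = (2 * k)%N%:Z - (2 * j)%N%:Z by lia.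
by rewrite e; apply: pdegM => //; exact: pdeg_xv.
Qed.

Lemma rootpoly_root k : \sum_(0 <= j < k.+2) (rootpoly k.+1)`_j * xv k ^+ j = 0.
Proof.
rewrite big_mkord -horner_coef_wide; first by rewrite rootpolyS hornerM hornerXsubC subrr mulr0.
by apply/leq_sizeP => j kj; rewrite rootpoly_out.
Qed.

(** The A_(k+1)-span of 1, ..., x_k^k is closed under multiplication by x_k, since the monic
    equation of x_k rewrites the power k + 1. It is therefore a ring, and it contains the generators
    of A_k. *)
Lemma tower_span k f : (k <= m)%N -> tower k f ->
  exists c : nat -> R, (forall j, tower k.+1 (c j)) /\
    f = \sum_(0 <= j < k.+1) c j * xv k ^+ j.
Proof.
move=> km.
pose sp f := exists c : nat -> R, (forall j, tower k.+1 (c j)) /\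
    f = \sum_(0 <= j < k.+1) c j * xv k ^+ j.
have sp1 g : tower k.+1 g -> sp g.
  move=> hg; exists (fun j => if j == 0%N then g else 0); split=> [j|].
    by case: eqP => // _; exact: tower0.
  rewrite big_nat_recl //= expr0 mulr1 big1 ?addr0 // => j _.
  by rewrite mul0r.
have spD g h : sp g -> sp h -> sp (g + h).
  move=> [c [hc ->]] [d [hd ->]]; exists (fun j => c j + d j); split=> [j|].
    exact: towerD.
  by rewrite -big_split; apply: eq_bigr => j _; rewrite mulrDl.
have spM a g : tower k.+1 a -> sp g -> sp (a * g).
  move=> ha [c [hc ->]]; exists (fun j => a * c j); split=> [j|].
    exact: towerM.
  by rewrite big_distrr; apply: eq_bigr => j _; rewrite /= mulrA.
have sp0 : sp 0 by apply: sp1; exact: tower0.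
have sp_sum (s : seq nat) (F : nat -> R) :
    (forall j, j \in s -> sp (F j)) -> sp (\sum_(j <- s) F j).
  by move=> h; rewrite big_seq; apply: big_ind => // j js; apply: h.
have spw j : (j <= k)%N -> sp (xv k ^+ j).
  move=> jk; exists (fun i => (i == j)%:R); split=> [i|].
    by case: eqP => _; [exact: tower1 | exact: tower0].
  rewrite (bigD1_seq j) ?mem_index_iota ?iota_uniq ?leq0n ?ltnS // eqxx mul1r big1.
    exact/esym/addr0.
  by move=> i /negPf->; rewrite mul0r.
have spX g : sp g -> sp (xv k * g).
  move=> [c [hc ->]]; rewrite big_distrr /=; apply: (sp_sum) => j.
  rewrite mem_index_iota /= ltnS => jk; rewrite mulrCA -exprS; apply: (spM) => //.
  move: jk; rewrite leq_eqVlt => /orP[/eqP->|]; last exact: spw.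
  have := rootpoly_root k; rewrite big_nat_recr //= rootpoly_lead mul1r addrC.
  move/eqP; rewrite addr_eq0 => /eqP->; rewrite -mulN1r.
  apply: (spM); first exact: (towerN (tower1 _)).
  apply: (sp_sum) => i; rewrite mem_index_iota /= ltnS => ik.
  by apply: (spM); [exact: rootpoly_tower | exact: spw].
have spXn j g : sp g -> sp (xv k ^+ j * g).
  by elim: j => [|j IH] hg; rewrite ?expr0 ?mul1r // exprS -mulrA; apply: spX; apply: IH.
rewrite -/(sp f); elim=> {f} [f hf|i /andP[ki im]|f g _ hf _ hg|f g _ hf _ hg].
- by apply: sp1; apply: tower_sym.
- move: ki; rewrite leq_eqVlt => /orP[/eqP<-|ki].
    by rewrite -[xv k]mulr1; apply/spX/sp1/tower1.
  by apply: sp1; apply: tower_X; rewrite ki.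
- exact: spD.
- case: hf => c [hc ->]; rewrite big_distrl /=; apply: (sp_sum) => j _.
  by rewrite -mulrA; apply: (spM) => //; apply: spXn.
Qed.

Section OneStep.
Variable k : nat.
Hypothesis km : (k <= m)%N.
Local Notation D := (ddw (iota 0 k)).

Lemma step_linear c f : tower k.+1 c -> D (c * f) = c * D f.
Proof.
move=> hc; apply: ddw_linear => [|i].
  by apply/allP => i; rewrite mem_iota; lia.
by rewrite mem_iota => hi; apply: (tower_inv _ hc); lia.
Qed.

Lemma step_sum (c F : nat -> R) N : (forall j, tower k.+1 (c j)) ->
  D (\sum_(0 <= j < N) c j * F j) = \sum_(0 <= j < N) c j * D (F j).
Proof.
move=> hc; rewrite (zm_sum (ddw_additive _)).
by apply: eq_bigr => j _; rewrite step_linear.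
Qed.

Lemma step_tower f : tower k f -> tower k.+1 (D f).
Proof.
move=> /(tower_span km)[c [hc ->]]; rewrite step_sum // big_mkord.
apply: tower_sum => j; apply: towerM => //.
rewrite ddw_power // ?leq_ord //; case: eqP => _; [exact: tower1 | exact: tower0].
Qed.

(* The coefficients in t of the quotient of prod_(i <= k) (t - x_i) by t - x_k. *)
Definition dualv j : R := \sum_(0 <= l < k.+1) (rootpoly k.+1)`_(l + j.+1) * xv k ^+ l.

(** On A_k, which is spanned by the powers of x_k, the operator D reads off the coefficient of
    x_k^k; for this functional Euler's formula gives the dual basis as the coefficients of F(t) / (t
    - x_k), with F the monic equation of x_k. *)
Lemma step_dual i j : (i <= k)%N -> (j <= k)%N ->
  D (xv k ^+ i * dualv j) = (i == j)%:R.
Proof.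
move=> ik jk; pose c := fun l => (rootpoly k.+1)`_l.
have hc l : tower k.+1 (c l) by exact: rootpoly_tower.
pose e t := D (xv k ^+ t).
have elt t : (t < k)%N -> e t = 0.
  by move=> tk; rewrite /e ddw_power ?(ltnW tk) // ltn_eqF.
have -> : D (xv k ^+ i * dualv j) = \sum_(0 <= l < k.+1) c (l + j.+1)%N * e (l + i)%N.
  rewrite -step_sum // big_distrr; congr (D _); apply: eq_bigr => l _ /=.
  by rewrite mulrCA -exprD [(i + _)%N]addnC.
have [ij|ij|eij] := ltngtP i j.
- apply: big_nat_eq0 => l /andP[_ lk].
  have [h|h] := ltnP (l + i) k; first by rewrite elt // mulr0.
  by rewrite /c rootpoly_out ?mul0r //; lia.
(* After an index shift the sum becomes D (x_k^r F(x_k)), which is 0. The terms added have exponent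
   l + r < i <= k, where D vanishes; those removed have a coefficient beyond the degree of F. *)
- pose r := (i - j.+1)%N; pose G l := c l * e (l + r)%N.
  have -> : \sum_(0 <= l < k.+1) c (l + j.+1)%N * e (l + i)%N = \sum_(0 <= l < k.+1 + j.+1) G l.
    rewrite [RHS](@big_cat_nat _ _ _ j.+1) //=; last by lia.
    rewrite [X in _ = X + _]big_nat_eq0 ?add0r; last first.
      by move=> l /andP[_ lj]; rewrite /G elt ?mulr0 // /r; lia.
    rewrite -{2}[j.+1]add0n big_addn addnK; apply: eq_bigr => l _.
    by rewrite /G -addnA; congr (_ * e (_ + _)%N); rewrite /r; lia.
  rewrite (@big_cat_nat _ _ _ k.+2) //=; last by lia.
  rewrite [X in _ + X]big_nat_eq0 ?addr0; last first.
    by move=> l /andP[lk _]; rewrite /G /c rootpoly_out ?mul0r.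
  transitivity (D (xv k ^+ r * \sum_(0 <= l < k.+2) c l * xv k ^+ l)).
    rewrite big_distrr -step_sum //; congr (D _); apply: eq_bigr => l _.
    by rewrite /= mulrCA -exprD [(r + _)%N]addnC.
  by rewrite rootpoly_root mulr0 (zm0 (ddw_additive _)).
- rewrite eij (@big_cat_nat _ _ _ (k - j)) //=; last by lia.
  rewrite [X in X + _]big_nat_eq0 ?add0r; last by move=> l /andP[_ lk]; rewrite elt ?mulr0 //; lia.
  rewrite big_ltn; last by lia.
  have -> : (k - j + j.+1 = k.+1)%N by lia.
  rewrite /c rootpoly_lead subnK // /e ddw_power // eqxx mulr1.
  rewrite big_nat_eq0 ?addr0 // => l /andP[lk _].
  by rewrite rootpoly_out ?mul0r //; lia.
Qed.

Lemma dualv_tower j : tower k (dualv j).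
Proof.
apply: tower_sum => l; apply: towerM; first by apply: tower_le (leqnSn k) _; exact: rootpoly_tower.
by apply: towerX; apply: tower_X; rewrite leqnn.
Qed.

Lemma step_expand g : tower k g -> g = \sum_(j < k.+1) D (g * dualv j) * xv k ^+ j.
Proof.
move=> /(tower_span km)[c [hc ->]]; rewrite big_mkord; apply: eq_bigr => j _.
congr (_ * _); rewrite -(big_mkord xpredT (fun i => c i * xv k ^+ i)) big_distrl /=.
under eq_bigr do rewrite -mulrA.
rewrite step_sum // big_mkord (bigD1 j) //= step_dual ?leq_ord // eqxx mulr1.
by rewrite big1 ?addr0 // => i ij; rewrite step_dual ?leq_ord // (negPf (ij : i != j :> nat)) mulr0.
Qed.

(** The difference g' of the two sides pairs to zero with every power of x_k, hence with all of A_k;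
    expanding g' itself by [step_expand] then shows that it vanishes. *)
Lemma step_expand_dual g : tower k g -> g = \sum_(j < k.+1) D (g * xv k ^+ j) * dualv j.
Proof.
move=> hg; pose g' := g - \sum_(j < k.+1) D (g * xv k ^+ j) * dualv j.
have hx j : tower k (xv k ^+ j) by apply: towerX; apply: tower_X; rewrite leqnn.
have hD j : tower k.+1 (D (g * xv k ^+ j)) by apply: step_tower; apply: towerM.
have hg' : tower k g'.
  apply: towerD => //; apply: towerN; apply: tower_sum => j; apply: towerM.
    exact: tower_le (leqnSn k) _.
  exact: dualv_tower.
have z (j : 'I_k.+1) : D (g' * xv k ^+ j) = 0.
  have hd (i : 'I_k.+1) : D (D (g * xv k ^+ i) * dualv i * xv k ^+ j) =
      D (g * xv k ^+ i) * (j == i)%:R.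
    by rewrite -mulrA step_linear // [dualv i * _]mulrC step_dual ?leq_ord.
  rewrite mulrBl ddw_additive big_distrl (zm_sum (ddw_additive _)) /=.
  rewrite (eq_bigr _ (fun i _ => hd i)) (bigD1 j) //= eqxx mulr1.
  rewrite big1 ?addr0 ?subrr // => i ij.
  by rewrite eq_sym (negPf ij) mulr0.
have z' h : tower k h -> D (g' * h) = 0.
  move=> /(tower_span km)[c [hc ->]]; rewrite big_distrr /=.
  under eq_bigr do rewrite mulrCA.
  by rewrite step_sum // big_mkord big1 // => j _; rewrite z mulr0.
apply/eqP; rewrite -subr_eq0 -/g' (step_expand hg') big1 // => j _.
by rewrite z' ?mul0r //; exact: dualv_tower.
Qed.

Lemma dualv_deg j : pdeg ((2 * k)%N%:Z - (2 * j)%N%:Z) (dualv j).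
Proof.
apply: (gr_sum (pdeg_grading _)) => l _.
have -> : (2 * k)%N%:Z - (2 * j)%N%:Z =
    (2 * k.+1)%N%:Z - (2 * (l + j.+1))%N%:Z + (2 * l)%N%:Z by lia.
apply: pdegM; [exact: rootpoly_deg | exact: xvX_deg].
Qed.
End OneStep.

(** Traces compose and dual bases multiply along the tower: an element is expanded over A_k, and
    then each coefficient over A_(k+1). Step k contributes k letters, whence the length k (k - 1) /
    2 at stage k. *)
Lemma frobenius_tower k : (k <= m.+1)%N ->
  exists (w : seq nat) (I : finType) (a b : I -> R) (d : I -> int),
    [/\ [/\ all (fun i => i < m)%N w, size w = ((k * k.-1)./2)%N,
        forall f, tower k (ddw w f)
        & forall c f, tower k c -> ddw w (c * f) = c * ddw w f],
      forall i, pdeg (d i) (a i) /\ pdeg ((2 * size w)%N%:Z - d i) (b i),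
      forall f, f = \sum_i ddw w (f * a i) * b i,
      forall f, f = \sum_i ddw w (f * b i) * a i
    & forall i j, ddw w (a i * b j) = (i == j)%:R].
Proof.
elim: k => [_|k IH km].
  exists [::], unit, (fun=> 1), (fun=> 1), (fun=> 0).
  split=> //; first by split=> // f; exact: tower_all.
  - by move=> _; rewrite muln0 subr0; split; exact: pdeg1.
  - by move=> f; rewrite (big_pred1 tt) ?mulr1 // => -[].
  - by move=> f; rewrite (big_pred1 tt) ?mulr1 // => -[].
  - by move=> [] []; rewrite /= mulr1.
have [w [I [a [b [d [[wm sw_ wt wl] dab e1 e2 e3]]]]]] := IH (ltnW km).
have hx j : tower k (xv k ^+ j) by apply: towerX; apply: tower_X; rewrite leqnn.
(* [ddw] applies the end of the word first, so the letters of the new step go in front. *)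
exists (iota 0 k ++ w), (I * 'I_k.+1)%type, 
  (fun p : I * 'I_k.+1 => a p.1 * xv k ^+ p.2),
  (fun p : I * 'I_k.+1 => b p.1 * dualv k p.2),
  (fun p : I * 'I_k.+1 => d p.1 + (2 * p.2)%N%:Z).
have hw f : ddw (iota 0 k ++ w) f = ddw (iota 0 k) (ddw w f) by exact: ddw_cat.
split.
- split.
  + by rewrite all_cat wm andbT; apply/allP => i; rewrite mem_iota; lia.
  + rewrite size_cat size_iota sw_.
    have -> : (k.+1 * k.+1.-1 = k.*2 + k * k.-1)%N by case: (k) => [|l] //=; lia.
    by rewrite halfD odd_double doubleK.
  + by move=> f; rewrite hw; apply: step_tower.
  + by move=> c f hc; rewrite !hw wl ?step_linear //; exact: tower_le (leqnSn k) _.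
- move=> [i j] /=; have [da db] := dab i; split.
    by apply: pdegM => //; exact: xvX_deg.
  have -> : (2 * size (iota 0 k ++ w))%N%:Z - (d i + (2 * j)%N%:Z) =
      (2 * size w)%N%:Z - d i + ((2 * k)%N%:Z - (2 * j)%N%:Z).
    by rewrite size_cat size_iota; lia.
  by apply: pdegM => //; exact: dualv_deg.
- move=> f; rewrite {1}(e1 f) -(pair_bigA _ (fun i (j : 'I_k.+1) =>
    ddw (iota 0 k ++ w) (f * (a i * xv k ^+ j)) * (b i * dualv k j))) /=.
  apply: eq_bigr => i _; rewrite {1}(step_expand_dual km (wt (f * a i))) big_distrl /=.
  apply: eq_bigr => j _; rewrite hw [f * (_ * _)]mulrA [f * a i * _]mulrC (wl (xv k ^+ j)) //.
  by rewrite [xv k ^+ j * _]mulrC [b i * _]mulrC mulrA.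
- move=> f; rewrite {1}(e2 f) -(pair_bigA _ (fun i (j : 'I_k.+1) =>
    ddw (iota 0 k ++ w) (f * (b i * dualv k j)) * (a i * xv k ^+ j))) /=.
  apply: eq_bigr => i _; rewrite {1}(step_expand km (wt (f * b i))) big_distrl /=.
  apply: eq_bigr => j _; rewrite hw [f * (_ * _)]mulrA [f * b i * _]mulrC (wl (dualv k j)) //.
    2: exact: dualv_tower.
  by rewrite [dualv k j * _]mulrC [a i * _]mulrC mulrA.
move=> [i j] [i' j'] /=; rewrite hw mulrACA mulrC wl; last first.
  by apply: towerM => //; exact: dualv_tower.
rewrite e3 xpair_eqE; case: (i == i'); last first.
  by rewrite mulr0 (zm0 (ddw_additive _)).
by rewrite mulr1 step_dual ?leq_ord //.
Qed.

Lemma frobenius_basis : exists (w : seq nat) (I : finType) (a b : I -> R) (d : I -> int),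
    [/\ [/\ all (fun i => i < m)%N w, size w = ((m.+1 * m)./2)%N,
        forall f, symm (ddw w f)
        & forall c f, symm c -> ddw w (c * f) = c * ddw w f],
      forall i, pdeg (d i) (a i) /\ pdeg ((2 * size w)%N%:Z - d i) (b i),
      forall f, f = \sum_i ddw w (f * a i) * b i,
      forall f, f = \sum_i ddw w (f * b i) * a i
    & forall i j, ddw w (a i * b j) = (i == j)%:R].
Proof.
have [w [I [a [b [d [[h1 h2 h3 h4] h5 h6 h7 h8]]]]]] := frobenius_tower (leqnn m.+1).
exists w, I, a, b, d; split=> //; split=> // [f|c f hc].
  exact: tower_top.
by apply: h4; exact: tower_sym.
Qed.
End DividedDifferences.

(** * Tensor products of bimodules *)

Section TensorLift.
Variables (A : gradedRing) (S : gradedSubring A) (M N K : gbimod A).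
Variable f : M -> N -> K.
Hypothesis fb : balanced S f.
Hypothesis fZ : forall a m n, f (a *: m) n = a *: f m n.
Hypothesis fr : forall a m n, f m (ract n a) = ract (f m n) a.
Hypothesis fd : forall i j m n, gdeg i m -> gdeg j n -> gdeg (i + j) (f m n).

(** The lift is kept opaque: only its values on pure tensors are visible, which determine it. *)
Definition blift_sig :
  {g : bhom (btens S M N) K | forall m n, g (pure S m n) = f m n}.
Proof.
unshelve eexists; [apply: (@mk_bhom _ (btens S M N) K (tlift f)) | exact: tlift_pure fb]
  => [a u v|t a|k t].
- rewrite (zmD (tlift_additive fb)); congr (_ + _); move: u; apply: tens_ext.
  + by move=> t u; rewrite scalerBr (tlift_additive fb).
  + by move=> t u; rewrite (tlift_additive fb) scalerBr.
  + by move=> m n; rewrite scale_pure !(tlift_pure fb) fZ.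
- move: t; apply: tens_ext.
  + by move=> t u; rewrite (ractl_additive (M := btens S M N)) (tlift_additive fb).
  + by move=> t u; rewrite (tlift_additive fb) (ractl_additive (M := K)).
  + by move=> m n; rewrite /= tract_pure !(tlift_pure fb) fr.
- elim=> {t} [_ [i [j [m [n [hm hn <- ->]]]]]||u v _ du _ dv].
  + by rewrite (tlift_pure fb); exact: fd.
  + by rewrite (zm0 (tlift_additive fb)); exact: gr0 (gdeg_grading K) _.
  + by rewrite (tlift_additive fb); exact: grB (gdeg_grading K) _ _ _ du dv.
Qed.

Definition blift := sval blift_sig.

Lemma blift_pure m n : blift (pure S m n) = f m n.
Proof. exact: (svalP blift_sig). Qed.
End TensorLift.

Section Bimod.
Variable A : gradedRing.
Implicit Types M N K : gbimod A.
Local Notation fullA := (full_subring A).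
Local Notation pr_ := (pure (full_subring A)).

Lemma pure_deg (S : gradedSubring A) M N i j (m : M) (n : N) :
  gdeg i m -> gdeg j n -> gdeg (i + j) (pure S m n : btens S M N).
Proof. by move=> hm hn; apply: span_gen; exists i, j, m, n. Qed.

Lemma ract_pure (S : gradedSubring A) M N (m : M) (n : N) a :
  ract (pure S m n : btens S M N) a = pure S m (ract n a).
Proof. exact: tract_pure. Qed.

Lemma pureZ M N (m : M) (n : N) a : pr_ m (a *: n) = pr_ (ract m a) n.
Proof. by rewrite pureM. Qed.

Lemma pureZl (S : gradedSubring A) M N (m : M) (n : N) a :
  pure S (a *: m) n = a *: (pure S m n : btens S M N).
Proof. by rewrite scale_pure. Qed.

Lemma bhom_tens_ext (S : gradedSubring A) M N K (f g : bhom (btens S M N) K) :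
  (forall m n, f (pure S m n) = g (pure S m n)) -> forall t, f t = g t.
Proof. exact: (tens_ext (bhomB f) (bhomB g)). Qed.

Lemma biso_refl M : biso M M.
Proof. by exists (bid M), (bid M). Qed.

Lemma biso_sym M N : biso M N -> biso N M.
Proof. by move=> [f [g [fg gf]]]; exists g, f. Qed.

Lemma biso_trans M N K : biso M N -> biso N K -> biso M K.
Proof.
move=> [f [g [fg gf]]] [f' [g' [fg' gf']]].
by exists (bcomp f' f), (bcomp g g'); split=> x /=; rewrite ?fg' ?fg ?gf ?gf'.
Qed.

Section Units.
Variable M : gbimod A.

Definition lunit : bhom (breg A \tens M) M.
Proof.
apply: (@blift A fullA (breg A) M M (fun a m => (a : A) *: m)).
- split=> [m a b|a m m'|a b m _]; first by rewrite scalerBl.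
    by rewrite scalerBr.
  by rewrite /= scalerA.
- by move=> a b m; rewrite -scalerA.
- by move=> a b m; rewrite ractZ.
- by move=> i j a m; exact: gdegl.
Defined.

Definition lunit_inv : bhom M (breg A \tens M).
Proof.
apply: (@mk_bhom _ M (breg A \tens M) (fun m => pr_ (1 : breg A) m)) => [a u v|m a|i m hm].
- by rewrite pureDr pureZ -pureZl; congr (pr_ _ _ + _); rewrite /= /GRing.scale /= mul1r mulr1.
- by rewrite ract_pure.
- by rewrite -[i]add0r; apply: pure_deg => //; exact: rdeg1.
Defined.

Lemma lunitE (a : A) m : lunit (pr_ (a : breg A) m) = a *: m.
Proof. exact: blift_pure. Qed.

Lemma biso_lunit : biso (breg A \tens M) M.
Proof.
exists lunit, lunit_inv; split=> [t|m]; last first.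
  by rewrite /= lunitE scale1r.
apply: (bhom_tens_ext (f := bcomp lunit_inv lunit) (g := bid _)) => a m.
rewrite /= lunitE pureZ; congr (pr_ _ _).
by rewrite /= mul1r.
Qed.

Definition runit : bhom (M \tens breg A) M.
Proof.
apply: (@blift A fullA M (breg A) M (fun m a => ract m a)).
- split=> [a m m'|m a b|m a b _]; first exact: ractl_additive.
    exact: ractr_additive.
  by rewrite -ractA.
- by move=> a m b; rewrite -ractZ.
- by move=> a m b; rewrite ractA.
- by move=> i j m a hm ha; exact: gdegr.
Defined.

Definition runit_inv : bhom M (M \tens breg A).
Proof.
apply: (@mk_bhom _ M (M \tens breg A) (fun m => pr_ m (1 : breg A))) => [a u v|m a|i m hm].
- by rewrite pureDl pureZl.
- rewrite ract_pure -[ract (1 : breg A) a]/(1 * a : A) mul1r.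
  by rewrite -[a in RHS]mulr1 -[a * 1]/(a *: (1 : breg A)) pureZ.
- by rewrite -[i]addr0; apply: pure_deg => //; exact: rdeg1.
Defined.

Lemma runitE m (a : A) : runit (pr_ m (a : breg A)) = ract m a.
Proof. exact: blift_pure. Qed.

Lemma biso_runit : biso (M \tens breg A) M.
Proof.
exists runit, runit_inv; split=> [t|m]; last first.
  by rewrite /= runitE ract1.
apply: (bhom_tens_ext (f := bcomp runit_inv runit) (g := bid _)) => m a.
by rewrite /= runitE -pureZ; congr (pr_ _ _); rewrite /GRing.scale /= mulr1.
Qed.
End Units.

Section Assoc.
Variables M N K : gbimod A.
Local Notation MN := (M \tens N).
Local Notation NK := (N \tens K).

Lemma assoc_bal (k : K) :
  balanced fullA (fun (m : M) (n : N) => pr_ m (pr_ n k : NK) : M \tens NK).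
Proof.
split=> [n m m'|m n n'|m a n _]; rewrite ?pureBl ?pureBr //.
by rewrite -pureZ -pureZl.
Qed.

Definition assoc_sig : {f : bhom (MN \tens K) (M \tens NK) |
  forall m n k, f (pr_ (pr_ m n : MN) k) = pr_ m (pr_ n k : NK)}.
Proof.
pose F (t : MN) (k : K) : M \tens NK := tlift (fun m n => pr_ m (pr_ n k : NK)) t.
have FB k : zmod_morphism (F ^~ k) := tlift_additive (assoc_bal k).
have FE m n k : F (pr_ m n) k = pr_ m (pr_ n k : NK) by exact: (tlift_pure (assoc_bal k)).
have FBr t : zmod_morphism (F t).
  move=> k k'; move: t; apply: tens_ext => [|t u|m n]; first exact: FB.
    by rewrite !FB opprD addrACA -opprD.
  by rewrite !FE pureBr pureBr.
have Fb : balanced fullA F.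
  split=> [k|t|t a k _]; [exact: FB|exact: FBr|].
  move: t; apply: tens_ext => [t u|t u|m n]; rewrite ?FB //.
    by rewrite (ractl_additive (M := MN)) FB.
  by rewrite ract_pure !FE pureZ.
have FZ a t k : F (a *: t) k = a *: F t k.
  move: t; apply: tens_ext => [t u|t u|m n]; rewrite ?scalerBr ?FB ?scalerBr //.
  by rewrite -pureZl !FE -pureZl.
have Fr a t k : F t (ract k a) = ract (F t k) a.
  move: t; apply: tens_ext => [t u|t u|m n]; rewrite ?FB ?(ractl_additive (M := M \tens NK)) //.
  by rewrite !FE !ract_pure.
have Fd i j t k : @gdeg _ MN i t -> gdeg j k -> gdeg (i + j) (F t k).
  move=> + hk; elim=> {t} [_ [i' [j' [m [n [hm hn <- ->]]]]]||u v _ du _ dv].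
  - by rewrite FE -addrA; apply: pure_deg => //; exact: pure_deg.
  - by rewrite (zm0 (FB k)); exact: gr0 (gdeg_grading _) _.
  - by rewrite FB; exact: grB (gdeg_grading _) _ _ _ du dv.
by exists (blift Fb FZ Fr Fd) => m n k; rewrite blift_pure FE.
Qed.

Lemma assoc_inv_bal (m : M) :
  balanced fullA (fun (n : N) (k : K) => pr_ (pr_ m n : MN) k : MN \tens K).
Proof.
split=> [k n n'|n k k'|n a k _]; rewrite ?pureBr ?pureBl //.
by rewrite pureZ ract_pure.
Qed.

Definition assoc_inv_sig : {f : bhom (M \tens NK) (MN \tens K) |
  forall m n k, f (pr_ m (pr_ n k : NK)) = pr_ (pr_ m n : MN) k}.
Proof.
pose F (m : M) (t : NK) : MN \tens K := tlift (fun n k => pr_ (pr_ m n : MN) k) t.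
have FB m : zmod_morphism (F m) := tlift_additive (assoc_inv_bal m).
have FE m n k : F m (pr_ n k) = pr_ (pr_ m n : MN) k by exact: (tlift_pure (assoc_inv_bal m)).
have FBl t : zmod_morphism (F ^~ t).
  move=> m m'; move: t; apply: tens_ext => [|t u|n k]; first exact: FB.
    by rewrite !FB opprD addrACA -opprD.
  by rewrite !FE pureBl pureBl.
have Fb : balanced fullA F.
  split=> [t|m|m a t _]; [exact: FBl|exact: FB|].
  move: t; apply: tens_ext => [t u|t u|n k]; rewrite ?scalerBr ?FB //.
  by rewrite -pureZl !FE -pureZ.
have FZ a m t : F (a *: m) t = a *: F m t.
  move: t; apply: tens_ext => [t u|t u|n k]; rewrite ?FB ?scalerBr //.
  by rewrite !FE -!pureZl.
have Fr a m t : F m (ract t a) = ract (F m t) a.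
  move: t; apply: tens_ext => [t u|t u|n k];
    rewrite ?(ractl_additive (M := NK)) ?FB ?(ractl_additive (M := MN \tens K)) //.
  by rewrite !ract_pure !FE ract_pure.
have Fd i j m t : gdeg i m -> @gdeg _ NK j t -> gdeg (i + j) (F m t).
  move=> hm; elim=> {t} [_ [i' [j' [n [k [hn hk <- ->]]]]]||u v _ du _ dv].
  - by rewrite FE addrA; apply: pure_deg => //; exact: pure_deg.
  - by rewrite (zm0 (FB m)); exact: gr0 (gdeg_grading _) _.
  - by rewrite FB; exact: grB (gdeg_grading _) _ _ _ du dv.
by exists (blift Fb FZ Fr Fd) => m n k; rewrite blift_pure FE.
Qed.

Lemma biso_assoc : biso (MN \tens K) (M \tens NK).
Proof.
have [f hf] := assoc_sig; have [g hg] := assoc_inv_sig.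
have gf : forall t, bcomp g f t = bid _ t.
  apply: bhom_tens_ext => t k; move: t.
  apply: tens_ext => [t u|t u|m n]; rewrite ?pureBl ?(bhomB (bcomp g f)) //.
  by rewrite /= hf hg.
have fg : forall t, bcomp f g t = bid _ t.
  apply: bhom_tens_ext => m t; move: t.
  apply: tens_ext => [t u|t u|n k]; rewrite ?pureBr ?(bhomB (bcomp f g)) //.
  by rewrite /= hg hf.
by exists f, g; split=> t; [exact: gf | exact: fg].
Qed.
End Assoc.

Section Shifts.
Variables (M N : gbimod A) (k : int).

Lemma biso_shiftl : biso (bshift k M \tens N) (bshift k (M \tens N)).
Proof.
have dl i j m n : @gdeg _ (bshift k M) i m -> gdeg j n ->
    @gdeg _ (bshift k (M \tens N)) (i + j) (pr_ (m : M) n).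
  by move=> hm hn /=; rewrite addrAC; apply: pure_deg.
have [f fp] : {f : bhom (bshift k M \tens N) (bshift k (M \tens N)) |
    forall m n, f (pure fullA (M := bshift k M) m n) = pr_ (m : M) n}.
  apply: (@blift_sig A fullA (bshift k M) N (bshift k (M \tens N))
    (fun m n => pr_ (m : M) n)) => //; first exact: (pure_balanced fullA M N).
    by move=> a m n; exact/esym/scale_pure.
  by move=> a m n; exact/esym/ract_pure.
(* The inverse is lifted from the unshifted tensor product, with the compensating shift - k on the
   target, and only its degrees are reread afterwards. *)
have [h hp] : {h : bhom (M \tens N) (bshift (- k) (bshift k M \tens N)) |
    forall m n, h (pr_ m n) = pure fullA (M := bshift k M) m n}.
  apply: (@blift_sig A fullA M N (bshift (- k) (bshift k M \tens N))
    (fun m n => pure fullA (M := bshift k M) m n)).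
  - exact: (pure_balanced fullA (bshift k M) N).
  - by move=> a m n; exact/esym/(scale_pure fullA (M := bshift k M)).
  - by move=> a m n; exact/esym/(ract_pure fullA (M := bshift k M)).
  - move=> i j m n hm hn /=; rewrite opprK addrAC.
    by apply: (pure_deg fullA (M := bshift k M)) => //=; rewrite addrK.
have hd i t : @gdeg _ (bshift k (M \tens N)) i t -> @gdeg _ (bshift k M \tens N) i (h t).
  by move=> /(bhom_deg h) /=; rewrite opprK subrK.
pose g : bhom (bshift k (M \tens N)) (bshift k M \tens N) :=
  @mk_bhom _ (bshift k (M \tens N)) (bshift k M \tens N) h
    (fun a u v => linearP h a u v) (fun m a => bhomr h m a) hd.
have gf : forall t, bcomp g f t = bid _ t.
  by apply: bhom_tens_ext => m n; rewrite /= fp hp.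
exists f, g; split=> [t|t]; first exact: gf.
move: t; apply: (tens_ext (bhomB (bcomp f g)) (h := id)) => [t u //|m n].
by rewrite /= hp fp.
Qed.
End Shifts.
End Bimod.

(** * Finite biproducts *)

Section Biproducts.
Variable A : gradedRing.
Implicit Types M N K : gbimod A.

(** Inclusions and projections are preserved by any additive functor, such as tensoring or shifting;
    an isomorphism with [bdsum] is extracted only where one is required. *)
Definition biproduct (I : finType) (F : I -> gbimod A) M :=
  exists (inc : forall i, bhom (F i) M) (prj : forall i, bhom M (F i)),
    [/\ forall i x, prj i (inc i x) = x,
        forall i j x, i != j -> prj j (inc i x) = 0
      & forall x, x = \sum_i inc i (prj i x)].

Lemma biproduct_iso (I : finType) (F : I -> gbimod A) M N :
  biso M N -> biproduct F M -> biproduct F N.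
Proof.
move=> [f [g [fg gf]]] [inc [prj [h1 h2 h3]]].
exists (fun i => bcomp f (inc i)), (fun i => bcomp (prj i) g).
split=> [i x|i j x ij|x] /=; rewrite ?fg ?h1 ?h2 //.
by rewrite -{1}[x]gf {1}(h3 (g x)) (zm_sum (bhomB f)).
Qed.

Lemma biproduct_map (S : gradedSubring A) (I : finType) (F : I -> gbimod A) M N :
  biproduct F M -> biproduct (fun i => btens S N (F i)) (btens S N M).
Proof.
move=> [inc [prj [h1 h2 h3]]].
exists (fun i => btens_map S (bid N) (inc i)), (fun i => btens_map S (bid N) (prj i)).
split=> [i|i j t ij|].
- apply: (bhom_tens_ext (f := bcomp (btens_map S (bid N) (prj i)) (btens_map S (bid N) (inc i)))
    (g := bid _)) => n x.
  by rewrite /= !tmap_pure /= h1.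
- apply: (bhom_tens_ext (f := bcomp (btens_map S (bid N) (prj j)) (btens_map S (bid N) (inc i)))
    (g := bzero_hom _ _)) => n x.
  by rewrite /= !tmap_pure /= h2 // (zm0 (pureBr _ _)).
- apply: (tens_ext (f := id)) => [//|t u|n x].
    by rewrite -sumrB; apply: eq_bigr => i _; rewrite !linearB.
  rewrite {1}(h3 x) (zm_sum (pureBr _ _)); apply: eq_bigr => i _.
  by rewrite /= !tmap_pure.
Qed.

Lemma biproduct_comp (I : finType) (J : I -> finType) (F : I -> gbimod A)
    (G : forall i, J i -> gbimod A) M :
    biproduct F M -> (forall i, biproduct (G i) (F i)) ->
  biproduct (fun p : {i : I & J i} => G (tag p) (tagged p)) M.
Proof.
move=> [inc [prj [h1 h2 h3]]] hG.
have /all_sig [u hu] i := cid (hG i).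
have /all_sig [v hv] i := cid (hu i).
exists (fun p => bcomp (inc (tag p)) (u (tag p) (tagged p))),
  (fun p => bcomp (v (tag p) (tagged p)) (prj (tag p))).
split=> [[i j] x|[i j] [i' j'] x ij|x] /=.
- by rewrite h1; case: (hv i) => ->.
- have [e|ne] := eqVneq i i'; last by rewrite h2 ?bhom0.
  case: _ / e j' ij => j' ij; rewrite h1; case: (hv i) => _ -> //.
  by apply: contraNneq ij => ->.
- transitivity (\sum_i \sum_j inc i (u i j (v i j (prj i x)))); last first.
    exact: (sig_big_dep xpredT (fun _ _ => true)).
  rewrite {1}(h3 x); apply: eq_bigr => i _; case: (hv i) => _ _ e.
  by rewrite {1}(e (prj i x)) (zm_sum (bhomB (inc i))).
Qed.

Lemma biproduct_reindex (I J : finType) (h : J -> I) (F : I -> gbimod A) M :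
  bijective h -> biproduct F M -> biproduct (fun j => F (h j)) M.
Proof.
move=> bh [inc [prj [h1 h2 h3]]].
exists (fun j => inc (h j)), (fun j => prj (h j)); split=> [j x|i j x ij|x].
- exact: h1.
- by apply: h2; rewrite (bij_eq bh).
- by rewrite {1}(h3 x) (reindex h) //; exact: onW_bij.
Qed.

Lemma biproduct_bdsum (I : finType) (F : I -> gbimod A) M :
  biproduct F M -> biso M (bdsum F).
Proof.
move=> [inc [prj [h1 h2 h3]]].
have fin (G : forall i, F i) : exists s : seq I, forall i, i \notin s -> G i = 0.
  by exists (enum I) => i; rewrite mem_enum.
have [f fE] : {f : bhom M (bdsum F) | forall x i, f x i = prj i x}.
  unshelve eexists.
    apply: (@mk_bhom _ M (bdsum F) (fun x => Dsum (fin (fun i => prj i x)))).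
    - by move=> a u v; apply: dsum_ext => i /=; rewrite linearP.
    - by move=> u a; apply: dsum_ext => i /=; rewrite bhomr.
    - by move=> k u hu i; exact: bhom_deg.
  by [].
have gE x : bdlift inc x = \sum_i inc i (x i).
  have e := dliftE (fun i => bhomB (inc i)) (x := x) (enum_uniq I).
  rewrite -[LHS]/(dlift (fun i => inc i) x) e => [|i]; last by rewrite mem_enum.
  by rewrite big_enum.
exists f, (bdlift inc); split=> x.
  by rewrite gE {2}(h3 x); apply: eq_bigr => i _; rewrite fE.
apply: dsum_ext => j; rewrite fE gE (zm_sum (bhomB _)) (bigD1 j) //= h1.
by rewrite big1 ?addr0 // => i ij; rewrite h2.
Qed.

Lemma biproduct_unit M : biproduct (fun _ : unit => M) M.
Proof.
exists (fun=> bid M), (fun=> bid M); split=> [//|[] [] //|x].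
by rewrite (big_pred1 tt) // => -[].
Qed.

Lemma projective_biproduct (S : gradedSubring A) (I : finType) (F : I -> gbimod A) M :
  (forall i, projective S (F i)) -> biproduct F M -> projective S M.
Proof.
move=> hF /biproduct_bdsum[f [g [fg _]]].
exact: (projective_retract fg) (projective_bdsum hF).
Qed.

Definition bshift_map k M N (f : bhom M N) : bhom (bshift k M) (bshift k N).
Proof.
apply: (@mk_bhom _ (bshift k M) (bshift k N) f) => [a u v|u a|i u hu].
- exact: linearP.
- exact: (bhomr f u a).
- exact: (bhom_deg f).
Defined.

Lemma biproduct_shift k (I : finType) (F : I -> gbimod A) M :
  biproduct F M -> biproduct (fun i => bshift k (F i)) (bshift k M).
Proof.
move=> [inc [prj [h1 h2 h3]]].
by exists (fun i => bshift_map k (inc i)), (fun i => bshift_map k (prj i)); split.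
Qed.

Lemma biso_shiftD k l M : biso (bshift k (bshift l M)) (bshift (k + l) M).
Proof.
have fd i (u : M) : @gdeg _ (bshift k (bshift l M)) i u -> @gdeg _ (bshift (k + l) M) i u.
  by rewrite /= opprD addrA.
have gd i (u : M) : @gdeg _ (bshift (k + l) M) i u -> @gdeg _ (bshift k (bshift l M)) i u.
  by rewrite /= opprD addrA.
by exists (@mk_bhom _ (bshift k (bshift l M)) (bshift (k + l) M) id
    (fun a u v => erefl) (fun m a => erefl) fd),
  (@mk_bhom _ (bshift (k + l) M) (bshift k (bshift l M)) id
    (fun a u v => erefl) (fun m a => erefl) gd).
Qed.

Lemma biso_shift0 M : biso (bshift 0 M) M.
Proof.
have fd i (u : M) : @gdeg _ (bshift 0 M) i u -> gdeg i u by rewrite /= subr0.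
have gd i (u : M) : gdeg i u -> @gdeg _ (bshift 0 M) i u by rewrite /= subr0.
by exists (@mk_bhom _ (bshift 0 M) M id (fun a u v => erefl) (fun m a => erefl) fd),
  (@mk_bhom _ M (bshift 0 M) id (fun a u v => erefl) (fun m a => erefl) gd).
Qed.

Lemma biso_zero M N : is_zero M -> is_zero N -> biso M N.
Proof.
by move=> M0 N0; exists (bzero_hom M N), (bzero_hom N M); split=> x; rewrite ?[x]M0 ?[x]N0 bhom0.
Qed.

Lemma is_zero_bzero : is_zero (bzero A).
Proof. by move=> x; exact: (thinmx0 x). Qed.

Lemma is_zero_tensl (S : gradedSubring A) M N : is_zero M -> is_zero (btens S M N).
Proof.
move=> M0; apply: (tens_ext (f := id) (h := fun=> 0)) => [//|t u|m n]; first by rewrite subrr.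
by rewrite (M0 m) (zm0 (pureBl _ _)).
Qed.

Lemma is_zero_tensr (S : gradedSubring A) M N : is_zero N -> is_zero (btens S M N).
Proof.
move=> N0; apply: (tens_ext (f := id) (h := fun=> 0)) => [//|t u|m n]; first by rewrite subrr.
by rewrite (N0 n) (zm0 (pureBr _ _)).
Qed.

Variable S : gradedSubring A.

Lemma scentral_tens (S' : gradedSubring A) M N : (forall a, smem S a -> smem S' a) ->
  scentral S M -> scentral S N -> scentral S (btens S' M N).
Proof.
move=> SS' hM hN a sa; apply: tens_ext => [t u|t u|m n].
- by rewrite scalerBr.
- exact: (ractl_additive (M := btens S' M N)).
by rewrite -pureZl hM // pureM ?hN ?ract_pure //; exact: SS'.
Qed.

Lemma scentral_breg : scentral S (breg A).
Proof. by move=> a _ m; rewrite /= mulrC. Qed.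

Lemma scentral_bzero : scentral S (bzero A).
Proof. by move=> a _ m; rewrite /= [m]is_zero_bzero scaler0. Qed.

Lemma scentral_bshift k M : scentral S M -> scentral S (bshift k M).
Proof. by move=> h a sa m; exact: h. Qed.

Lemma scentral_bdsum (I : choiceType) (F : I -> gbimod A) :
  (forall i, scentral S (F i)) -> scentral S (bdsum F).
Proof. by move=> h a sa x; apply: dsum_ext => i /=; exact: h. Qed.

Lemma scentral_inj M N (f : bhom M N) : injective f -> scentral S N -> scentral S M.
Proof. by move=> inj h a sa m; apply: inj; rewrite linearZ bhomr /= h. Qed.
End Biproducts.

(** * The bimodule induced by a Frobenius extension *)

Record frobenius (A : gradedRing) (S : gradedSubring A) := Frobenius {
  ftr : A -> A;
  ftop : int;
  fidx : finType;
  fbasis : fidx -> A;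
  fdual : fidx -> A;
  fdeg : fidx -> int;
  ftrB : zmod_morphism ftr;
  ftr_mem : forall f, smem S (ftr f);
  ftr_linear : forall c f, smem S c -> ftr (c * f) = c * ftr f;
  ftr_deg : forall i f, rdeg i f -> rdeg (i - ftop) (ftr f);
  fbasis_deg : forall i, rdeg (fdeg i) (fbasis i);
  fdual_deg : forall i, rdeg (ftop - fdeg i) (fdual i);
  fbasis_expand : forall f, f = \sum_i ftr (f * fdual i) * fbasis i;
  fdual_expand : forall f, f = \sum_i ftr (f * fbasis i) * fdual i;
  fdualE : forall i j, ftr (fbasis i * fdual j) = (i == j)%:R }.

Section Induced.
Variables (A : gradedRing) (S : gradedSubring A).
Hypothesis SF : frobenius S.
Local Notation tr := (ftr SF).
Local Notation I := (fidx SF).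
Local Notation a_ := (@fbasis _ _ SF).
Local Notation b_ := (@fdual _ _ SF).
Local Notation d_ := (@fdeg _ _ SF).
Local Notation pr_ := (pure (full_subring A)).
Local Notation fullA := (full_subring A).
Implicit Types M N K : gbimod A.

Local Notation ibalanced := (@balanced A S (breg A) (breg A) _).
Local Notation ilift := (@tlift A S (breg A) (breg A) _).

Definition ind : gbimod A := btens S (breg A) (breg A).

Definition ipure (x y : A) : ind := pure S (x : breg A) (y : breg A).

Lemma ind_ext (Z : zmodType) (f h : ind -> Z) : zmod_morphism f -> zmod_morphism h ->
  (forall x y, f (ipure x y) = h (ipure x y)) -> f =1 h.
Proof. exact: tens_ext. Qed.

Lemma ipureZ c x y : c *: ipure x y = ipure (c * x) y.
Proof. by rewrite /ipure scale_pure. Qed.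

Lemma ipure_ract x y c : ract (ipure x y) c = ipure x (y * c).
Proof. by rewrite /ipure ract_pure. Qed.

Lemma ipureM x c y : smem S c -> ipure (x * c) y = ipure x (c * y).
Proof. by move=> sc; rewrite /ipure -[x * c]/(ract (x : breg A) c) pureM. Qed.

Lemma ipureDl y : zmod_morphism (ipure^~ y).
Proof. exact: (@pureBl A S (breg A) (breg A)). Qed.

Lemma ipureDr x : zmod_morphism (ipure x).
Proof. exact: (@pureBr A S (breg A) (breg A)). Qed.

Lemma ipure_deg i j x y : rdeg i x -> rdeg j y -> gdeg (i + j) (ipure x y).
Proof. by move=> hx hy; apply: pure_deg. Qed.

Lemma scentral_ind : scentral S ind.
Proof. by apply: scentral_tens => //; exact: scentral_breg. Qed.

Lemma scentral_full M N : scentral S M -> scentral S N -> scentral S (M \tens N).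
Proof. exact: scentral_tens. Qed.

Lemma ind_lift_bal M (e : M) : (forall s, smem S s -> s *: e = ract e s) ->
  ibalanced (fun x y : A => ract (x *: e) y).
Proof.
move=> he; split=> [y x x'|x y y'|x c y sc].
- by rewrite scalerBl (ractl_additive (M := M)).
- exact: (ractr_additive (M := M)).
by rewrite -[ract x c]/(x * c) -[c *: y]/(c * y) -scalerA he // ractZ -ractA.
Qed.

Definition ind_lift_sig M k (e : M) : gdeg k e ->
    (forall s, smem S s -> s *: e = ract e s) ->
  {f : bhom (bshift k ind) M | forall x y, f (ipure x y) = ract (x *: e) y}.
Proof.
move=> de he.
have [f hf] : {f : bhom ind (bshift (- k) M) | forall x y, f (ipure x y) = ract (x *: e) y}.
  apply: (@blift_sig A S (breg A) (breg A) (bshift (- k) M) (fun x y => ract (x *: e) y)).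
  - exact: (ind_lift_bal he).
  - by move=> a m n; rewrite ractZ scalerA.
  - by move=> a m n; rewrite -ractA.
  - move=> i j m n hm hn /=; rewrite opprK addrAC.
    by apply: gdegr => //; apply: gdegl.
have fd i (u : ind) : @gdeg _ (bshift k ind) i u -> @gdeg _ M i (f u).
  by move=> h; have := @bhom_deg _ _ _ f (i - k) u h; rewrite /= opprK subrK.
by exists (@mk_bhom _ (bshift k ind) M f (fun a u v => linearP f a u v)
  (fun m a => bhomr f m a) fd).
Qed.

Lemma bhom_ind_ext k M (f g : bhom (bshift k ind) M) :
  (forall x y, f (ipure x y) = g (ipure x y)) -> forall t, f t = g t.
Proof. exact: (ind_ext (bhomB f) (bhomB g)). Qed.

Lemma projective_ind k : projective S (bshift k ind).
Proof.
move=> M N K p q cM ex f qf; pose y := f (ipure 1 1).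
have [x px] := ex y (qf _).
have hM := gdeg_grading M; have hN := gdeg_grading N.
have dy : gdeg k y.
  apply: bhom_deg => /=; rewrite subrr -[0]addr0.
  by apply: ipure_deg; exact: rdeg1.
(* A preimage x of y need not be homogeneous, but p preserves degrees, so the degree k component of
   x already maps to y. *)
have pk : p (pr hM k x) = y.
  have e : pr hN k y = y by rewrite (pr_id hN k dy) eqxx.
  rewrite -[RHS]e -px; move: x {px}; apply: (eq_homog hM) => [u v|u v|j u du].
  - by rewrite prB linearB.
  - by rewrite linearB prB.
  rewrite (pr_id hM k du) (pr_id hN k (bhom_deg p du)).
  by case: ifP => // _; rewrite bhom0.
have [g gE] := ind_lift_sig (pr_gr hM k x) (fun s ss => cM s ss _).
exists g; apply: (bhom_ind_ext (f := bcomp p g)) => u v.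
rewrite /= gE bhomr linearZ /= pk /y -linearZ /= -(bhomr f); congr (f _).
by rewrite [u *: _](ipureZ u 1 1) [LHS](ipure_ract (u * 1) 1 v) mulr1 mul1r.
Qed.

Definition ifree M := exists (J : finType) (k : J -> int), biproduct (fun j => bshift (k j) ind) M.

Lemma ifree_iso M N : biso M N -> ifree M -> ifree N.
Proof. by move=> h [J [k hM]]; exists J, k; exact: biproduct_iso hM. Qed.

Lemma ifree_ind k : ifree (bshift k ind).
Proof. by exists unit, (fun=> k); exact: biproduct_unit. Qed.

Lemma ifree_projective M : ifree M -> projective S M.
Proof.
by move=> [J [k hM]]; apply: projective_biproduct hM => j; exact: projective_ind.
Qed.

Lemma biproduct_isos (J : finType) (F G : J -> gbimod A) M :
  (forall j, biso (F j) (G j)) -> biproduct F M -> biproduct G M.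
Proof.
move=> h [inc [prj [h1 h2 h3]]].
have /all_sig [f hf] j := cid (h j).
have /all_sig [g hg] j := cid (hf j).
exists (fun j => bcomp (inc j) (g j)), (fun j => bcomp (f j) (prj j)).
split=> [i x|i j x ij|x] /=.
- by rewrite h1; case: (hg i) => _ ->.
- by rewrite h2 // bhom0.
- by rewrite {1}(h3 x); apply: eq_bigr => i _; case: (hg i) => ->.
Qed.

Lemma ifree_shift k M : ifree M -> ifree (bshift k M).
Proof.
move=> [J [l hM]]; exists J, (fun j => k + l j).
by apply: biproduct_isos (biproduct_shift k hM) => j; exact: biso_shiftD.
Qed.

Lemma tau_bal j : ibalanced (fun x y : A => x * tr (y * b_ j)).
Proof.
split=> [y x x'|x y y'|x c y sc] /=; first by rewrite mulrBl.
  by rewrite mulrBl ftrB mulrBr.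
by rewrite /GRing.scale /= -!mulrA (ftr_linear SF _ sc).
Qed.

(** C is free as a left module on the elements 1 (x) a_j, and [tau j] is the j-th coordinate. Its
    mirror image [tau'] is the coordinate along a_j (x) 1 for the right action. *)
Definition tau j : ind -> A := ilift (fun x y : A => x * tr (y * b_ j)).

Lemma tauE j x y : tau j (ipure x y) = x * tr (y * b_ j).
Proof. exact: (tlift_pure (tau_bal j)). Qed.

Lemma tauB j : zmod_morphism (tau j).
Proof. exact: tlift_additive (tau_bal j). Qed.

Lemma tauZ j c t : tau j (c *: t) = c * tau j t.
Proof.
move: t; apply: ind_ext => [t u|t u|x y]; rewrite ?scalerBr ?tauB ?mulrBr //.
by rewrite ipureZ !tauE mulrA.
Qed.

Lemma tau_central j t c : smem S c -> tau j (ract t c) = c * tau j t.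
Proof. by move=> sc; rewrite -scentral_ind // tauZ. Qed.

Lemma tau_deg j i t : gdeg i t -> rdeg (i - d_ j) (tau j t).
Proof.
elim=> {t} [_ [i' [j' [x [y [hx hy <- ->]]]]]||u v _ du _ dv].
- rewrite (tauE j x y) -addrA; apply: rdegM => //.
  have -> : j' - d_ j = j' + (ftop SF - d_ j) - ftop SF by lia.
  by apply/ftr_deg/rdegM => //; exact: fdual_deg.
- by rewrite (zm0 (tauB j)); exact: gr0 (rdeg_grading A) _.
- by rewrite tauB; exact: grB (rdeg_grading A) _ _ _ du dv.
Qed.

Lemma ind_expand t : t = \sum_j ipure (tau j t) (a_ j).
Proof.
move: t; apply: (ind_ext (f := id)) => [//|t u|x y].
  by rewrite -sumrB; apply: eq_bigr => j _; rewrite tauB ipureDl.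
rewrite {1}(fbasis_expand SF y) (zm_sum (ipureDr x)); apply: eq_bigr => j _.
by rewrite tauE ipureM //; exact: ftr_mem.
Qed.

Lemma tau'_bal j : ibalanced (fun x y : A => tr (x * b_ j) * y).
Proof.
split=> [y x x'|x y y'|x c y sc] /=; first by rewrite mulrBl ftrB mulrBl.
  by rewrite mulrBr.
by rewrite /GRing.scale /= [x * c]mulrC -mulrA (ftr_linear SF _ sc) [RHS]mulrCA mulrA.
Qed.

Definition tau' j : ind -> A := ilift (fun x y : A => tr (x * b_ j) * y).

Lemma tau'E j x y : tau' j (ipure x y) = tr (x * b_ j) * y.
Proof. exact: (tlift_pure (tau'_bal j)). Qed.

Lemma tau'B j : zmod_morphism (tau' j).
Proof. exact: tlift_additive (tau'_bal j). Qed.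

Lemma tau'_ract j c t : tau' j (ract t c) = tau' j t * c.
Proof.
move: t; apply: ind_ext => [t u|t u|x y]; rewrite ?tau'B ?mulrBl //.
  by rewrite (ractl_additive (M := ind)) tau'B.
by rewrite ipure_ract !tau'E mulrA.
Qed.

Lemma ind_expand' t : t = \sum_j ipure (a_ j) (tau' j t).
Proof.
move: t; apply: (ind_ext (f := id)) => [//|t u|x y].
  by rewrite -sumrB; apply: eq_bigr => j _; rewrite tau'B ipureDr.
rewrite {1}(fbasis_expand SF x) (zm_sum (ipureDl y)); apply: eq_bigr => j _.
by rewrite tau'E -ipureM ?[a_ j * _]mulrC //; exact: ftr_mem.
Qed.

(** C (x) C is R (x) R (x) R over R^W, and expanding the middle factor in the basis a_j splits it
    into copies of C, shifted by the degrees of the a_j. *)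
Lemma ind_tens_ind k : ifree (ind \tens bshift k ind).
Proof.
pose C := bshift k ind.
exists I, (fun j => k + d_ j).
have inc_sig j : {f : bhom (bshift (k + d_ j) ind) (ind \tens C) | forall x y,
    f (ipure x y) = pr_ (ipure x (a_ j)) (ipure 1 y : C)}.
  have de : @gdeg _ (ind \tens C) (k + d_ j) (pr_ (ipure 1 (a_ j)) (ipure 1 1 : C)).
    rewrite addrC; apply: pure_deg.
      by rewrite -[d_ j]add0r; apply: ipure_deg; [exact: rdeg1 | exact: fbasis_deg].
    by rewrite /= subrr -[0]addr0; apply: ipure_deg; exact: rdeg1.
  have cE : scentral S (ind \tens C).
    by apply: scentral_full; [exact: scentral_ind|apply: scentral_bshift; exact: scentral_ind].
  have [f hf] := ind_lift_sig de (fun s ss => cE s ss _).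
  by exists f => x y; rewrite hf -pureZl ract_pure ipureZ [ract _ y](ipure_ract 1 1 y) mulr1 mul1r.
(* The left factor of u is moved across the tensor sign before the coordinate is read: (x (x) z) (x)
   (c (x) e) goes to x tr(z c b_j) (x) e. *)
pose F j (t : ind) (u : C) : bshift (k + d_ j) ind :=
  ilift (fun c e : A => ipure (tau j (ract t c)) e) u.
have Fbal j t : ibalanced (fun c e : A => ipure (tau j (ract t c)) e).
  split=> [y x x'|x y y'|x c y sc].
  - rewrite -ipureDl; congr (ipure _ _); rewrite -tauB; congr (tau j _).
    exact: (ractr_additive (M := ind)).
  - exact: ipureDr.
  - by rewrite -[ract x c]/(x * c : A) ractA tau_central // [c * _]mulrC ipureM.
have FE j t x y : F j t (ipure x y : C) = ipure (tau j (ract t x)) y.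
  exact: (tlift_pure (Fbal j t)).
have FB j t : zmod_morphism (F j t) := tlift_additive (Fbal j t).
have FBl j u : zmod_morphism (F j ^~ u).
  move=> t t'; move: u; apply: ind_ext => [|u v|x y]; first exact: FB.
    by rewrite !FB opprD addrACA -opprD.
  by rewrite !FE (ractl_additive (M := ind)) tauB ipureDl.
have prj_sig j : {f : bhom (ind \tens C) (bshift (k + d_ j) ind) | forall t x y,
    f (pr_ t (ipure x y : C)) = ipure (tau j (ract t x)) y}.
  have [f hf] : {f : bhom (ind \tens C) (bshift (k + d_ j) ind) |
      forall t u, f (pr_ t u) = F j t u}.
    apply: (@blift_sig A fullA ind C (bshift (k + d_ j) ind) (F j)).
    - split=> // t c u _; move: u; apply: ind_ext => [||x y]; first exact: FB.
        by move=> u v; rewrite scalerBr FB.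
      by rewrite [c *: _](ipureZ c x y) !FE -ractA.
    - move=> c t; apply: ind_ext => [||x y]; first exact: FB.
        by move=> u v; rewrite FB scalerBr.
      by rewrite !FE -ractZ tauZ -ipureZ.
    - move=> c t; apply: ind_ext => [u v|u v|x y].
      + by rewrite (ractl_additive (M := C)) FB.
      + by rewrite FB (ractl_additive (M := ind)).
      + by rewrite [ract _ c](ipure_ract x y c) !FE [RHS]ipure_ract.
    - move=> i l t u dt; rewrite /= -[l](subrK k) addrK; move: (l - k) => {}l.
      elim=> {u} [_ [i' [j' [x [y [hx hy <- ->]]]]]||u v _ du _ dv].
      + rewrite (FE j t x y) (_ : _ - _ = i + i' - d_ j + j'); last by lia.
        by apply: ipure_deg => //; apply: tau_deg; exact: gdegr.
      + by rewrite (zm0 (FB j t)); exact: gr0 (gdeg_grading ind) _.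
      + by rewrite FB; exact: grB (gdeg_grading ind) _ _ _ du dv.
  by exists f => t x y; rewrite hf FE.
exists (fun j => sval (inc_sig j)), (fun j => sval (prj_sig j)).
have pi i j x y : sval (prj_sig j) (sval (inc_sig i) (ipure x y)) = (i == j)%:R *: ipure x y.
  rewrite (svalP (inc_sig i)) (svalP (prj_sig j)) ract1 tauE fdualE.
  by rewrite ipureZ mulrC.
split=> [i|i j x ij|].
- apply: (bhom_ind_ext (f := bcomp (sval (prj_sig i)) (sval (inc_sig i)))
    (g := bid _)) => x y.
  by rewrite [LHS]pi eqxx scale1r.
- move: x; apply: (bhom_ind_ext (f := bcomp (sval (prj_sig j)) (sval (inc_sig i)))
    (g := bzero_hom _ _)) => x y.
  by rewrite [LHS]pi (negPf ij) scale0r.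
apply: (tens_ext (f := id)) => [//|u v|t u].
  by rewrite -sumrB; apply: eq_bigr => i _; rewrite !linearB.
move: u; apply: ind_ext => [u v|u v|x y].
- exact: pureBr.
- by rewrite -sumrB; apply: eq_bigr => i _; rewrite pureBr !linearB.
transitivity (\sum_j pr_ (ipure (tau j (ract t x)) (a_ j)) (ipure 1 y : C)); last first.
  by apply: eq_bigr => j _; rewrite (svalP (prj_sig j)) (svalP (inc_sig j)).
rewrite -(zm_sum (pureBl fullA (ipure 1 y : C))) -ind_expand -pureZ.
by rewrite [x *: _](ipureZ x 1 y) mulr1.
Qed.
End Induced.

(** * The bar construction *)

Section Bar.
Variables (A : gradedRing) (S : gradedSubring A).
Hypothesis SF : frobenius S.
Local Notation I := (fidx SF).
Local Notation a_ := (@fbasis _ _ SF).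
Local Notation pr_ := (pure (full_subring A)).
Local Notation fullA := (full_subring A).
Local Notation C := (ind S).
Implicit Types M N K : gbimod A.
Implicit Types E : cpx A.

Lemma ifree_tens M : ifree S M -> ifree S (C \tens M).
Proof.
move=> [J [k hM]].
have h j : ifree S (C \tens bshift (k j) C) by exact: (ind_tens_ind SF).
have /all_sig [L hL] j := cid (h j).
have /all_sig [l hl] j := cid (hL j).
exists {j : J & L j}, (fun p => l (tag p) (tagged p)).
exact: (biproduct_comp (biproduct_map fullA C hM) hl).
Qed.

Lemma ifree_tens_shift k M : ifree S M -> ifree S (bshift k C \tens M).
Proof.
move=> hM; apply: ifree_iso (biso_sym (biso_shiftl C M k)) _.
by apply: ifree_shift; exact: ifree_tens.
Qed.

Section RightCoordinates.
Variables (k : int) (j : I).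
Local Notation N := (bshift k C).

Lemma rcoord_bal M : balanced fullA (fun (m : M) (t : N) => ract m (tau j t)).
Proof.
split=> [t|m t u|m a t _].
- exact: ractl_additive.
- by rewrite -(ractr_additive m); congr (ract m _); exact: tauB.
- by rewrite -ractA; congr (ract m _); rewrite -tauZ.
Qed.

(** As an abelian group M (x) C is a finite sum of copies of M, with these coordinates. They are not
    bimodule maps, but they are natural in M, which suffices to transfer exactness. *)
Definition rcoord M (z : M \tens N) : M := tlift (fun (m : M) (t : N) => ract m (tau j t)) z.

Lemma rcoordB M : zmod_morphism (@rcoord M).
Proof. exact: tlift_additive (rcoord_bal M). Qed.

Lemma rcoordE M (m : M) (t : N) : rcoord (pr_ m t) = ract m (tau j t).
Proof. exact: (tlift_pure (rcoord_bal M)). Qed.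

Lemma rcoord_nat M M' (f : bhom M M') z :
  rcoord (btens_map fullA f (bid N) z) = f (rcoord z).
Proof.
move: z; apply: tens_ext => [t u|t u|m t]; rewrite ?linearB ?rcoordB ?linearB //.
by rewrite btens_map_pure !rcoordE bhomr.
Qed.
End RightCoordinates.

Lemma rcoord_expand k M (z : M \tens bshift k C) :
  z = \sum_j pr_ (rcoord j z) (ipure S 1 (a_ j) : bshift k C).
Proof.
move: z; apply: (tens_ext (f := id)) => [//|t u|m t].
  by rewrite -sumrB; apply: eq_bigr => j _; rewrite rcoordB pureBl.
rewrite {1}(ind_expand SF t) (zm_sum (pureBr _ m)); apply: eq_bigr => j _.
rewrite rcoordE -pureZ; congr (pr_ m _).
by rewrite -[RHS]/(tau j t *: ipure S 1 (a_ j)) ipureZ mulr1.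
Qed.

Lemma rcoord_basis k M i j (m : M) :
  rcoord j (pr_ m (ipure S 1 (a_ i) : bshift k C)) = if i == j then m else 0.
Proof.
rewrite rcoordE tauE mul1r fdualE; case: eqP => _; first exact: ract1.
exact: zm0 (ractr_additive m).
Qed.

Lemma exact_ctensr k E : exact_cpx E -> exact_cpx (ctensr E (bshift k C)).
Proof.
move=> exE i z dz.
have dzj j : cdiff E (i + 1) (rcoord j z) = 0.
  by rewrite -rcoord_nat [X in rcoord j X]dz (zm0 (@rcoordB _ _ _)).
have /all_sig [w hw] j := cid (exE i _ (dzj j)).
exists (\sum_j pr_ (w j) (ipure S 1 (a_ j) : bshift k C)).
rewrite (zm_sum (bhomB _)) [RHS]rcoord_expand; apply: eq_bigr => j _.
by rewrite [LHS]btens_map_pure hw.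
Qed.

(** A cycle y is placed on one basis element, and the corresponding coordinate of a preimage of y
    (x) (1 (x) a_i) is a preimage of y. The index witnesses that the basis is nonempty, without
    which C would vanish. *)
Lemma exact_of_ctensr k E : I -> exact_cpx (ctensr E (bshift k C)) -> exact_cpx E.
Proof.
move=> i0 exT i y dy; pose u : bshift k C := ipure S 1 (a_ i0).
have [|z dz] := exT i (pr_ y u).
  by rewrite [LHS]btens_map_pure dy (zm0 (pureBl _ _)).
exists (rcoord i0 z); rewrite -rcoord_nat.
have -> : btens_map fullA (cdiff E i) (bid _) z = pr_ y u by exact: dz.
by rewrite rcoord_basis eqxx.
Qed.

Section LeftCoordinates.
Variables (k : int) (j : I).
Local Notation N := (bshift k C).

Lemma lcoord_bal M : balanced fullA (fun (t : N) (m : M) => tau' j t *: m).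
Proof.
split=> [m t u|t|t a m _].
- by rewrite -scalerBl; congr (_ *: m); exact: tau'B.
- exact: scalel_additive.
- by rewrite scalerA; congr (_ *: m); rewrite -tau'_ract.
Qed.

Definition lcoord M (z : N \tens M) : M := tlift (fun (t : N) (m : M) => tau' j t *: m) z.

Lemma lcoordB M : zmod_morphism (@lcoord M).
Proof. exact: tlift_additive (lcoord_bal M). Qed.

Lemma lcoordE M (t : N) (m : M) : lcoord (pr_ t m) = tau' j t *: m.
Proof. exact: (tlift_pure (lcoord_bal M)). Qed.

Lemma lcoord_nat M M' (f : bhom M M') z :
  lcoord (btens_map fullA (bid N) f z) = f (lcoord z).
Proof.
move: z; apply: tens_ext => [t u|t u|t m]; rewrite ?linearB ?lcoordB ?linearB //.
by rewrite btens_map_pure !lcoordE linearZ.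
Qed.
End LeftCoordinates.

Lemma lcoord_expand k M (z : bshift k C \tens M) :
  z = \sum_j pr_ (ipure S (a_ j) 1 : bshift k C) (lcoord j z).
Proof.
move: z; apply: (tens_ext (f := id)) => [//|t u|t m].
  by rewrite -sumrB; apply: eq_bigr => j _; rewrite lcoordB pureBr.
rewrite {1}(ind_expand' SF t) (zm_sum (pureBl _ m)); apply: eq_bigr => j _.
rewrite lcoordE pureZ; congr (pr_ _ m).
by rewrite -[RHS]/(ract (ipure S (a_ j) 1) (tau' j t)) ipure_ract mul1r.
Qed.

Lemma exact_ctensl k E : exact_cpx E -> exact_cpx (ctensl (bshift k C) E).
Proof.
move=> exE i z dz.
have dzj j : cdiff E (i + 1) (lcoord j z) = 0.
  by rewrite -lcoord_nat [X in lcoord j X]dz (zm0 (@lcoordB _ _ _)).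
have /all_sig [w hw] j := cid (exE i _ (dzj j)).
exists (\sum_j pr_ (ipure S (a_ j) 1 : bshift k C) (w j)).
rewrite (zm_sum (bhomB _)) [RHS]lcoord_expand; apply: eq_bigr => j _.
by rewrite [LHS]btens_map_pure hw.
Qed.

Definition counit_sig M : {f : bhom (C \tens M) M |
  forall x y m, f (pr_ (ipure S x y) m) = (x * y) *: m}.
Proof.
have [mu muE] : {f : bhom C (breg A) | forall x y, f (ipure S x y) = x * y}.
  apply: (@blift_sig A S (breg A) (breg A) (breg A) (fun x y => (x : A) * (y : A))).
  - split=> [y x x'|x y y'|x c y _]; [exact: mulrBl|exact: mulrBr|exact/esym/mulrA].
  - by move=> a x y; exact/esym/mulrA.
  - by move=> a x y; exact: mulrA.
  - by move=> i j x y; exact: rdegM.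
exists (bcomp (lunit M) (btens_map fullA mu (bid M))) => x y m.
by rewrite /= tmap_pure muE lunitE.
Qed.

Definition counit M := sval (counit_sig M).

Lemma counitE M x y (m : M) : counit M (pr_ (ipure S x y) m) = (x * y) *: m.
Proof. exact: (svalP (counit_sig M)). Qed.

Lemma ind_tens_ext M (Z : zmodType) (f h : C \tens M -> Z) :
    zmod_morphism f -> zmod_morphism h ->
  (forall x y m, f (pr_ (ipure S x y) m) = h (pr_ (ipure S x y) m)) -> f =1 h.
Proof.
move=> hf hh e; apply: tens_ext => // t m; move: t.
by apply: ind_ext => [t u|t u|x y]; rewrite ?pureBl.
Qed.

Definition tensC M N (f : bhom M N) : bhom (C \tens M) (C \tens N) :=
  btens_map fullA (bid C) f.

Lemma counit_nat M N (f : bhom M N) t : counit N (tensC f t) = f (counit M t).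
Proof.
move: t; apply: ind_tens_ext => [t u|t u|x y m]; rewrite ?linearB //.
by rewrite btens_map_pure !counitE linearZ.
Qed.

(** The contracting map of the bar resolution. It commutes with the right action but not with the
    left one, so it is a plain function and not a [bhom]. *)
Definition unitC M (m : M) : C \tens M := pr_ (ipure S 1 1) m.

Lemma unitCB M : zmod_morphism (@unitC M).
Proof. exact: pureBr. Qed.

Lemma unitC_ract M (m : M) a : unitC (ract m a) = ract (unitC m) a.
Proof. by rewrite /unitC ract_pure. Qed.

Lemma counitK M (m : M) : counit M (unitC m) = m.
Proof. by rewrite counitE mulr1 scale1r. Qed.

Lemma tensC_unit M N (f : bhom M N) m : tensC f (unitC m) = unitC (f m).
Proof. exact: btens_map_pure. Qed.

Fixpoint bar (k : nat) : gbimod A := if k is k'.+1 then C \tens bar k' else breg A.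

(** Unrolling d_(k+1) = counit - C (x) d_k gives the alternating sum of the bar differential. In
    this form d d = 0 follows by induction: naturality of the counit cancels the mixed terms and
    leaves C (x) (d d). *)
Fixpoint dbar (k : nat) : bhom (bar k.+1) (bar k) :=
  if k is k'.+1 return bhom (bar k.+1) (bar k) then
    bisub (counit (bar k'.+1)) (tensC (dbar k'))
  else counit (breg A).

Lemma dbarS k t : dbar k.+1 t = counit (bar k.+1) t - tensC (dbar k) t.
Proof. exact: bisubE. Qed.

Lemma tensC_comp M N K (f : bhom M N) (g : bhom N K) t :
  tensC g (tensC f t) = tensC (bcomp g f) t.
Proof.
move: t; apply: ind_tens_ext => [t u|t u|x y m]; rewrite ?linearB //.
by rewrite !btens_map_pure.
Qed.

Lemma tensC0 M N (f : bhom M N) t : (forall m, f m = 0) -> tensC f t = 0.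
Proof.
move=> h; move: t; apply: (ind_tens_ext (h := fun=> 0)) => [t u|t u|x y m].
- by rewrite linearB.
- by rewrite subrr.
by rewrite btens_map_pure h (zm0 (pureBr _ _)).
Qed.

Lemma dbarK k t : dbar k (dbar k.+1 t) = 0.
Proof.
elim: k t => [|k IH] t.
  by rewrite dbarS linearB /= counit_nat subrr.
rewrite [dbar k.+2 t]dbarS linearB [dbar k.+1 (tensC _ _)]dbarS counit_nat tensC_comp.
rewrite [tensC _ t](@tensC0 _ _ (bcomp (dbar k) (dbar k.+1))); last exact: IH.
by rewrite subr0 subrr.
Qed.

Lemma dbar_unit k (t : bar k.+1) : dbar k.+1 (unitC t) = t - unitC (dbar k t).
Proof. by rewrite dbarS counitK tensC_unit. Qed.

Lemma dbar0_unit (t : bar 0) : dbar 0 (unitC t) = t.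
Proof. exact: counitK. Qed.

(** Reassociation moves the leading factor C outside, where [ifree_tens] applies to it. *)
Lemma ifree_bar_tens k M : ifree S M -> ifree S (bar k \tens M).
Proof.
move=> hM; elim: k => [|k IH]; first exact: ifree_iso (biso_sym (biso_lunit M)) hM.
exact: ifree_iso (biso_sym (biso_assoc C (bar k) M)) (ifree_tens IH).
Qed.

Lemma ifree_barS k : ifree S (bar k.+1).
Proof.
elim: k => [|k IH]; last exact: ifree_tens.
apply: ifree_iso (biso_sym (biso_runit C)) _.
exact: ifree_iso (biso_shift0 C) (ifree_ind S 0).
Qed.

Lemma scentral_bar k : scentral S (bar k).
Proof.
elim: k => [|k IH]; first exact: scentral_breg.
by apply: scentral_full => //; exact: scentral_ind.
Qed.
End Bar.

(** * The bar complex and its augmentation *)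

(* The bar complex places bar k.+1 in degree - k; degrees are translated into
   option nat, None standing for the zero object, so that the generic maps below
   can be typed between arbitrary degrees. *)
Definition lev (i : int) : option nat :=
  match i with Posz 0 => Some 1%N | Posz _ => None | Negz k => Some k.+2 end.

(** Level 0 would be R itself, which is not a term of the complex: level 1, sitting in degree 0, is
    followed by the zero object. *)
Definition nxt (u : option nat) : option nat :=
  if u is Some k.+2 then Some k.+1 else None.

Lemma lev_succ i : lev (i + 1) = nxt (lev i).
Proof.
have [j e] : {j | j = i + 1} by exists (i + 1).
rewrite -e; case: i e => [[|k]|[|k]] e.
- by have -> : j = 1 by lia.
- by have -> : j = Posz k.+2 by lia.
- by have -> : j = 0 by lia.
- by have -> : j = Negz k by lia.
Qed.

Lemma lev1 i : lev i = Some 1%N -> i = 0.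
Proof. by case: i => [[|k]|k]. Qed.

Lemma lev_neq0 i : lev i != Some 0%N.
Proof. by case: i => [[|k]|k]. Qed.

Lemma lev_eq0 i : (i == 0) = (lev i == Some 1%N).
Proof. by case: i => [[|k]|k]. Qed.

Arguments bar : simpl never.
Arguments dbar : simpl never.

Section BarComplex.
Variables (A : gradedRing) (S : gradedSubring A).
Hypothesis SF : frobenius S.
Local Notation pr_ := (pure (full_subring A)).
Local Notation fullA := (full_subring A).
Local Notation C := (ind S).
Local Notation bar := (bar S).
Local Notation dbar := (dbar S).

Definition obar (u : option nat) : gbimod A := if u is Some k then bar k else bzero A.

Definition dnat (k l : nat) : bhom (bar k) (bar l) :=
  match k =P l.+1 with
  | ReflectT e => ecast i (bhom (bar i) (bar l)) (esym e) (dbar l)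
  | ReflectF _ => bzero_hom _ _
  end.

Lemma dnatS l : dnat l.+1 l = dbar l.
Proof. by rewrite /dnat; case: eqP => // e; rewrite eq_axiomK. Qed.

Definition dobar (u v : option nat) : bhom (obar u) (obar v) :=
  match u, v return bhom (obar u) (obar v) with
  | Some k, Some l => dnat k l
  | _, _ => bzero_hom _ _
  end.

Lemma dobarK u v w x : v = nxt u -> w = nxt v -> dobar v w (dobar u v x) = 0.
Proof.
move=> -> ->; case: u x => [[|[|[|k]]]|] x //.
by rewrite -[LHS]/(dnat k.+2 k.+1 (dnat k.+3 k.+2 x)) !dnatS dbarK.
Qed.

Definition barc : cpx A.
Proof.
exists (fun i => obar (lev i)) (fun i => dobar (lev i) (lev (i + 1))).
by move=> i x; apply: dobarK; exact: lev_succ.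
Defined.

(** The boolean abstracts the test i == 0 in [conc], so that case analysis on it makes the target
    type concrete. *)
Definition epsb (u : option nat) (b : bool) : bhom (obar u) (if b then breg A else bzero A) :=
  match u, b return bhom (obar u) (if b then breg A else bzero A) with
  | Some 1%N, true => dbar 0
  | _, _ => bzero_hom _ _
  end.

Lemma epsb_d u v b x : v = nxt u -> b = (v == Some 1%N) -> epsb v b (dobar u v x) = 0.
Proof.
move=> -> ->; case: u x => [[|[|[|k]]]|] x //.
by rewrite -[LHS]/(dbar 0 (dnat 2 1 x)) dnatS dbarK.
Qed.

Definition bar_eps : cmap barc (conc (breg A)).
Proof.
exists (fun i => epsb (lev i) (i == 0)).
by move=> i x; exact: epsb_d (lev_succ i) (lev_eq0 (i + 1)).
Defined.

Lemma bzero0 (x : bzero A) : x = 0.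
Proof. exact: is_zero_bzero. Qed.

(** At level 1 the element y of R is hit by the augmentation of [unitC S y]. At higher levels x is a
    cycle, or is killed by the augmentation, and d (unitC x) = x - unitC (d x) makes [unitC S x] a
    preimage. *)
Lemma bar_cone_lift u v w b b' x (y : if b then breg A else bzero A : gbimod A) :
    u != Some 0%N -> v = nxt u -> w = nxt v ->
    b = (u == Some 1%N) -> b' = (v == Some 1%N) ->
    dobar v w x = 0 -> epsb v b' x = 0 ->
  exists x', dobar u v x' = x /\ epsb u b x' = y.
Proof.
move=> u0 ev ew eb eb'; subst w v b b'.
case: u u0 x y => [[|[|[|k]]]|] // _ x y dx ex.
- exists (unitC S y); split; first by rewrite [x]bzero0 [LHS]bzero0.
  exact: dbar0_unit.
- exists (unitC S x); split; last by rewrite [y]bzero0.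
  rewrite -[LHS]/(dnat 2 1 (unitC S x)) dnatS dbar_unit.
  by rewrite [dbar 0 x]ex (zm0 (@unitCB _ S _)) subr0.
- exists (unitC S x); split; last by rewrite [y]bzero0.
  rewrite -[LHS]/(dnat k.+3 k.+2 (unitC S x)) dnatS dbar_unit.
  have -> : dbar k.+1 x = 0 by rewrite -dnatS.
  by rewrite (zm0 (@unitCB _ S _)) subr0.
- by exists 0; rewrite [x]bzero0 [y]bzero0.
Qed.

Lemma exact_cone_bar : exact_cpx (cone bar_eps).
Proof.
move=> i [x y]; rewrite cone_diffE => -[dx ex].
(* The first component of the cone differential carries a sign, so a preimage of - x is taken. *)
have [|||||||x' [h1 h2]] := @bar_cone_lift (lev (i + 1)) (lev (i + 1 + 1)) (lev (i + 1 + 1 + 1))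
  (i + 1 == 0) (i + 1 + 1 == 0) (- x) y.
- exact: lev_neq0.
- exact: lev_succ.
- exact: lev_succ.
- exact: lev_eq0.
- exact: lev_eq0.
- by rewrite bhomN.
- by move: ex; rewrite addr0 /= bhomN => ->; rewrite oppr0.
exists (x', 0); rewrite cone_diffE /= h1 h2 opprK.
by congr pair; rewrite addr0.
Qed.

Lemma barc_bounded : bounded_above barc.
Proof. by exists 0; case=> [[|k]|k] // _ x; exact: bzero0. Qed.

Lemma ifree_bzero : ifree S (bzero A).
Proof.
exists void, (fun=> 0), (fun x => of_void _ x), (fun x => of_void _ x).
by split=> [[]|[]|x]; rewrite [x]bzero0 [RHS]bzero0.
Qed.

Lemma ifree_barc i : ifree S (barc i).
Proof.
rewrite /=; case: (lev i) (lev_neq0 i) => [[|k]|] // _; first exact: ifree_barS.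
exact: ifree_bzero.
Qed.

Lemma scentral_obar u : scentral S (obar u).
Proof. by case: u => [k|]; [exact: scentral_bar | exact: scentral_bzero]. Qed.

Lemma scentral_conc i : scentral S (conc (breg A) i).
Proof. by rewrite /=; case: ifP => _; [exact: scentral_breg | exact: scentral_bzero]. Qed.

Lemma scentral_cone (D E : cpx A) (f : cmap D E) : (forall i, scentral S (D i)) ->
  (forall i, scentral S (E i)) -> forall i, scentral S (cone f i).
Proof. by move=> hD hE i; apply: scentral_bsum. Qed.

Lemma scentral_cone_bar i : scentral S (cone bar_eps i).
Proof. by apply: scentral_cone => {}i; [exact: scentral_obar | exact: scentral_conc]. Qed.

Lemma projective_tens_bsuml M N K : projective S (M \tens K) -> projective S (N \tens K) ->
  projective S (bsum M N \tens K).
Proof.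
move=> hM hN.
pose f := bpair (btens_map fullA (bfst M N) (bid K)) (btens_map fullA (bsnd M N) (bid K)).
pose g := badd
  (bcomp (btens_map fullA (bpair (bid M) (bzero_hom M N)) (bid K)) (bfst (M \tens K) (N \tens K)))
  (bcomp (btens_map fullA (bpair (bzero_hom N M) (bid N)) (bid K)) (bsnd (M \tens K) (N \tens K))).
apply: (projective_retract (i := f) (r := g)) (projective_bsum hM hN).
have gf : forall t, bcomp g f t = bid _ t.
  apply: bhom_tens_ext => -[m n] k; rewrite /= !tmap_pure /= -pureDl.
  by congr pure; congr pair; rewrite ?addr0 ?add0r.
exact: gf.
Qed.

Lemma projective_tens_bsumr M N K : projective S (K \tens M) -> projective S (K \tens N) ->
  projective S (K \tens bsum M N).
Proof.
move=> hM hN.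
pose f := bpair (btens_map fullA (bid K) (bfst M N)) (btens_map fullA (bid K) (bsnd M N)).
pose g := badd
  (bcomp (btens_map fullA (bid K) (bpair (bid M) (bzero_hom M N))) (bfst (K \tens M) (K \tens N)))
  (bcomp (btens_map fullA (bid K) (bpair (bzero_hom N M) (bid N))) (bsnd (K \tens M) (K \tens N))).
apply: (projective_retract (i := f) (r := g)) (projective_bsum hM hN).
have gf : forall t, bcomp g f t = bid _ t.
  apply: bhom_tens_ext => k [m n]; rewrite /= !tmap_pure /= -pureDr.
  by congr pure; congr pair; rewrite ?addr0 ?add0r.
exact: gf.
Qed.

Lemma ifree_obar_tens u M : ifree S M -> ifree S (obar u \tens M).
Proof.
move=> hM; case: u => [k|]; first exact: ifree_bar_tens.
apply: ifree_iso ifree_bzero; apply: biso_zero; first exact: is_zero_bzero.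
apply: is_zero_tensl; exact: is_zero_bzero.
Qed.

Lemma ifree_tens_obar u k : ifree S (bshift k C \tens obar u).
Proof.
case: u => [[|l]|].
- exact: ifree_iso (biso_sym (biso_runit _)) (ifree_ind S k).
- by apply: ifree_tens_shift => //; exact: ifree_barS.
apply: ifree_iso ifree_bzero; apply: biso_zero; first exact: is_zero_bzero.
apply: is_zero_tensr; exact: is_zero_bzero.
Qed.

Lemma conc_obar i : exists u, conc (breg A) i = obar u.
Proof. by rewrite /=; case: ifP => _; [exists (Some 0%N) | exists None]. Qed.

Lemma bounded_cone : bounded_above (cone bar_eps).
Proof.
exists 0; case=> [[|k]|k] // _ [x y]; congr pair; last exact: bzero0.
have h : is_zero (obar (lev (Posz k.+1 + 1))) by rewrite lev_succ; exact: is_zero_bzero.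
exact: h.
Qed.

Lemma cone_tensr_contractible k :
  hequiv (ctensr (cone bar_eps) (bshift k C)) (czero A).
Proof.
apply: (hequiv_zero_of_exact (S := S)).
- have [N hN] := bounded_cone; exists N => i /hN h; apply: is_zero_tensl; exact: h.
- move=> i; apply: projective_tens_bsuml; apply: ifree_projective.
    by apply: ifree_obar_tens; exact: ifree_ind.
  have [u ->] := conc_obar i; by apply: ifree_obar_tens; exact: ifree_ind.
- move=> i; apply: scentral_full; first exact: scentral_cone_bar.
  by apply: scentral_bshift; exact: scentral_ind.
- exact: (exact_ctensr SF) exact_cone_bar.
Qed.

Lemma cone_tensl_contractible k :
  hequiv (ctensl (bshift k C) (cone bar_eps)) (czero A).
Proof.
apply: (hequiv_zero_of_exact (S := S)).
- have [N hN] := bounded_cone; exists N => i /hN h; apply: is_zero_tensr; exact: h.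
- move=> i; apply: projective_tens_bsumr; apply: ifree_projective.
    exact: ifree_tens_obar.
  have [u ->] := conc_obar i; exact: ifree_tens_obar.
- move=> i; apply: scentral_full; last exact: scentral_cone_bar.
  by apply: scentral_bshift; exact: scentral_ind.
- exact: (exact_ctensl SF) exact_cone_bar.
Qed.
End BarComplex.

(** * Idempotence *)

Section Idempotent.
Variables (A : gradedRing) (S : gradedSubring A).
Hypothesis SF : frobenius S.
Local Notation pr_ := (pure (full_subring A)).
Local Notation fullA := (full_subring A).
Local Notation C := (ind S).
Local Notation bar := (bar S).
Local Notation dbar := (dbar S).
Local Notation P := (barc S).
Local Notation obar := (obar S).
Local Notation dobar := (dobar S).
Local Notation PP := (ctens P P).
Local Notation cell k i j h m n := (@tot_pure A P P k (exist _ (i, j) h) m n).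

Lemma tot_ext k (Z : zmodType) (f g : PP k -> Z) : zmod_morphism f -> zmod_morphism g ->
  (forall i j h (m : P i) (n : P j), f (cell k i j h m n) = g (cell k i j h m n)) -> f =1 g.
Proof.
move=> hf hg e; apply: eq_dsum => // -[[i j] h] t; move: t.
have dB := @dinc_additive A (tot_idx k) (@tot_term A P P k) (exist _ (i, j) h).
by apply: tens_ext => [t u|t u|m n]; rewrite ?dB ?hf ?hg //; exact: e.
Qed.

(** A component of eps (x) id : P (x) P -> R (x) P = P. The source degree j and the target degree k
    are independent, and the map is zero unless they agree and the first factor sits in degree 0. *)
Definition theta0 (u : option nat) (j k : int) : bhom (obar u \tens P j) (P k) :=
  match u return bhom (obar u \tens P j) (P k) with
  | Some 1%N => match j =P k with
    | ReflectT e => ecast l (bhom (bar 1 \tens P j) (P l)) e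
        (bcomp (lunit (P j)) (btens_map fullA (dbar 0) (bid (P j))))
    | ReflectF _ => bzero_hom _ _
    end
  | _ => bzero_hom _ _
  end.

Lemma theta0E j m n : theta0 (Some 1%N) j j (pr_ m n) = (dbar 0 m : A) *: n.
Proof.
rewrite /theta0; case: eqP => // e; rewrite eq_axiomK /= tmap_pure.
exact: lunitE.
Qed.

Lemma theta0_out u j k t : u != Some 1%N -> theta0 u j k t = 0.
Proof. by case: u t => [[|[|l]]|]. Qed.

Lemma theta0_ker u v j k m n : v = nxt u -> theta0 v j k (pr_ (dobar u v m) n) = 0.
Proof.
move=> ->; case: u m => [[|[|[|l]]]|] m //.
have [<-|ne] := eqVneq j k; last first.
  by rewrite /= /theta0; case: eqP => // e; rewrite e eqxx in ne.
rewrite -[nxt _]/(Some 1%N) theta0E -[dobar _ _ _]/(dnat S 2 1 m) dnatS dbarK.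
exact: scale0r.
Qed.

Definition thetak k : bhom (PP k) (P k) :=
  bdlift (fun p : tot_idx k => theta0 (lev (val p).1) (val p).2 k).

Lemma thetakE k (p : tot_idx k) (m : P (val p).1) (n : P (val p).2) :
  thetak k (tot_pure m n) = theta0 (lev (val p).1) (val p).2 k (pr_ m n).
Proof. by rewrite [LHS]dlift_inc // => q; exact: bhomB. Qed.

Lemma thetak_d k x : thetak (k + 1) (cdiff PP k x) = cdiff P k (thetak k x).
Proof.
move: x; apply: tot_ext => [x y|x y|i j h m n]; rewrite ?linearB //.
rewrite [cdiff PP k _]tot_diffE linearD linearZ !thetakE.
rewrite theta0_ker; last exact: lev_succ.
rewrite [LHS]add0r.
have [e|ne] := eqVneq (lev i) (Some 1%N); last first.
  by rewrite !theta0_out // [LHS]scaler0 bhom0.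
move: (lev1 e) => ei; subst i; move/eqP: (h); rewrite /= add0r => ej; subst k.
rewrite [LHS]scale1r [LHS]theta0E.
transitivity (cdiff P j ((dbar 0 m : A) *: n)); first exact/esym/linearZ.
by congr (cdiff P j _); exact/esym/theta0E.
Qed.

Definition theta : cmap PP P := @CMap A PP P thetak thetak_d.

(** The contraction [unitC] between arbitrary levels, zero unless the second is the successor of the
    first. *)
Definition sbar (u v : option nat) : obar u -> obar v :=
  match u, v return obar u -> obar v with
  | Some k, Some l => match l =P k.+1 with
    | ReflectT e => fun m => ecast x (bar x) (esym e) (unitC S m)
    | ReflectF _ => fun=> 0
    end
  | _, _ => fun=> 0
  end.

Lemma sbarS k (m : obar (Some k)) : sbar (Some k.+1) m = unitC S m.
Proof. by rewrite /sbar; case: eqP => // e; rewrite eq_axiomK. Qed.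

Lemma sbarB u v : zmod_morphism (@sbar u v).
Proof.
case: u v => [k|] [l|] m m'; rewrite /sbar ?subrr //.
case: eqP => [e|_]; last by rewrite subrr.
by case: _ / (esym e); exact: unitCB.
Qed.

Lemma sbar_ract u v m a : sbar v (ract (m : obar u) a) = ract (sbar v m) a.
Proof.
case: u v m => [k|] [l|] m; rewrite /sbar ?(zm0 (ractl_additive _)) //.
case: eqP => [e|_]; last by rewrite (zm0 (ractl_additive _)).
by case: _ / (esym e); exact: unitC_ract.
Qed.

Lemma sbar_contr k (m : obar (Some k.+2)) :
  dobar (Some k.+3) (Some k.+2) (sbar (Some k.+3) m) +
  sbar (Some k.+2) (dobar (Some k.+2) (Some k.+1) m) = m.
Proof.
rewrite !sbarS -[dobar _ _ _]/(dnat S k.+3 k.+2 (unitC S m)).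
rewrite -[dobar _ _ _]/(dnat S k.+2 k.+1 m) !dnatS.
by rewrite dbar_unit subrK.
Qed.

Lemma sbar_contr0 (m : obar (Some 1%N)) :
  dobar (Some 2%N) (Some 1%N) (sbar (Some 2%N) m) = m - unitC S (dbar 0 m).
Proof.
by rewrite sbarS -[dobar _ _ _]/(dnat S 2 1 (unitC S m)) dnatS dbar_unit.
Qed.

Lemma prev_subproof k (p : tot_idx (k + 1)) : (val p).1 - 1 + (val p).2 == k.
Proof. by rewrite addrAC (eqP (valP p)) addrK. Qed.

Definition prevl k (p : tot_idx (k + 1)) : tot_idx k :=
  exist _ ((val p).1 - 1, (val p).2) (prev_subproof p).

Lemma sbar_bal u v (N : gbimod A) : balanced fullA (fun (m : obar u) (n : N) => pr_ (sbar v m) n).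
Proof.
split=> [n m m'|m n n'|m a n _].
- by rewrite sbarB pureBl.
- exact: pureBr.
- by rewrite sbar_ract pureM.
Qed.

(** The contraction of the first factor tensored with the identity of the second. It is well defined
    over R because [sbar] respects the right action; the result is additive but not left linear. *)
Definition shtpy k (x : PP (k + 1)) : PP k :=
  dlift (fun (p : tot_idx (k + 1)) (t : P (val p).1 \tens P (val p).2) =>
    dinc (M := @tot_term A P P k) (i := prevl p)
      (tlift (fun m n => pr_ (sbar (lev ((val p).1 - 1)) m) n) t)) x.

Lemma shtpy_cellB k (p : tot_idx (k + 1)) :
  zmod_morphism (fun t : P (val p).1 \tens P (val p).2 =>
    dinc (M := @tot_term A P P k) (i := prevl p)
      (tlift (fun m n => pr_ (sbar (lev ((val p).1 - 1)) m) n) t)).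
Proof.
move=> t u; rewrite -dinc_additive; congr dinc.
have e := tlift_additive (@sbar_bal (lev (val p).1) (lev ((val p).1 - 1)) (P (val p).2)) t u.
exact: e.
Qed.

Lemma shtpyB k : zmod_morphism (@shtpy k).
Proof. exact: dlift_additive (@shtpy_cellB k). Qed.

Lemma shtpyE k i j h h' m n :
  @shtpy k (cell (k + 1) i j h m n) = cell k (i - 1) j h' (sbar (lev (i - 1)) m) n.
Proof.
rewrite /shtpy [LHS](dlift_inc (@shtpy_cellB k)).
rewrite (tlift_pure (@sbar_bal (lev i) (lev (i - 1)) (P j))); exact: tot_pure_irr.
Qed.

(** An additive section of theta, with values in the summand of bidegree (0, k). *)
Definition sunit k (y : P k) : PP k :=
  @tot_pure A P P k (exist _ (0, k) (introT eqP (add0r k))) (unitC S (1 : breg A)) y.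

Lemma sunitB k : zmod_morphism (@sunit k).
Proof.
move=> y y'; rewrite /sunit /tot_pure pureBr; exact: dinc_additive.
Qed.

Lemma theta_sunit k y : thetak k (sunit y) = y.
Proof. by rewrite [LHS]thetakE -[lev 0]/(Some 1%N) theta0E dbar0_unit scale1r. Qed.

Lemma sunit_d k (y : P k) : cdiff PP k (sunit y) = sunit (cdiff P k y).
Proof.
have e0 : cdiff P 0 (unitC S (1 : breg A) : P 0) = 0 by exact: is_zero_bzero.
have aux (V : zmodType) (a b c : V) : a = 0 -> b = c -> a + b = c.
  by move=> -> ->; rewrite add0r.
rewrite [LHS]tot_diffE; apply: aux.
  pose p0 : tot_idx k := exist _ (0, k) (introT eqP (add0r k)).
  exact: (etrans (congr1 (fun m => @tot_pure A P P (k + 1) (nextl p0) m y) e0)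
    (@tot_pure0l A P P (k + 1) (nextl p0) y)).
rewrite [LHS]scale1r; exact: tot_pure_irr.
Qed.

Lemma theta_shtpy k x : thetak k (@shtpy k x) = 0.
Proof.
move: x; apply: (tot_ext (g := fun=> 0)) => [x y|x y|i j h m n].
- by rewrite shtpyB linearB.
- by rewrite subrr.
have h' : i - 1 + j == k by rewrite addrAC (eqP h) addrK.
rewrite (@shtpyE k i j h h' m n) thetakE.
have [e|ne] := eqVneq (lev (i - 1)) (Some 1%N); last by rewrite theta0_out.
have z : is_zero (P i) by rewrite /= -[i](subrK 1) lev_succ e; exact: is_zero_bzero.
by rewrite [m]z (zm0 (@sbarB _ _)) (zm0 (pureBl _ _)) bhom0.
Qed.

(** Together with [cell_s] this moves an entry between the propositionally equal cells i - 1 + 1, i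
    + 1 - 1 and i. *)
Lemma cell_d k i i' j v h h' z n : i = i' ->
  cell k i j h (dobar v (lev i) z) n = cell k i' j h' (dobar v (lev i') z) n.
Proof. by move=> e; case: _ / e h' => h'; exact: tot_pure_irr. Qed.

Lemma cell_s k i i' j v h h' (z : obar v) n : i = i' ->
  cell k i j h (sbar (lev i) z) n = cell k i' j h' (sbar (lev i') z) n.
Proof. by move=> e; case: _ / e h' => h'; exact: tot_pure_irr. Qed.

Lemma sign_pred (i : int) : (-1) ^+ `|i - 1| = - (-1) ^+ `|i| :> A.
Proof. by rewrite -{2}[i](subrK 1) sign_succ opprK. Qed.

Lemma zm_sign (M N : gbimod A) (f : M -> N) k x : zmod_morphism f ->
  f ((-1) ^+ k *: x) = (-1) ^+ k *: f x.
Proof.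
by move=> hf; rewrite -signr_odd; case: odd; rewrite ?scale1r // expr1 !scaleN1r zmN.
Qed.

Lemma tot_pureDl k (p : tot_idx k) (m m' : P (val p).1) (n : P (val p).2) :
  tot_pure (m + m') n = tot_pure m n + tot_pure m' n :> PP k.
Proof. by rewrite /tot_pure pureDl (zmD (@dinc_additive _ _ _ p)). Qed.

Lemma tot_pureNl k (p : tot_idx k) (m : P (val p).1) (n : P (val p).2) :
  tot_pure (- m) n = - tot_pure m n :> PP k.
Proof.
by rewrite /tot_pure (zmN (pureBl fullA n)) (zmN (@dinc_additive _ _ _ p)).
Qed.

(** The contraction lowers the first degree by one and so reverses the Koszul sign: the two terms
    with a differential on the second factor cancel, and the contraction identity of the first
    factor is left. *)
Lemma shtpy_contr_cell k i j h m n :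
  cdiff PP k (@shtpy k (cell (k + 1) i j h m n)) +
    shtpy (cdiff PP (k + 1) (cell (k + 1) i j h m n)) =
  cell (k + 1) i j h
    (dobar (lev (i - 1)) (lev i) (sbar (lev (i - 1)) m) +
     sbar (lev i) (dobar (lev i) (lev (i + 1)) m)) n.
Proof.
have h1 : i - 1 + j == k by rewrite addrAC (eqP h) addrK.
have h2 : i + 1 + j == k + 1 + 1 by rewrite addrAC (eqP h).
have h3 : i + (j + 1) == k + 1 + 1 by rewrite addrA (eqP h).
have h4 : i - 1 + (j + 1) == k + 1 by rewrite addrA (eqP h1).
have h5 : i - 1 + 1 + j == k + 1 by rewrite subrK.
have h6 : i + 1 - 1 + j == k + 1 by rewrite addrK.
have aux (L : lmodType A) (a b c d e : L) (s s' : A) :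
    s' = - s -> a = c -> b = d -> a + s' *: e + (b + s *: e) = c + d.
  by move=> -> -> ->; rewrite scaleNr addrACA addNr addr0.
rewrite (@shtpyE k i j h h1 m n) tot_pureDl.
have E1 : cdiff PP k (cell k (i - 1) j h1 (sbar (lev (i - 1)) m) n) =
    cell (k + 1) (i - 1 + 1) j h5
      (dobar (lev (i - 1)) (lev (i - 1 + 1)) (sbar (lev (i - 1)) m)) n +
    (-1) ^+ `|i - 1| *: cell (k + 1) (i - 1) (j + 1) h4 (sbar (lev (i - 1)) m) (cdiff P j n).
  rewrite [LHS]tot_diffE; congr (_ + _ *: _); exact: tot_pure_irr.
have E2 : shtpy (cdiff PP (k + 1) (cell (k + 1) i j h m n)) =
    cell (k + 1) (i + 1 - 1) j h6
      (sbar (lev (i + 1 - 1)) (dobar (lev i) (lev (i + 1)) m)) n +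
    (-1) ^+ `|i| *: cell (k + 1) (i - 1) (j + 1) h4 (sbar (lev (i - 1)) m) (cdiff P j n).
  rewrite -(@shtpyE (k + 1) (i + 1) j h2) -(@shtpyE (k + 1) i (j + 1) h3).
  rewrite -(zm_sign _ _ (@shtpyB (k + 1))) -(zmD (@shtpyB (k + 1))); congr (shtpy _).
  rewrite [LHS]tot_diffE; congr (_ + _ *: _); exact: tot_pure_irr.
rewrite E1 E2; apply: aux; first exact: sign_pred.
- exact: (cell_d (i := i - 1 + 1)) (subrK 1 i).
- exact: (cell_s (i := i + 1 - 1)) (addrK 1 i).
Qed.

Lemma bar_contr u v w (m : obar u) : u != Some 0%N -> u != Some 1%N ->
  u = nxt w -> v = nxt u -> dobar w u (sbar w m) + sbar u (dobar u v m) = m.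
Proof.
case: u m => [[|[|k]]|] m // _ _; last by move=> _ _; rewrite [LHS]bzero0 [RHS]bzero0.
case: w => [[|[|[|l]]]|] //= [<-] ->; exact: sbar_contr.
Qed.

Lemma bar_contr0 w (m : obar (Some 1%N)) : Some 1%N = nxt w ->
  dobar w (Some 1%N) (sbar w m) = m - unitC S (dbar 0 m).
Proof. by case: w => [[|[|[|l]]]|] //= _; exact: sbar_contr0. Qed.

Lemma lev_pred i : lev i = nxt (lev (i - 1)).
Proof. by rewrite -lev_succ subrK. Qed.

(** With [theta_sunit] this makes theta an equivalence of complexes of abelian groups with inverse
    [sunit]. Exactness of its cone needs no more, and projectivity then provides a bimodule
    equivalence. *)
Lemma shtpy_contr k x : cdiff PP k (@shtpy k x) + shtpy (cdiff PP (k + 1) x) =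
  x - sunit (thetak (k + 1) x).
Proof.
move: x; apply: tot_ext => [x y|x y|i j h m n].
- by rewrite shtpyB (bhomB (cdiff PP k)) (bhomB (cdiff PP (k + 1))) shtpyB opprD addrACA.
- by rewrite (bhomB (thetak _)) sunitB opprD addrACA -opprD.
rewrite shtpy_contr_cell thetakE.
have [e|ne] := eqVneq (lev i) (Some 1%N); last first.
  rewrite theta0_out // (zm0 (@sunitB _)) subr0.
  congr (@tot_pure A P P (k + 1) (exist _ (i, j) h) _ n).
  by apply: bar_contr => //; [exact: lev_neq0 | exact: lev_pred | exact: lev_succ].
move: (lev1 e) => ei; subst i.
have ej : j = k + 1 by move/eqP: (h); rewrite /= add0r.
subst j; rewrite [X in _ - sunit X]theta0E.
have -> : dobar (lev (0 - 1)) (lev 0) (sbar (lev (0 - 1)) m) = m - unitC S (dbar 0 m).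
  by apply: bar_contr0; exact: (lev_pred 0).
have -> : sbar (lev 0) (dobar (lev 0) (lev (0 + 1)) m) = 0.
  have -> : dobar (lev 0) (lev (0 + 1)) m = 0 by exact: is_zero_bzero.
  exact: zm0 (@sbarB _ _).
rewrite addr0 tot_pureDl tot_pureNl; congr (_ - _).
rewrite /sunit /tot_pure pureZ -unitC_ract.
have -> : ract (1 : breg A) (dbar 0 m : A) = dbar 0 m by exact: mul1r.
exact: tot_pure_irr.
Qed.

Lemma exact_cone_theta : exact_cpx (cone theta).
Proof.
move=> i [x y]; rewrite cone_diffE => e.
have ex : theta (i + 1 + 1) x + cdiff P (i + 1) y = 0 := congr1 snd e.
have dx : cdiff PP (i + 1 + 1) x = 0 by apply: oppr_inj; rewrite oppr0; exact: (congr1 fst e).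
(* As x is a cycle and theta x = - d y, the identity [shtpy_contr] reads x = d (shtpy x - sunit y).
   The outer sign is that of the cone, and theta kills [shtpy] and sends [sunit y] to y. *)
exists (- (shtpy x - sunit y), 0); rewrite cone_diffE bhom0 addr0 !bhomN opprK; congr pair.
  rewrite linearB [cdiff PP (i + 1) (sunit y)]sunit_d.
  have := shtpy_contr x; rewrite dx (zm0 (@shtpyB _)) addr0 => ->.
  have -> : sunit (cdiff P (i + 1) y) = - sunit (thetak (i + 1 + 1) x).
    have aux (V : zmodType) (a b : V) : a + b = 0 -> b = - a.
      by move/eqP; rewrite addr_eq0 => /eqP->; rewrite opprK.
    by rewrite -(zmN (@sunitB _)); congr sunit; exact: aux.
  by rewrite opprK subrK.
by rewrite linearB [X in - (X - _)]theta_shtpy sub0r opprK [LHS]theta_sunit.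
Qed.

Lemma bar_tens_hequiv : hequiv (ctens P P) P.
Proof.
apply: (hequiv_of_exact_cone (S := S) (f := theta)).
- exists 0 => k k0; move=> x; apply: dsum_ext => -[[i j] h].
  have z : is_zero (P i \tens P j).
    have [hi|hi] := ltrP 0 i.
      by apply: is_zero_tensl; case: i hi {x h} => [[|i]|i] // _; exact: is_zero_bzero.
    apply: is_zero_tensr; have : 0 < j by move/eqP: h => /=; lia.
    by case: j {x h} => [[|j]|j] // _; exact: is_zero_bzero.
  by rewrite [LHS]z [RHS]z.
- move=> k; apply: projective_bdsum => -[[i j] h]; apply: ifree_projective.
  by apply: ifree_obar_tens => //; exact: ifree_barc.
- move=> k; apply: scentral_bdsum => -[[i j] h].
  by apply: scentral_full; exact: scentral_obar.
- exact: barc_bounded.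
- by move=> i; apply: ifree_projective; exact: ifree_barc.
- by move=> i; exact: scentral_obar.
- exact: exact_cone_theta.
Qed.
End Idempotent.

(** * Direct summands *)

Section Kernel.
Variables (A : gradedRing) (M N : gbimod A) (f : bhom M N).

Definition ker_pred : {pred M} := fun x => f x == 0.

Lemma ker_predP x : reflect (f x = 0) (x \in ker_pred).
Proof. exact: eqP. Qed.

Lemma ker_submod_closed : submod_closed ker_pred.
Proof.
split; first by apply/ker_predP; exact: bhom0.
by move=> a u v /ker_predP hu /ker_predP hv; apply/ker_predP; rewrite linearP hu hv scaler0 addr0.
Qed.

HB.instance Definition _ := GRing.isSubmodClosed.Build A M ker_pred ker_submod_closed.

Record ker := Ker { ker_val : M; ker_in : ker_val \in ker_pred }.

HB.instance Definition _ := [isSub for ker_val].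
HB.instance Definition _ := [Choice of ker by <:].
HB.instance Definition _ := [SubChoice_isSubLmodule of ker by <:].

Lemma ker0 (x : ker) : f (ker_val x) = 0.
Proof. exact/ker_predP/(ker_in x). Qed.

Lemma ker_ract_in (x : ker) a : ract (ker_val x) a \in ker_pred.
Proof. by apply/ker_predP; rewrite bhomr ker0 (zm0 (ractl_additive a)). Qed.

Definition ker_ract (x : ker) a : ker := Ker (ker_ract_in x a).

Lemma ker_pr_in i (x : ker) : pr (gdeg_grading M) i (ker_val x) \in ker_pred.
Proof.
apply/ker_predP.
have e : f (pr (gdeg_grading M) i (ker_val x)) = pr (gdeg_grading N) i (f (ker_val x)).
  move: (ker_val x); apply: (eq_homog (gdeg_grading M)) => [u v|u v|j u hu].
  - by rewrite prB linearB.
  - by rewrite linearB prB.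
  rewrite (pr_id _ _ hu) (pr_id _ _ (bhom_deg f hu)).
  by case: ifP => // _; rewrite bhom0.
by rewrite e ker0 (zm0 (@prB _ _ _ i)).
Qed.

Lemma ker_grading : grading (fun i (x : ker) => gdeg i (ker_val x)).
Proof.
pose G := gdeg_grading M.
split.
- by move=> i; exact: gr0 G i.
- by move=> i u v; exact: (grB G).
- move=> x; exists (gsupp G (ker_val x)), (fun i => Ker (ker_pr_in i x)); split=> [i|].
    exact: pr_gr.
  apply: val_inj; rewrite raddf_sum /=; exact: pr_sum.
- move=> s h us hh e i si; apply: val_inj.
  apply: (gr_indep G (f := fun i => ker_val (h i)) us) => //.
  by have := congr1 val e; rewrite raddf_sum.
Qed.

Definition bker : gbimod A.
Proof.
apply: (@GBimod A ker ker_ract _ _ _ _ _ (fun i (x : ker) => gdeg i (ker_val x))).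
- by move=> a u v; apply: val_inj; exact: ractDl.
- by move=> a b u; apply: val_inj; exact: ractDr.
- by move=> a b u; apply: val_inj; exact: ractA.
- by move=> u; apply: val_inj; exact: ract1.
- by move=> a b u; apply: val_inj; exact: ractZ.
- exact: ker_grading.
- by move=> i j a u ha hu; exact: gdegl.
- by move=> i j a u hu ha; exact: gdegr.
Defined.

(** The class [soergel] is closed under summands with an explicit complement, so a retraction has to
    be completed to a direct sum decomposition; the kernel of f is the complement. *)
Lemma split_summand (g : bhom N M) : cancel g f -> biso M (bsum N bker).
Proof.
move=> gK.
have pin x : x - g (f x) \in ker_pred by apply/ker_predP; rewrite linearB gK subrr.
have [p pE] : {p : bhom M bker | forall x, ker_val (p x) = x - g (f x)}.
  unshelve eexists.
    apply: (@mk_bhom _ M bker (fun x => Ker (pin x))).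
    - move=> a u v; apply: val_inj; rewrite [RHS](linearP val) /=.
      by rewrite (linearP f) (linearP g) opprD addrACA scalerBr.
    - move=> u a; apply: val_inj; rewrite /= !bhomr.
      exact/esym/(ractl_additive (M := M)).
    - move=> i u hu; apply: (grB (gdeg_grading M)) => //.
      by do 2!apply: bhom_deg.
  by [].
have [q qE] : {q : bhom bker M | forall x, q x = ker_val x}.
  unshelve eexists.
    by apply: (@mk_bhom _ bker M (fun x : ker => (ker_val x))).
  by [].
exists (bpair f p), (badd (bcomp g (bfst N bker)) (bcomp q (bsnd N bker))).
split=> [x|[y x]] /=.
  by rewrite qE pE addrC subrK.
congr pair; first by rewrite linearD gK qE ker0 addr0.
apply: val_inj; rewrite /= pE linearD gK qE ker0 addr0 addrC addKr //.
Qed.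
End Kernel.

(** * Soergel bimodules *)

Section SoergelTheory.
Variable m : nat.
Local Notation n := m.+1.
Local Notation R := (polyR n).
Local Notation S := (invariants [set: 'S_n]).
Local Notation fullR := (full_subring R).
Local Notation pr_ := (pure (full_subring R)).
Implicit Types M N L : gbimod R.

Lemma symmP (f : R) : smem S f <-> symm f.
Proof. by split=> h s; [apply: h; rewrite inE | move=> _; exact: h]. Qed.

Lemma polyR_frobenius : exists (w : seq nat) (SF : frobenius S),
  [/\ all (fun i => i < m)%N w, size w = ((n * n.-1)./2)%N,
      ftop SF = (2 * size w)%N & forall f, ftr SF f = ddw w f].
Proof.
have [w [I [a [b [d [[h1 h2 h3 h4] h5 h6 h7 h8]]]]]] := frobenius_basis m.
have trB : @zmod_morphism R R (@ddw m w) := @ddw_additive m w.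
have hS (f : R) : smem S (ddw w f) by apply/symmP.
have hl (c f : R) : smem S c -> ddw w (c * f) = c * ddw w f by move=> /symmP; exact: h4.
have hd i (f : R) : rdeg i f -> rdeg (i - (2 * size w)%N%:Z) (ddw w f : R) by exact: pdeg_ddw.
exists w, (@Frobenius R S (@ddw m w) (2 * size w)%N%:Z I a b d trB hS hl hd
  (fun i => (h5 i).1) (fun i => (h5 i).2) h7 h6 h8).
by split.
Qed.

Lemma soergel_zero : soergel (bzero R).
Proof.
apply: (soergel_summand (soergel_R n) (N := breg R)).
exists (bpair (bzero_hom _ _) (bid (breg R))), (bsnd (bzero R) (breg R)).
by split=> [x|[x y]] //=; congr pair; rewrite [RHS]is_zero_bzero.
Qed.

Lemma soergel_iso M N : soergel M -> biso M N -> soergel N.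
Proof.
move=> hM h; apply: (soergel_summand hM (N := bzero R)); apply: biso_trans h _.
exists (bpair (bid N) (bzero_hom _ _)), (bfst N (bzero R)).
by split=> [x|[x y]] //=; congr pair; rewrite [RHS]is_zero_bzero.
Qed.

(** W-invariants are s-invariant, hence pass through the tensor sign of each B_s; a summand inherits
    centrality because it embeds. This makes the cone of an arbitrary augmentation eps' a legitimate
    target for lifting. *)
Lemma soergel_scentral M : soergel M -> scentral S M.
Proof.
elim=> {M} [|i j _|M N _ hM _ hN|M N L _ hL [f [g [fg gf]]]|k M _ hM|M N _ hM _ hN].
- exact: scentral_breg.
- apply: scentral_bshift; apply: scentral_tens; try exact: scentral_breg.
  by move=> f hf w _; apply: hf; rewrite inE.
- exact: scentral_bsum.
- apply: (scentral_inj (f := bcomp g (bpair (bid M) (bzero_hom M N)))) hL => x y /=.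
  by move=> /(can_inj gf) [].
- exact: scentral_bshift.
- exact: scentral_full.
Qed.

Lemma dd_swapP i (c : R) : (i < m)%N -> smem (invariants [set sw m i]) c ->
  msym (sw m i) c = c.
Proof. by move=> _; apply; rewrite inE. Qed.

(* The form [gamma] on a Bott-Samelson bimodule sends a_0 (x) ... (x) a_r to
   a_0 d_1 (a_1 d_2 (... d_r a_r)) with d_i the divided differences. *)
Lemma bott_samelson (w : seq nat) : all (fun i => i < m)%N w ->
  exists (M : gbimod R) (e : M) (gamma : M -> R),
    [/\ soergel M /\ gdeg (- (size w)%:Z) e, zmod_morphism gamma,
        forall a x, gamma (a *: x) = a * gamma x,
        forall i x, gdeg i x -> rdeg (i - (size w)%:Z) (gamma x)
      & forall f, gamma (ract e f) = ddw w f].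
Proof.
elim: w => [_|i w IH /= /andP[im /IH[M [e [gamma [[sM de] gB gZ gd ge]]]]]].
  exists (breg R), (1 : R), id; split=> //.
  - by split; [exact: soergel_R | exact: rdeg1].
  - by move=> i x; rewrite subr0.
  - by move=> f; exact: mul1r.
pose S' := invariants [set sw m i].
have rho_bal : @balanced R S' (breg R) (breg R) R (fun x y : R => x * dd i y).
  split=> [y x x'|x y y'|x c y sc]; first exact: mulrBl.
    by rewrite -mulrBr; congr (_ * _); exact: dd_additive.
  rewrite -[ract x c]/(x * c : R) -[c *: y]/(c * y : R) -mulrA; congr (_ * _).
  by apply/esym/dd_linear => //; exact: dd_swapP sc.
pose rho : ind S' -> R := tlift (fun x y : breg R => (x : R) * dd i (y : R)).
have rhoB : zmod_morphism rho := tlift_additive rho_bal.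
have rhoE x y : rho (ipure S' x y) = x * dd i y by exact: (tlift_pure rho_bal).
have rhoZ c t : rho (c *: t) = c * rho t.
  move: t; apply: ind_ext => [t u|t u|x y]; rewrite ?scalerBr ?rhoB ?mulrBr //.
  by rewrite ipureZ !rhoE mulrA.
have rhod j t : gdeg j t -> rdeg (j - 2) (rho t).
  elim=> {t} [_ [i' [j' [x [y [hx hy <- ->]]]]]||u v _ du _ dv].
  - by rewrite (rhoE x y) -addrA; apply: rdegM => //; exact: pdeg_dd.
  - by rewrite (zm0 rhoB); exact: gr0 (rdeg_grading R) _.
  - by rewrite rhoB; exact: grB (rdeg_grading R) _ _ _ du dv.
have F_bal : @balanced R fullR (Bs (sw m i)) M R (fun t x => rho (ract (t : ind S') (gamma x))).
  split=> [x t u|t x y|t a x _].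
  - by rewrite -rhoB; congr rho; exact: (ractl_additive (M := ind S')).
  - by rewrite gB -rhoB; congr rho; exact: (ractr_additive (M := ind S')).
  - by rewrite gZ (ractA (g := ind S')).
exists (Bs (sw m i) \tens M), (pure fullR (M := Bs (sw m i)) (ipure S' 1 1) e).
pose gamma' : Bs (sw m i) \tens M -> R :=
  tlift (fun (t : Bs (sw m i)) x => rho (ract (t : ind S') (gamma x))).
have gB' : zmod_morphism gamma' := tlift_additive F_bal.
have gE t x : gamma' (pure fullR (M := Bs (sw m i)) t x) = rho (ract (t : ind S') (gamma x)).
  exact: (tlift_pure F_bal).
exists gamma'; split=> //.
- split.
    apply: soergel_tens => //; apply: soergel_Bs.
    by rewrite !inordK //; lia.
  have -> : - (size w).+1%:Z = -1 + - (size w)%:Z by lia.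
  apply: (pure_deg fullR (M := Bs (sw m i))) => //=.
  by rewrite subrr -[0]addr0; apply: ipure_deg; exact: rdeg1.
- move=> a; apply: (tens_ext (M := Bs (sw m i))) => [t u|t u|t x].
  + by rewrite scalerBr gB'.
  + by rewrite gB' mulrBr.
  + rewrite -(pureZl fullR (M := Bs (sw m i))) !gE -rhoZ.
    exact: (congr1 rho (esym (@ractZ _ (ind S') a (gamma x) t))).
- move=> j t; elim=> {t} [_ [i' [j' [t [x [ht hx <- ->]]]]]||u v _ du _ dv].
  + rewrite gE.
    have -> : i' + j' - (size w).+1%:Z = i' - (- 1) + (j' - (size w)%:Z) - 2 by lia.
    by apply/rhod/gdegr => //; exact: gd.
  + by rewrite (zm0 gB'); exact: gr0 (rdeg_grading R) _.
  + by rewrite gB'; exact: grB (rdeg_grading R) _ _ _ du dv.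
- move=> f; rewrite (ract_pure fullR (M := Bs (sw m i))) gE ge.
  by rewrite ipure_ract rhoE !mul1r.
Qed.

(** B_w0 is a retract of the Bott-Samelson bimodule: alpha sends 1 (x) 1 to the generator e, and
    beta sends e to the sum of the d_w0(a_j) (x) b_j. The traces d_w0(a_j) are symmetric, so this
    equals 1 (x) sum_j d_w0(a_j) b_j = 1 (x) 1. *)
Lemma soergel_ind_shift : soergel (bshift (- ((n * n.-1)./2)%:Z) (ind S)).
Proof.
have [w [SF [wm sw_ topE trE]]] := polyR_frobenius.
have [M [e [gamma [[sM de] gB gZ gd ge]]]] := bott_samelson wm.
have cM := soergel_scentral sM.
rewrite -sw_; set l := (size w)%:Z; pose B := bshift (- l) (ind S).
have [alpha alphaE] := ind_lift_sig de (fun s ss => cM s ss e).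
pose a_ := @fbasis _ _ SF; pose b_ := @fdual _ _ SF.
pose beta x : B := \sum_j ipure S (gamma (ract x (a_ j))) (b_ j).
have betaB : zmod_morphism beta.
  move=> x y; rewrite -sumrB; apply: eq_bigr => j _.
  by rewrite (ractl_additive (M := M)) gB ipureDl.
have betaZ a x : beta (a *: x) = a *: beta x.
  rewrite scaler_sumr; apply: eq_bigr => j _.
  by rewrite -ractZ gZ -[RHS]/(a *: ipure S _ _) ipureZ.
have betaR x a : beta (ract x a) = ract (beta x) a.
  rewrite [RHS](zm_sum (ractl_additive (M := B) a)).
  (* One matrix describes multiplication by a in both bases: a a_i is the sum over j of c_ij a_j,
     and a b_j is the sum over i of c_ij b_i. Its symmetric entries can be moved across the tensor
     sign. *)
  pose c i j : R := ftr SF (a * a_ i * b_ j).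
  have cS i j : smem S (c i j) by exact: ftr_mem.
  transitivity (\sum_i \sum_j ipure S (gamma (ract x (a_ j))) (c i j * b_ i)).
    apply: eq_bigr => i _; rewrite -ractA {1}(fbasis_expand SF (a * a_ i)).
    rewrite (zm_sum (ractr_additive x)) (zm_sum gB) (zm_sum (ipureDl S _)).
    apply: eq_bigr => j _; rewrite -/(c i j) ractA -(cM _ (cS i j) x) -ractZ gZ mulrC.
    by rewrite ipureM.
  rewrite exchange_big; apply: eq_bigr => j _ /=.
  rewrite -(zm_sum (ipureDr S _)) -[RHS]/(ract (ipure S _ _) a) ipure_ract.
  congr (ipure S _ _); rewrite [RHS](fdual_expand SF (b_ j * a)).
  by apply: eq_bigr => i _; congr (ftr SF _ * _); rewrite mulrC mulrA.
have betaD i x : gdeg i x -> @gdeg _ B i (beta x).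
  move=> hx; apply: (gr_sum (gdeg_grading B)) => j _ /=.
  (* The trace lowers degrees by 2l and [gamma] by l; the difference is the shift by l built into
     the target. *)
  have -> : i - - l = i + fdeg j - l + (ftop SF - fdeg j) by rewrite topE /l; lia.
  apply: ipure_deg; last exact: fdual_deg.
  by apply/gd/gdegr => //; exact: fbasis_deg.
have betaL : linear beta.
  by move=> a x y; rewrite (zmD betaB) betaZ.
pose b : bhom M B := @mk_bhom _ M B beta betaL betaR betaD.
have ba : cancel alpha b.
  have h : forall t, bcomp b alpha t = bid B t.
    apply: bhom_ind_ext => x y; rewrite -[LHS]/(beta (alpha (ipure S x y))) alphaE.
    rewrite betaR betaZ.
    have -> : beta e = ipure S 1 1.
      transitivity (\sum_j ipure S 1 (ftr SF (1 * a_ j) * b_ j)); last first.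
        by rewrite -(zm_sum (ipureDr S 1)) -fdual_expand.
      apply: eq_bigr => j _; rewrite ge -trE -ipureM ?mul1r //; exact: ftr_mem.
    by rewrite -[LHS]/(ract (x *: ipure S 1 1) y) ipureZ ipure_ract mulr1 mul1r.
  exact: h.
exact: (soergel_summand sM (split_summand ba)).
Qed.

Lemma soergel_Bw0 : soergel (Bw0 n).
Proof. exact: soergel_ind_shift. Qed.

Lemma soergel_ind : soergel (ind S).
Proof.
apply: (soergel_iso (soergel_shift ((n * n.-1)./2)%:Z soergel_Bw0)).
apply: biso_trans (biso_shiftD _ _ _) _; rewrite subrr; exact: biso_shift0.
Qed.

Lemma soergel_bar k : soergel (bar S k).
Proof.
by elim: k => [|k IH]; [exact: soergel_R | apply: soergel_tens => //; exact: soergel_ind].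
Qed.

Lemma ifree_sum_of_Bw0 M : ifree S M -> sum_of_Bw0 M.
Proof.
move=> [J [k hM]]; pose l := ((n * n.-1)./2)%:Z.
exists #|J|, (fun i => k (enum_val i) + l); apply: biproduct_bdsum.
apply: (biproduct_reindex (h := @enum_val J _) (F := fun j => bshift (k j + l) (Bw0 n))).
  exact: enum_val_bij.
apply: biproduct_isos hM => j; apply: biso_sym.
apply: biso_trans (biso_shiftD _ _ _) _; rewrite addrK; exact: biso_refl.
Qed.

Lemma sum_of_Bw0_projective M : sum_of_Bw0 M -> projective S M.
Proof.
move=> [r [k [f [g [fg _]]]]]; apply: projective_retract fg _.
apply: projective_bdsum => i.
have [f' [g' [fg' _]]] := biso_shiftD (k i) (- ((n * n.-1)./2)%:Z) (ind S).
apply: (@projective_retract R S (bshift (k i) (Bw0 n)) _ f' g' fg'); exact: projective_ind.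
Qed.
End SoergelTheory.

(** * Existence, idempotence and uniqueness of the complex *)

Theorem theorem1p12 (n : nat) (hn : (0 < n)%N) :
  exists (P : cpx (polyR n)) (eps : cmap P (conc (breg (polyR n)))),
    [/\ in_Kminus P, resolved_by_Bw0 P, cone_killed_by_Bw0 eps,
        tens_idempotent P
      & forall (P' : cpx (polyR n)) (eps' : cmap P' (conc (breg (polyR n)))),
          in_Kminus P' -> resolved_by_Bw0 P' -> cone_killed_by_Bw0 eps' ->
          exists Phi : cmap P' P,
            [/\ is_hequiv Phi, homotopic (ccomp eps Phi) eps'
              & forall Psi : cmap P' P,
                  homotopic (ccomp eps Psi) eps' -> homotopic Psi Phi]].
Proof.
case: n hn => // m _; have [_ [SF _]] := polyR_frobenius m.
pose S := invariants [set: 'S_m.+1].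
(* The basis is nonempty because 1 expands in it and is not 0. *)
have i0 : fidx SF.
  case: (pickP (fun _ : fidx SF => true)) => [i //|e].
  have := fbasis_expand SF 1; rewrite big_pred0 // => /eqP.
  by rewrite oner_eq0.
have KP : in_Kminus (barc S).
  split; first exact: barc_bounded.
  move=> i /=; case: (lev i) => [k|]; [exact: soergel_bar | exact: soergel_zero].
exists (barc S), (bar_eps S); split=> //.
- exists (barc S); split=> // [i|]; first by apply: ifree_sum_of_Bw0; exact: ifree_barc.
  exists (cid_map _), (cid_map _); split; exact: homotopic_ext.
- by split; [exact: cone_tensr_contractible | exact: cone_tensl_contractible].
- exact: bar_tens_hequiv.
move=> P' eps' [_ sP'] [Q [[bQ _] sQ hQ]] [hr _].
apply: (resolution_unique (S := S)).
- apply: projectively_resolved_refl; first exact: barc_bounded.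
  by move=> i; apply: ifree_projective; exact: ifree_barc.
- exact: exact_cone_bar.
- exact: scentral_cone_bar.
- by exists Q; split=> // i; exact: sum_of_Bw0_projective.
(* [Bw0] is a shift of C, so the cone of eps' is exact after tensoring with C, and the coordinate at
   [i0] brings exactness back to the cone. *)
- exact: (exact_of_ctensr i0 (exact_of_hequiv_zero hr)).
- apply: scentral_cone => i; [exact: soergel_scentral | exact: scentral_conc].
Qed.
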